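(* Let $N\ge 1$, $\alpha>-1$, let $\mu$ be a finite positive Borel measure on $\mathbb{B}_N$ and let $\psi_1$ and $\psi_2$ be two Orlicz functions. Consider the two conditions: $$(R_0)\quad \text{for every } A>0,\ \varrho_\mu(h)=o_{h\to 0}\left(\frac{1}{\psi_2\left(A\psi_1^{-1}(1/h^{N+1+\alpha})\right)}\right),$$ $$(K_0)\quad \text{for every } A>0,\ K_{\mu,\alpha}(h)=o_{h\to 0}\left(\frac{1/h^{N+1+\alpha}}{\psi_2\left(A\psi_1^{-1}(1/h^{N+1+\alpha})\right)}\right).$$ Then: (1) If the inclusion $A_\alpha^{\psi_1}(\mathbb{B}_N)\subset L^{\psi_2}(\mu)$ holds and is compact, then $(R_0)$ holds. (2) If $(K_0)$ holds, then $A_\alpha^{\psi_1}(\mathbb{B}_N)$ embeds compactly in $L^{\psi_2}(\mu)$ (i.e. the inclusion holds and is a compact operator). (3) If in addition $\psi_1=\psi_2=\psi$ satisfies the $\nabla_0$-Condition, then $(R_0)$ and $(K_0)$ are equivalent.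
   Context: $\mathbb{B}_N$ is the open unit ball and $\mathbb{S}_N$ the unit sphere of $\mathbb{C}^N$. An Orlicz function is a strictly convex function $\psi:\mathbb{R}_+\to\mathbb{R}_+$ vanishing at $0$, continuous at $0$, with $\psi(x)/x\to+\infty$ as $x\to\infty$; $\psi^{-1}$ is its inverse. For a finite positive measure $\mu$ on $\Omega$, $L^\psi(\mu)$ is the space of (classes of) measurable $f:\Omega\to\mathbb{C}$ with $\int\psi(|f|/C)\,d\mu<\infty$ for some $C>0$, with the Luxemburg norm $\|f\|_{L^{\psi}(\mu)}=\inf\{C>0:\int\psi(|f|/C)\,d\mu\le 1\}$. For $\alpha>-1$, $dv_\alpha(z)=c_\alpha(1-|z|^2)^\alpha dv(z)$, where $dv$ is normalized Lebesgue volume measure on $\mathbb{B}_N$ and $c_\alpha$ is such that $v_\alpha(\mathbb{B}_N)=1$. $A_\alpha^\psi(\mathbb{B}_N)$ is the space of holomorphic functions on $\mathbb{B}_N$ belonging to $L^\psi(v_\alpha)$, with the norm of $L^\psi(v_\alpha)$. For $\zeta\in\mathbb{S}_N$, $h\in(0,1]$, let $Q(\zeta,h)=\{\xi\in\mathbb{S}_N: |1-\langle\zeta,\xi\rangle|<h\}$ and $W(\zeta,h)=\{z\in\mathbb{B}_N: 1-|z|<h,\ z/|z|\in Q(\zeta,h)\}$ (Carleson window). Define $\varrho_\mu(h)=\sup_{\xi\in\mathbb{S}_N}\mu(W(\xi,h))$ and $K_{\mu,\alpha}(h)=\sup_{0<t\le h}\varrho_\mu(t)/t^{N+1+\alpha}$.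 $\nabla_0$-Condition for $\psi$: there exist $x_0>0$ and $C\ge 1$ such that for all $x_0\le x\le y$, $\psi(2x)/\psi(x)\le\psi(2C y)/\psi(y)$. *)

(* Defs.v *)
From HB Require Import structures.
From mathcomp Require Import all_boot all_order all_algebra complex.
From mathcomp Require Import all_classical all_reals all_analysis.
From mathcomp Require Import measurable_realfun lra.

Set Implicit Arguments.
Unset Strict Implicit.
Unset Printing Implicit Defensive.
Import Order.TTheory GRing.Theory Num.Theory numFieldNormedType.Exports.
Local Open Scope classical_set_scope.
Local Open Scope ring_scope.

(* The topology of C given by the modulus; 'rV[R[i]]_N then gets the usual
   topology of C^N from the library. *)
HB.instance Definition _ (R : realType) := NormedModule.copy R[i] R[i]^o.

Notation borel T := (g_sigma_algebraType (@open T)).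

(* Open intervals: the notation R[i] breaks the parsing of `]a, b[. *)
Definition ooitv (R : realType) (p q : rat) : interval R := Interval (BRight (ratr p)) (BLeft (ratr q)).

Lemma nbhs_complex_rect (R : realType) (c : R[i]) (P : set R[i]) : nbhs c P ->
  exists q : (rat * rat) * (rat * rat),
    (complex.Re c \in ooitv _ q.1.1 q.1.2 /\
     complex.Im c \in ooitv _ q.2.1 q.2.2) /\
    (forall w, complex.Re w \in ooitv _ q.1.1 q.1.2 ->
     complex.Im w \in ooitv _ q.2.1 q.2.2 -> P w).
Proof.
move=> /nbhs_ballP[[e e']]; rewrite /= ltcE /= => /andP[/eqP -> e0] eP.
have [d d0 de] : exists2 d, 0 < d & d = e / 2 by exists (e / 2) => //; lra.
case: c eP => a b eP.
have rat_near x : exists q : rat * rat,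
    ratr q.1 \in Interval (BRight (x - d)) (BLeft x) /\ ratr q.2 \in Interval (BRight x) (BLeft (x+d)).
  have /rat_in_itvoo[q1 hq1] : x - d < x by lra.
  have /rat_in_itvoo[q2 hq2] : x < x + d by lra.
  by exists (q1, q2).
have [qa] := rat_near a; rewrite !in_itv /= => -[/andP[a1 a2] /andP[a3 a4]].
have [qb] := rat_near b; rewrite !in_itv /= => -[/andP[b1 b2] /andP[b3 b4]].
exists (qa, qb); rewrite !in_itv /=; split.
  by rewrite a2 a3 b2 b3.
move=> [u v]; rewrite !in_itv /= => /andP[u1 u2] /andP[v1 v2].
apply: eP; rewrite /ball /= ltcE /= eqxx /=.
have -> : e = Num.sqrt (e ^+ 2) by rewrite sqrtr_sqr gtr0_norm.
rewrite ltr_sqrt ?exprn_gt0//.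
have : (a - u) ^+ 2 < d ^+ 2 by rewrite -ltr_sqrt ?exprn_gt0 // !sqrtr_sqr (gtr0_norm d0) ltr_norml; apply/andP; split; lra.
have : (b - v) ^+ 2 < d ^+ 2 by rewrite -ltr_sqrt ?exprn_gt0 // !sqrtr_sqr (gtr0_norm d0) ltr_norml; apply/andP; split; lra.
by rewrite de; nra.
Qed.

Lemma measurable_fun_rV (R : realType) (N : nat) d (T : measurableType d)
    (f : T -> borel 'rV[R[i]]_N) :
  (forall j, measurable_fun setT (fun t => complex.Re (f t ord0 j))) ->
  (forall j, measurable_fun setT (fun t => complex.Im (f t ord0 j))) ->
  measurable_fun setT f.
Proof.
move=> mRe mIm; apply: (@measurability _ _ T (borel 'rV[R[i]]_N) setT f (@open 'rV[R[i]]_N)) => //.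
move=> _ [U oU <-]; rewrite setTI.
pose rect (q : {ffun 'I_N -> (rat * rat) * (rat * rat)}) :=
  [set z : 'rV[R[i]]_N | forall j,
    complex.Re (z ord0 j) \in ooitv _ (q j).1.1 (q j).1.2 /\
    complex.Im (z ord0 j) \in ooitv _ (q j).2.1 (q j).2.2].
have -> : f @^-1` U =
    \bigcup_q (if `[< rect q `<=` U >] then f @^-1` rect q else set0).
  apply/seteqP; split => [t Ut|t [q _]]; last first.
    by case: asboolP => // qU /= /qU.
  move: oU; rewrite openE => /(_ _ Ut) [P nP PU].
  have /choice[q hq] := fun j => nbhs_complex_rect (nP ord0 j).
  exists [ffun j => q j] => //.
  case: asboolP => [_ j|[]].
    by rewrite ffunE; have [[]] := hq j.
  move=> z zq; apply: PU => i j; rewrite ord1.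
  have [_] := hq j; apply; have := zq j; rewrite ffunE => -[] //.
apply: countable_bigcupT_measurable => [//|q].
case: asboolP => _; last by exact: measurable0.
have -> : f @^-1` rect q = \bigcap_(j in [set: 'I_N])
    ((fun t => complex.Re (f t ord0 j)) @^-1` [set` ooitv _ (q j).1.1 (q j).1.2] `&`
     (fun t => complex.Im (f t ord0 j)) @^-1` [set` ooitv _ (q j).2.1 (q j).2.2]).
  by apply/seteqP; split=> t h j; [move=> _|]; have := h j; [|move=> /(_ I)].
apply: fin_bigcap_measurable => [|j _]; first exact: finite_finset.
by apply: measurableI; rewrite -[X in measurable X]setTI;
  [apply: mRe|apply: mIm].
Qed.

Section measurable_coordinates.
Context (R : realType).

Let continuous_normc (f : R[i] -> R) : {morph f : x y / x - y} ->
  (forall x, `|f x| <= Normc.normc x) -> continuous f.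
Proof.
move=> fB fle c A /nbhs_ballP[e /= e0 eA].
apply/nbhs_ballP; exists (real_complex R e) => /=; first by rewrite ltcR.
move=> w; rewrite /ball /= -[`|c - w|]/(real_complex R _) ltcR => cw.
by apply: eA; rewrite /ball /= -fB (le_lt_trans (fle _)).
Qed.

Lemma continuous_Re : continuous (@complex.Re R).
Proof.
apply: continuous_normc => [[a b] [c d]|[a b]] //=.
by rewrite -sqrtr_sqr ler_wsqrtr// lerDl sqr_ge0.
Qed.

Lemma continuous_Im : continuous (@complex.Im R).
Proof.
apply: continuous_normc => [[a b] [c d]|[a b]] //=.
by rewrite -sqrtr_sqr ler_wsqrtr// lerDr sqr_ge0.
Qed.

Lemma continuous_borel_measurable (T : ptopologicalType) (f : T -> R) :
  continuous f -> @measurable_fun _ _ (borel T) R setT f.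
Proof.
move=> cf; apply: (measurability _ (RGenOInfty.measurableE R)).
move=> _ [_ [a ->] <-]; rewrite setTI; apply: sub_sigma_algebra.
by move/continuousP: cf; apply; exact: interval_open.
Qed.

End measurable_coordinates.

Section tuple_measure.
Context d (T : measurableType d) (R : realType).

Section cons_measure.
Variables (m : {sigma_finite_measure set T -> \bar R}) (n : nat).
Variable mn : {sigma_finite_measure set (n.-tuple T) -> \bar R}.

Definition tuple_cons (p : T * n.-tuple T) : n.+1.-tuple T := [tuple of p.1 :: p.2].

Let measurable_tuple_cons : measurable_fun setT tuple_cons.
Proof. exact: measurable_cons. Qed.

Definition cons_measure : set (n.+1.-tuple T) -> \bar R :=
  pushforward (m \x mn)%E tuple_cons.

HB.instance Definition _ := Measure.copy cons_measure
  (measure_function_pushforward__canonical__measure_function_Measure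
     (m \x mn)%E measurable_tuple_cons).

Let cons_measure_sigma_finite : sigma_finite setT cons_measure.
Proof.
have [F TF Ffin] : sigma_finite setT (m \x mn)%E.
  by case: (lebesgue_integral_fubini.measure_function_Measure_isSigmaFinite__to__measure_function_isSigmaFinite m mn).
exists (fun k => (fun t : n.+1.-tuple T => (thead t, [tuple of behead t])) @^-1` F k).
  by rewrite -preimage_bigcup -TF preimage_setT.
move=> k; have [mF Fk] := Ffin k; split.
  rewrite -[X in measurable X]setTI.
  apply: measurable_fun_pair => //; first exact: measurable_tnth.
  exact: measurable_behead.
rewrite /cons_measure /pushforward.
rewrite [X in ((_ \x _) X < _)%E](_ : _ = F k)//.
apply/seteqP; split => -[x t] /=; rewrite /tuple_cons theadE /=;
  by congr (F k (_, _)); exact: val_inj.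
Qed.

HB.instance Definition _ := Measure_isSigmaFinite.Build _ _ _ cons_measure
  cons_measure_sigma_finite.

End cons_measure.

(* n-fold product measure; the canonical instances of \x in the library do not
   give sigma-finiteness for general factors, hence the detour by cons_measure. *)
Fixpoint tuple_measure (m : {sigma_finite_measure set T -> \bar R}) (n : nat) :
    {sigma_finite_measure set (n.-tuple T) -> \bar R} :=
  match n with
  | 0%N => \d_([tuple] : 0.-tuple T)
  | k.+1 => cons_measure m (tuple_measure m k)
  end.

End tuple_measure.

Section volume.
Context (R : realType) (N : nat).
Notation CN := 'rV[R[i]]_N.

Definition complex_coords (t : (N + N).-tuple R) : borel CN :=
  \row_(j < N) (Complex (tnth t (lshift N j)) (tnth t (rshift N j))).

Let measurable_complex_coords : measurable_fun setT complex_coords.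
Proof.
by apply: measurable_fun_rV => j;
  under eq_fun do rewrite mxE /=; exact: measurable_tnth.
Qed.

(* Lebesgue measure of R^2N transported to C^N, where the first N coordinates
   are the real parts and the last N ones the imaginary parts. *)
Definition lebesgue_Cn : set (borel CN) -> \bar R :=
  pushforward (tuple_measure lebesgue_measure (N + N)) complex_coords.

HB.instance Definition _ := Measure.copy lebesgue_Cn
  (measure_function_pushforward__canonical__measure_function_Measure
     (tuple_measure lebesgue_measure (N + N)) measurable_complex_coords).

(* sum_j z_j * conj(w_j) *)
Definition inner (z w : CN) : R[i] := dotmx z w.

Definition enorm (z : CN) : R := Num.sqrt (complex.Re (inner z z)).

Definition unit_ball : set CN := [set z | enorm z < 1].

Definition unit_sphere : set CN := [set z | enorm z = 1].

Lemma enorm_sqr z : enorm z ^+ 2 =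
  \sum_(j < N) (complex.Re (z ord0 j) ^+ 2 + complex.Im (z ord0 j) ^+ 2).
Proof.
have E : complex.Re (inner z z) =
  \sum_(j < N) (complex.Re (z ord0 j) ^+ 2 + complex.Im (z ord0 j) ^+ 2).
  rewrite /inner dotmxE mxE.
  rewrite (big_morph (@complex.Re R) (id1 := 0) (op1 := +%R)) => [|[? ?] [? ?]|] //.
  apply: eq_bigr => j _; rewrite !mxE; case: (z _ _) => a b /=.
  by rewrite mulrN opprK -!expr2.
rewrite /enorm E sqr_sqrtr// sumr_ge0// => j _.
by rewrite addr_ge0// sqr_ge0.
Qed.

Lemma measurable_enorm_sqr :
  @measurable_fun _ _ (borel CN) R setT (fun z => enorm z ^+ 2).
Proof.
under eq_fun do rewrite enorm_sqr.
apply: measurable_sum => j; apply: measurable_funD; apply: measurable_funX;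
  apply: continuous_borel_measurable => z.
- by apply: continuous_comp; [exact: coord_continuous|exact: continuous_Re].
- by apply: continuous_comp; [exact: coord_continuous|exact: continuous_Im].
Qed.

Lemma measurable_unit_ball : measurable (unit_ball : set (borel CN)).
Proof.
rewrite (_ : unit_ball = (fun z => enorm z ^+ 2) @^-1` [set` Interval -oo%O (BLeft 1)]).
  by rewrite -[X in measurable X]setTI; exact: measurable_enorm_sqr.
apply/seteqP; split => z; rewrite /= in_itv /=;
  by rewrite -[X in _ < X](expr1n _ 2) ltr_pXn2r// nnegrE ?sqrtr_ge0// ler01.
Qed.

Lemma inv_fine_measure_ge0 (m : {measure set (borel CN) -> \bar R}) A :
  0 <= (fine (m A))^-1 :> R.
Proof. by rewrite invr_ge0 fine_ge0. Qed.

(* dv: Lebesgue measure restricted to the ball, scaled to total mass 1. *)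
Definition volume : set (borel CN) -> \bar R :=
  mscale (NngNum (inv_fine_measure_ge0 lebesgue_Cn unit_ball))
         (mrestr lebesgue_Cn measurable_unit_ball).

HB.instance Definition _ := Measure.on volume.

Variable alpha : R.

(* volume is carried by the ball, so the integrals below do not see the values
   of the density outside the ball. *)
Definition c_alpha : R :=
  (fine (\int[volume]_z ((1 - enorm z ^+ 2) `^ alpha)%:E)%E)^-1.

Definition bergman_density (z : borel CN) : \bar R :=
  (c_alpha * (1 - enorm z ^+ 2) `^ alpha)%:E.

Let measurable_density : measurable_fun setT bergman_density.
Proof.
apply/measurable_EFinP; apply: measurable_funM => //.
apply: (measurableT_comp (@measurable_powR R alpha)).
by apply: measurable_funB => //; exact: measurable_enorm_sqr.
Qed.

Let bergman_density_ge0 z : (0 <= bergman_density z)%E.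
Proof.
rewrite lee_fin mulr_ge0 ?powR_ge0// invr_ge0 fine_ge0// integral_ge0// => x _.
by rewrite lee_fin powR_ge0.
Qed.

Definition v_alpha : set (borel CN) -> \bar R :=
  fun A => (\int[volume]_(z in A) bergman_density z)%E.

Let v_alpha0 : v_alpha set0 = 0%E.
Proof. by rewrite /v_alpha integral_set0. Qed.

Let v_alpha_ge0 A : (0 <= v_alpha A)%E.
Proof. by apply: integral_ge0. Qed.

Let v_alpha_sigma_additive : semi_sigma_additive v_alpha.
Proof.
move=> F mF tF mUF; rewrite /v_alpha ge0_integral_bigcup//; last first.
  exact: measurable_funS measurable_density.
by apply: is_cvg_ereal_nneg_natsum => n _; exact: integral_ge0.
Qed.

HB.instance Definition _ := isMeasure.Build _ _ _ v_alpha
  v_alpha0 v_alpha_ge0 v_alpha_sigma_additive.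

End volume.

Section luxemburg.
Context d (T : measurableType d) (R : realType).
Variables (mu : {measure set T -> \bar R}) (D : set T) (psi : R -> R).

Definition orlicz_modular (f : T -> R[i]) (C : R) : \bar R :=
  (\int[mu]_(x in D) (psi (Normc.normc (f x) / C))%:E)%E.

Definition orlicz_space (f : T -> R[i]) : Prop :=
  @measurable_fun _ _ T (borel R[i]) D f /\
  exists2 C, 0 < C & (orlicz_modular f C < +oo)%E.

Definition luxemburg (f : T -> R[i]) : \bar R :=
  ereal_inf [set C%:E | C in [set C | 0 < C /\ (orlicz_modular f C <= 1)%E]].

(* Functions are not identified almost everywhere: the Luxemburg norm is only a
   seminorm on orlicz_type. Its topology is the inverse image of that of the
   quotient, so compactness is not affected. *)
Definition orlicz_type : Type := {f : T -> R[i] | orlicz_space f}.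

HB.instance Definition _ := gen_eqMixin orlicz_type.
HB.instance Definition _ := gen_choiceMixin orlicz_type.

Definition luxemburg_open (U : set orlicz_type) : Prop :=
  forall f, U f -> exists2 e, 0 < e & forall g : orlicz_type,
    (luxemburg (fun x => sval g x - sval f x)%R < e%:E)%E -> U g.

Let luxemburg_openT : luxemburg_open setT.
Proof. by move=> f _; exists 1. Qed.

Let luxemburg_openI : setI_closed luxemburg_open.
Proof.
move=> U V oU oV f [/oU[e e0 Ue] /oV[e' e'0 Ve']].
exists (Num.min e e') => [|g gf]; first by rewrite lt_min e0.
by split; [apply: Ue|apply: Ve']; apply: (lt_le_trans gf);
  rewrite lee_fin ge_min lexx ?orbT.
Qed.

Let luxemburg_open_bigcup (I : Type) (U : I -> set orlicz_type) :
  (forall i, luxemburg_open (U i)) -> luxemburg_open (\bigcup_i U i).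
Proof.
move=> oU f [i _ /oU[e e0 Ue]]; exists e => // g gf.
by exists i => //; exact: Ue.
Qed.

HB.instance Definition _ := isOpenTopological.Build orlicz_type
  luxemburg_openT luxemburg_openI luxemburg_open_bigcup.

End luxemburg.

Section orlicz_function.
Context (R : realType).
Implicit Type psi : R -> R.

(* Functions on R_+ are total functions on R whose values at negative numbers
   are never used. *)
Definition orlicz_function psi : Prop :=
  [/\ forall x, 0 <= x -> 0 <= psi x,
      psi 0 = 0,
      forall x y t, 0 <= x -> 0 <= y -> x != y -> 0 < t < 1 ->
        psi (t * x + (1 - t) * y) < t * psi x + (1 - t) * psi y,
      psi x @[x --> 0^'+] --> psi 0 &
      psi x / x @[x --> +oo] --> +oo].

(* Inverse of psi as a map from [0, +oo[ to itself. *)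
Definition orlicz_inv psi : R -> R := pinv [set x : R | 0 <= x] psi.

Definition nabla0 psi : Prop :=
  exists2 x0, 0 < x0 & exists2 C, 1 <= C & forall x y, x0 <= x -> x <= y ->
    psi (2 * x) / psi x <= psi (2 * C * y) / psi y.

End orlicz_function.

Section bergman_orlicz.
Context (R : realType) (N : nat).
Notation CN := 'rV[R[i]]_N.
Variable alpha : R.

(* differentiable is with respect to the scalar field R[i], i.e. complex. *)
Definition holomorphic_on (U : set CN) (f : CN -> R[i]) : Prop :=
  forall z, U z -> differentiable f z.

Definition bergman_orlicz (psi : R -> R) (f : CN -> R[i]) : Prop :=
  holomorphic_on (@unit_ball R N) f /\
  orlicz_space (@v_alpha R N alpha) (@unit_ball R N) psi f.

Definition bergman_norm (psi : R -> R) (f : CN -> R[i]) : \bar R :=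
  luxemburg (@v_alpha R N alpha) (@unit_ball R N) psi f.

Variable mu : {measure set (borel CN) -> \bar R}.

Definition bergman_embeds (psi1 psi2 : R -> R) : Prop :=
  forall f, bergman_orlicz psi1 f -> orlicz_space mu (@unit_ball R N) psi2 f.

(* The set of the g whose underlying function is in the unit ball of the Bergman
   space is the image of this unit ball by the inclusion. *)
Definition compact_inclusion (psi1 psi2 : R -> R) : Prop :=
  compact (closure [set g : orlicz_type mu (@unit_ball R N) psi2 |
    bergman_orlicz psi1 (sval g) /\ (bergman_norm psi1 (sval g) <= 1)%E]).

Definition embeds_compactly (psi1 psi2 : R -> R) : Prop :=
  bergman_embeds psi1 psi2 /\ compact_inclusion psi1 psi2.

Definition nonisotropic_ball (zeta : CN) (h : R) : set CN :=
  [set xi | unit_sphere xi /\ Normc.normc (1 - inner zeta xi) < h].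

Definition carleson_window (zeta : CN) (h : R) : set CN :=
  [set z | [/\ unit_ball z, 1 - enorm z < h &
     nonisotropic_ball zeta h ((real_complex R (enorm z))^-1 *: z)]].

Definition varrho (h : R) : \bar R :=
  ereal_sup [set mu (carleson_window xi h) | xi in @unit_sphere R N].

(* Extended-real valued: the supremum may be infinite. *)
Definition K_mu (h : R) : \bar R :=
  ereal_sup [set (varrho t * ((t `^ (N%:R + 1 + alpha))^-1)%:E)%E
            | t in [set t | 0 < t <= h]].

Definition little_o_at0 (f : R -> \bar R) (g : R -> R) : Prop :=
  forall eps, 0 < eps ->
    \forall h \near 0^'+, (`|f h| <= (eps * `|g h|)%:E)%E.

Definition cond_R0 (psi1 psi2 : R -> R) : Prop := forall A, 0 < A ->
  little_o_at0 varrho (fun h =>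
    1 / psi2 (A * orlicz_inv psi1 (1 / h `^ (N%:R + 1 + alpha)))).

Definition cond_K0 (psi1 psi2 : R -> R) : Prop := forall A, 0 < A ->
  little_o_at0 K_mu (fun h => (1 / h `^ (N%:R + 1 + alpha)) /
    psi2 (A * orlicz_inv psi1 (1 / h `^ (N%:R + 1 + alpha)))).

End bergman_orlicz.

(* Main.v *)
(* The local sub-mean value inequality psi (|f z|) <= C (1 - |z|^2)^-(N+1+alpha) times the
   integral of psi (|f|) over a non-isotropic neighborhood of z bounds f pointwise and,
   by Tonelli, turns the integral of psi2 (|f|) over the shell r < |z| < 1 into an integral
   of psi1 (|f|) against a quotient controlled by the mass of Carleson windows; under
   (K0) this tail is small uniformly on the unit ball of the Bergman-Orlicz space.
   Together with equicontinuity on the smaller balls, every ultrafilter on the unit ball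
   converges in L^psi2 to its pointwise limit, which is compactness.

   Conversely, if (R0) fails along windows W(xi_n, h_n), the functions
   c psi1^-1(h_n^-s) (h_n / (1 - <z, (1 - h_n) xi_n>))^m with s = N + 1 + alpha are in the
   unit ball, tend to 0 pointwise, and are large on these windows; by
   Fatou's lemma a cluster point would be 0 mu-almost everywhere, which their size on
   the windows forbids.

   Under the nabla_0 condition, iterated as psi (2^n x) / psi x <= psi ((2C)^n y) / psi y,
   (R0) at a scale t <= h gives (K0) at the scale h. *)

Require Import Defs.
From HB Require Import structures.
From mathcomp Require Import all_boot all_order all_algebra complex.
From mathcomp Require Import all_classical all_reals all_analysis.
From mathcomp Require Import measurable_realfun ring lra.
Set Implicit Arguments.
Unset Strict Implicit.
Unset Printing Implicit Defensive.
Import Order.TTheory GRing.Theory Num.Theory numFieldNormedType.Exports.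
Local Open Scope classical_set_scope.
Local Open Scope ring_scope.

(** * Orlicz functions and Luxemburg norms *)

(** For the two compactness statements no growth condition is assumed, so a constant leaves the
    argument of psi only through psi (t x) <= t psi x for t <= 1; any other constant stays inside,
    where the quantifier over all A in (R0) and (K0), or the free scale of the Luxemburg norm,
    absorbs it. This licenses crude inequalities. The mean value inequality is taken on squares and
    loses a factor 16 per complex variable inside psi. It follows from Goursat's theorem on
    rectangles by averaging over the half side, and is iterated along N complex lines with Jensen's
    inequality at each step, so that neither polar coordinates nor pi nor the subharmonicity of psi
    (|f|) enters. For the same reason smallness in L^psi2 is always stated as modular at most 1 at a
    prescribed scale e: a modular tending to 0 at a single scale would not give norm convergence.
    Volumes are also computed in real coordinates; since the weight blows up at the sphere when
    alpha < 0, one real coordinate bounded away from 0 is singled out and integrated by a dyadic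
    argument. *)

Section orlicz_functions.
Context (R : realType) (psi : R -> R) (hpsi : orlicz_function psi).

Lemma orlicz_ge0 x : 0 <= x -> 0 <= psi x.
Proof. by case: hpsi => h _ _ _ _; exact: h. Qed.

Lemma orlicz_0 : psi 0 = 0.
Proof. by case: hpsi. Qed.

Lemma orlicz_convex x y t : 0 <= x -> 0 <= y -> 0 <= t <= 1 ->
  psi (t * x + (1 - t) * y) <= t * psi x + (1 - t) * psi y.
Proof.
case: hpsi => _ _ h _ _ x0 y0 /andP[t0 t1].
have [->|xy] := eqVneq x y; first by rewrite -!mulrDl addrC subrK !mul1r.
move: t0; rewrite le_eqVlt => /predU1P[<-|t0]; first by rewrite !mul0r !add0r subr0 !mul1r.
move: t1; rewrite le_eqVlt => /predU1P[->|t1]; first by rewrite subrr !mul0r !addr0 !mul1r.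
by apply/ltW/h; rewrite // t0.
Qed.

Lemma orlicz_scale t x : 0 <= t <= 1 -> 0 <= x -> psi (t * x) <= t * psi x.
Proof.
by move=> t01 x0; have := orlicz_convex x0 (lexx 0) t01; rewrite orlicz_0 !mulr0 !addr0.
Qed.

(** Strict convexity between 0 and y gives 0 <= psi (y / 2) < psi y / 2, hence psi y > 0; then psi x
    < (x / y) psi y <= psi y when x > 0. *)
Lemma orlicz_lt x y : 0 <= x -> x < y -> psi x < psi y.
Proof.
move=> x0 xy; have y0 : 0 < y by exact: le_lt_trans xy.
have psiy : 0 < psi y.
  case: hpsi => h _ hc _ _.
  have : psi (2^-1 * y + (1 - 2^-1) * 0) < 2^-1 * psi y + (1 - 2^-1) * psi 0.
    by apply: hc => //; [exact: ltW|rewrite gt_eqF|apply/andP; split; lra].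
  rewrite orlicz_0 !mulr0 !addr0 => /(le_lt_trans (h _ _)).
  by rewrite pmulr_rgt0; [apply; rewrite mulr_ge0 ?ltW|]; lra.
have [->|xN0] := eqVneq x 0; first by rewrite orlicz_0.
case: hpsi => _ _ hc _ _.
have : psi (x / y * y + (1 - x / y) * 0) < x / y * psi y + (1 - x / y) * psi 0.
  apply: hc => //; [exact: ltW|by rewrite gt_eqF|].
  by rewrite ltr_pdivrMr// mul1r xy andbT divr_gt0// lt_def xN0.
rewrite orlicz_0 !mulr0 !addr0 divfK ?gt_eqF// => /lt_le_trans; apply.
by rewrite ger_pMl// ler_pdivrMr// mul1r ltW.
Qed.

Lemma orlicz_gt0 x : 0 < x -> 0 < psi x.
Proof. by move=> /(orlicz_lt (lexx 0)); rewrite orlicz_0. Qed.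

Lemma orlicz_le x y : 0 <= x -> x <= y -> psi x <= psi y.
Proof.
by move=> x0; rewrite le_eqVlt => /predU1P[->//|xy]; exact/ltW/orlicz_lt.
Qed.

Lemma orlicz_le_inv x y : 0 <= y -> psi x <= psi y -> x <= y.
Proof. by move=> y0; apply: contraTle => yx; rewrite -ltNge orlicz_lt. Qed.

Lemma orlicz_inj x y : 0 <= x -> 0 <= y -> psi x = psi y -> x = y.
Proof.
move=> x0 y0 e; apply/eqP; rewrite eq_le.
by apply/andP; split; apply: orlicz_le_inv; rewrite // e.
Qed.

(** The slope on [x, y] is at most the slope on [x, M + 1], an interval of length at least 1. Local
    Lipschitz continuity of psi follows. *)
Lemma orlicz_chord_le x y M : 0 <= x -> x <= y -> y <= M ->
  psi y - psi x <= (y - x) * psi (M + 1).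
Proof.
move=> x0 xy yM; have d : 0 < M + 1 - x by lra.
pose t := (y - x) / (M + 1 - x).
have t0 : 0 <= t by rewrite divr_ge0//; lra.
have tyx : t <= y - x by rewrite ler_pdivrMr// ler_peMr//; lra.
have t1 : t <= 1 by rewrite ler_pdivrMr//; lra.
have : psi (t * (M + 1) + (1 - t) * x) <= t * psi (M + 1) + (1 - t) * psi x.
  by apply: orlicz_convex; rewrite ?t0//; lra.
have -> : t * (M + 1) + (1 - t) * x = y.
  have -> : t * (M + 1) + (1 - t) * x = x + t * (M + 1 - x) by ring.
  by rewrite /t divfK ?gt_eqF//; ring.
move=> h; apply: (@le_trans _ _ (t * psi (M + 1))).
  have : 0 <= t * psi x by rewrite mulr_ge0// orlicz_ge0.
  by move: h; rewrite mulrBl mul1r; lra.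
by rewrite ler_wpM2r// orlicz_ge0//; lra.
Qed.

Lemma orlicz_lipschitz M x y : 0 <= x -> x <= M -> 0 <= y -> y <= M ->
  `|psi y - psi x| <= `|y - x| * psi (M + 1).
Proof.
move=> x0 xM y0 yM; have [xy|/ltW yx] := leP x y.
  by rewrite !ger0_norm ?subr_ge0 ?orlicz_le//; exact: orlicz_chord_le.
rewrite distrC [in leRHS]distrC !ger0_norm ?subr_ge0 ?orlicz_le//.
exact: orlicz_chord_le.
Qed.

(** The values of psi at negative numbers are arbitrary; clamping the argument gives a function
    continuous, hence measurable, on the whole line. *)
Definition orlicz_ext x := psi (Num.max 0 x).

Lemma orlicz_extE x : 0 <= x -> orlicz_ext x = psi x.
Proof. by move=> x0; rewrite /orlicz_ext (max_idPr _). Qed.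

Lemma continuous_orlicz_ext : continuous orlicz_ext.
Proof.
move=> x; apply/cvgrPdist_lt => e e0.
pose M := Num.max 0 x + 1.
have C0 : 0 < psi (M + 1).
  apply: orlicz_gt0; have : 0 <= Num.max 0 x by rewrite le_max lexx.
  rewrite /M; lra.
near=> y; rewrite /orlicz_ext.
have xy : `|x - y| < Num.min 1 (e / psi (M + 1)).
  near: y; exists (Num.min 1 (e / psi (M + 1))) => //=; by rewrite lt_min ltr01 divr_gt0.
have [xy1 xy2] : `|x - y| < 1 /\ `|x - y| < e / psi (M + 1).
  by move: xy; rewrite lt_min => /andP.
have dmax : `|Num.max 0 x - Num.max 0 y| <= `|x - y|.
  rewrite /Num.max; case: ifPn => a; case: ifPn => b; rewrite ?subrr ?normr0 ?normr_ge0//.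
  - rewrite subr0 -leNgt in b *; rewrite !gtr0_norm//; [|lra]; lra.
  - rewrite -leNgt in a; rewrite sub0r normrN gtr0_norm// ler_normr.
    apply/orP; right; lra.
apply: le_lt_trans (orlicz_lipschitz (M := M) _ _ _ _) _.
- by rewrite le_max lexx.
- rewrite /M /Num.max; move: xy1; rewrite ltr_norml => /andP[? ?].
  by case: ifPn => a; case: ifPn => b; rewrite -?leNgt in a b; lra.
- by rewrite le_max lexx.
- by rewrite /M lerDl.
rewrite (le_lt_trans (ler_wpM2r _ dmax)) ?ltW//.
by rewrite -ltr_pdivlMr.
Unshelve. all: by end_near. Qed.

Lemma measurable_orlicz_ext : measurable_fun setT orlicz_ext.
Proof. exact: continuous_measurable_fun continuous_orlicz_ext. Qed.

(** Convexity and psi 0 = 0 already give psi k >= k psi 1 for k >= 1. *)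
Lemma orlicz_unbounded y : exists2 x, 0 <= x & y <= psi x.
Proof.
have p1 : 0 < psi 1 by exact: orlicz_gt0.
pose k := Num.max 1 (y / psi 1).
have k1 : 1 <= k by rewrite le_max lexx.
exists k; first lra.
have := @orlicz_scale k^-1 k; rewrite mulVf ?gt_eqF//; [|lra].
move=> h; have {h} : psi 1 <= k^-1 * psi k.
  by apply: h; rewrite ?invr_ge0 ?invf_le1//; lra.
move=> h; apply: (@le_trans _ _ (k * psi 1)).
  by rewrite -ler_pdivrMr// le_max lexx orbT.
by rewrite -ler_pdivlMl//; lra.
Qed.

Lemma orlicz_surj y : 0 <= y -> exists2 x, 0 <= x & psi x = y.
Proof.
move=> y0; have [M M0 yM] := orlicz_unbounded y.
have cts : {within `[0, M], continuous orlicz_ext}.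
  by apply: continuous_subspaceT => ?; exact: continuous_orlicz_ext.
have : Num.min (orlicz_ext 0) (orlicz_ext M) <= y <= Num.max (orlicz_ext 0) (orlicz_ext M).
  rewrite !orlicz_extE// orlicz_0 (min_idPl _) ?orlicz_ge0// y0 /=.
  by rewrite le_max yM orbT.
move=> /(IVT M0 cts)[c]; rewrite in_itv/= => /andP[c0 cM] cy.
by exists c => //; rewrite -orlicz_extE.
Qed.

Lemma orlicz_invP y : 0 <= y -> 0 <= orlicz_inv psi y /\ psi (orlicz_inv psi y) = y.
Proof.
move=> y0; have [x x0 xy] := orlicz_surj y0.
have himg : (psi @` [set x | 0 <= x]) y by exists x.
split; last by apply: pinvK; rewrite inE.
by have : [set x : R | 0 <= x] (orlicz_inv psi y) by apply: funS.
Qed.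

End orlicz_functions.

Section orlicz_jensen.
Context (R : realType) (psi : R -> R) (hpsi : orlicz_function psi).

Lemma orlicz_slopes x y z : 0 <= x -> x < y -> y < z ->
  (psi y - psi x) / (y - x) <= (psi z - psi y) / (z - y).
Proof.
move=> x0 xy yz; have zx : 0 < z - x by lra.
have [yx0 zy0] : 0 < y - x /\ 0 < z - y by split; lra.
pose t := (z - y) / (z - x).
have : psi (t * x + (1 - t) * z) <= t * psi x + (1 - t) * psi z.
  apply: orlicz_convex => //; first lra.
  by apply/andP; split; rewrite /t ?ler_pdivrMr ?ler_pdivlMr//; lra.
have -> : t * x + (1 - t) * z = y by rewrite /t; field; rewrite gt_eqF.
have -> : t * psi x + (1 - t) * psi z =
   ((z - y) * psi x + (y - x) * psi z) / (z - x).
  by rewrite /t; field; rewrite gt_eqF.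
rewrite ler_pdivlMr// => h.
by rewrite ler_pdivrMr// mulrAC ler_pdivlMr//; lra.
Qed.

(** The slope m of the supporting line is the supremum of the slopes to the left of y0, which every
    slope to the right bounds; it is nonnegative because the slope from 0 is. *)
Lemma orlicz_support y0 : 0 < y0 -> exists2 m, 0 <= m &
  forall y, 0 <= y -> psi y0 + m * (y - y0) <= psi y.
Proof.
move=> y00; pose E := [set (psi y0 - psi x) / (y0 - x) | x in [set x | 0 <= x < y0]].
have ubE y : y0 < y -> ubound E ((psi y - psi y0) / (y - y0)).
  by move=> y0y _ [x /andP[x0 xy0] <-]; exact: orlicz_slopes.
have E0 : E ((psi y0 - psi 0) / (y0 - 0)) by exists 0 => //=; rewrite lexx.
have supE : has_sup E.
  split; first by eexists; exact: E0.
  by exists ((psi (y0 + 1) - psi y0) / (y0 + 1 - y0)); apply: ubE; lra.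
exists (sup E).
  apply: le_trans (ub_le_sup (proj2 supE) E0).
  by rewrite orlicz_0// !subr0 divr_ge0 ?orlicz_ge0// ltW.
move=> y ygt0; have [yy0|yy0|->] := ltgtP y y0; last by rewrite subrr mulr0 addr0.
  have : (psi y0 - psi y) / (y0 - y) <= sup E.
    by apply: ub_le_sup => //; [case: supE|exists y => //=; rewrite ygt0].
  by rewrite ler_pdivrMr; lra.
have : sup E <= (psi y - psi y0) / (y - y0).
  by apply: ge_sup; [case: supE|exact: ubE].
by rewrite ler_pdivlMr; lra.
Qed.

Context d (T : measurableType d).

Lemma measurable_orlicz_comp (D : set T) (g : T -> R) : measurable D ->
  measurable_fun D g -> (forall x, D x -> 0 <= g x) ->
  measurable_fun D (fun x => psi (g x)).
Proof.
move=> mD mg g0; apply: (eq_measurable_fun (fun x => orlicz_ext psi (g x))).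
  by move=> x; rewrite inE => Dx; rewrite orlicz_extE// g0.
exact: measurableT_comp (measurable_orlicz_ext hpsi) mg.
Qed.

(** The supporting line at y0 has intercept -kap <= 0 because psi 0 = 0. A total mass smaller than 1
    therefore only helps, and a lower bound y0 for the mean suffices, which is the form a sub-mean
    value inequality provides. *)
Lemma orlicz_jensen (nu : {measure set T -> \bar R}) (D : set T) (k y0 : R)
    (g : T -> R) : measurable D -> 0 <= k -> (k%:E * nu D <= 1)%E ->
  measurable_fun D g -> (forall x, D x -> 0 <= g x) -> 0 <= y0 ->
  (y0%:E <= k%:E * \int[nu]_(x in D) (g x)%:E)%E ->
  ((psi y0)%:E <= k%:E * \int[nu]_(x in D) (psi (g x))%:E)%E.
Proof.
move=> mD k0 knu mg g0; rewrite le_eqVlt => /predU1P[<- _|y00 hy0].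
  rewrite orlicz_0// mule_ge0 ?lee_fin// integral_ge0// => x Dx.
  by rewrite lee_fin orlicz_ge0// g0.
have [m m0 hm] := orlicz_support y00.
pose kap := m * y0 - psi y0.
have kap0 : 0 <= kap.
  by have := hm 0 (lexx _); rewrite orlicz_0// /kap; lra.
have mpg := measurable_orlicz_comp mD mg g0.
have pg0 x : D x -> (0 <= (psi (g x))%:E)%E.
  by move=> Dx; rewrite lee_fin orlicz_ge0// g0.
suff : ((m * y0)%:E <= k%:E * \int[nu]_(x in D) (psi (g x))%:E + kap%:E)%E.
  by rewrite -leeBlDr// -EFinB /kap opprB addrC subrK.
rewrite EFinM; apply: (@le_trans _ _ (m%:E * (k%:E * \int[nu]_(x in D) (g x)%:E))%E).
  by apply: lee_wpmul2l; rewrite ?lee_fin.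
have -> : (m%:E * (k%:E * \int[nu]_(x in D) (g x)%:E) =
    k%:E * \int[nu]_(x in D) (m%:E * (g x)%:E))%E.
  by rewrite muleCA ge0_integralZl//; exact/measurable_EFinP.
apply: (@le_trans _ _ (k%:E * \int[nu]_(x in D) ((psi (g x))%:E + kap%:E))%E).
  apply: lee_wpmul2l; first by rewrite lee_fin.
  apply: ge0_le_integral => //.
  - by move=> x Dx; rewrite mule_ge0// lee_fin// g0.
  - by apply/measurable_EFinP; apply: measurable_funM.
  - apply: emeasurable_funD => //; exact/measurable_EFinP.
  - move=> x Dx; rewrite -EFinM -EFinD lee_fin.
    by have := hm (g x) (g0 _ Dx); rewrite /kap; lra.
rewrite ge0_integralD//; last exact/measurable_EFinP.
rewrite integral_cst// ge0_muleDr ?mule_ge0 ?lee_fin ?integral_ge0//.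
by rewrite leeD2l// muleCA -[leRHS]mule1 lee_wpmul2l ?lee_fin.
Qed.

End orlicz_jensen.

Section normc_facts.
Context (R : realType).
Implicit Types x y z : R[i].
Local Notation normc := Normc.normc.

Lemma normc_ge0 x : 0 <= normc x.
Proof. by case: x => a b; rewrite sqrtr_ge0. Qed.

Lemma normcD_le x y : normc (x + y) <= normc x + normc y.
Proof. exact: le_normcD. Qed.

Lemma normcB_sym x y : normc (x - y) = normc (y - x).
Proof. by rewrite -normcN opprB. Qed.

Lemma normcB_tri x y z : normc (x - z) <= normc (x - y) + normc (y - z).
Proof. by rewrite -[x - z](subrK y (x - z)) [X in normc X](_ : _ = (x - y) + (y - z)) ?normcD_le//; ring. Qed.

Lemma normc_le_ReIm x : normc x <= `|complex.Re x| + `|complex.Im x|.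
Proof.
case: x => a b /=; rewrite -[leRHS]ger0_norm ?addr_ge0// -sqrtr_sqr.
rewrite ler_wsqrtr// sqrrD !real_normK ?num_real// lerD2r lerDl.
by rewrite mulrn_wge0// mulr_ge0.
Qed.

Lemma Re_le_normc x : `|complex.Re x| <= normc x.
Proof. by case: x => a b /=; rewrite -sqrtr_sqr ler_wsqrtr// lerDl sqr_ge0. Qed.

Lemma Im_le_normc x : `|complex.Im x| <= normc x.
Proof. by case: x => a b /=; rewrite -sqrtr_sqr ler_wsqrtr// lerDr sqr_ge0. Qed.

Lemma normcE_ReIm x : normc x = Num.sqrt (complex.Re x ^+ 2 + complex.Im x ^+ 2).
Proof. by case: x. Qed.

Lemma normc_sqr x : normc x ^+ 2 = complex.Re x ^+ 2 + complex.Im x ^+ 2.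
Proof. by rewrite normcE_ReIm sqr_sqrtr// addr_ge0// sqr_ge0. Qed.

Lemma normc_real (r : R) : normc (real_complex R r) = `|r|.
Proof. by rewrite /= expr0n/= addr0 sqrtr_sqr. Qed.

Lemma normcX x n : normc (x ^+ n) = normc x ^+ n.
Proof. by elim: n => [|n IH]; rewrite ?expr0 ?Normc.normc1// !exprS Normc.normcM IH. Qed.

Lemma normc_gt0 x : (0 < normc x) = (x != 0).
Proof.
rewrite lt_def normc_ge0 andbT; congr (~~ _).
by apply/eqP/eqP => [/Normc.eq0_normc//|->]; exact: Normc.normc0.
Qed.

Context d (T : measurableType d).

Lemma measurable_Re (D : set T) (f : T -> borel R[i]) : measurable_fun D f ->
  measurable_fun D (fun t => complex.Re (f t)).
Proof.
apply: measurableT_comp; apply: continuous_borel_measurable.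
exact: continuous_Re.
Qed.

Lemma measurable_Im (D : set T) (f : T -> borel R[i]) : measurable_fun D f ->
  measurable_fun D (fun t => complex.Im (f t)).
Proof.
apply: measurableT_comp; apply: continuous_borel_measurable.
exact: continuous_Im.
Qed.

Lemma measurable_normcB (D : set T) (f g : T -> borel R[i]) :
  measurable_fun D f -> measurable_fun D g ->
  measurable_fun D (fun t => normc ((f t : R[i]) - g t)).
Proof.
move=> mf mg; under eq_fun do rewrite normcE_ReIm.
apply: (measurableT_comp (continuous_measurable_fun (@sqrt_continuous R))).
have ReB (u v : R[i]) : complex.Re (u - v) = complex.Re u - complex.Re v by case: u; case: v.
have ImB (u v : R[i]) : complex.Im (u - v) = complex.Im u - complex.Im v by case: u; case: v.
apply: measurable_funD; apply: measurable_funX.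
- by under eq_fun do rewrite ReB; apply: measurable_funB; exact: measurable_Re.
- by under eq_fun do rewrite ImB; apply: measurable_funB; exact: measurable_Im.
Qed.

Lemma measurable_normc (D : set T) (f : T -> borel R[i]) : measurable_fun D f ->
  measurable_fun D (fun t => normc (f t)).
Proof.
move=> mf; have := measurable_normcB mf (@measurable_cst _ _ T (borel R[i]) D (0 : R[i])).
by under eq_fun do rewrite subr0.
Qed.

End normc_facts.

(** * Modulars and neighborhoods for the Luxemburg seminorm *)

Section luxemburg_facts.
Context d (T : measurableType d) (R : realType).
Variables (mu : {measure set T -> \bar R}) (D : set T) (mD : measurable D).
Variables (psi : R -> R) (hpsi : orlicz_function psi).
Implicit Types f g h : T -> R[i].
Local Notation normc := Normc.normc.
Local Notation mod_ := (orlicz_modular mu D psi).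
Local Notation mfun f := (@measurable_fun _ _ T (borel R[i]) D f).
Local Notation mnormc f := (measurable_fun D (fun t => normc (f t))).

Lemma measurable_psi_normc f C : 0 < C -> mnormc f ->
  measurable_fun D (fun t => psi (normc (f t) / C)).
Proof.
move=> C0 mf; apply: measurable_orlicz_comp => //; first exact: measurable_funM.
by move=> t _; rewrite divr_ge0 ?normc_ge0// ltW.
Qed.

Lemma psi_normc_ge0 (z : R[i]) C : 0 < C -> (0 <= (psi (normc z / C))%:E)%E.
Proof. by move=> C0; rewrite lee_fin orlicz_ge0// divr_ge0 ?normc_ge0// ltW. Qed.

Lemma modular_le f C C' : 0 < C -> C <= C' -> mnormc f -> (mod_ f C' <= mod_ f C)%E.
Proof.
move=> C0 CC' mf; have C'0 : 0 < C' by exact: lt_le_trans CC'.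
apply: ge0_le_integral => //.
- by move=> t _; exact: psi_normc_ge0.
- by apply/measurable_EFinP; exact: measurable_psi_normc.
- by apply/measurable_EFinP; exact: measurable_psi_normc.
- move=> t _; rewrite lee_fin orlicz_le// ?divr_ge0 ?normc_ge0// ?(ltW C'0)//.
  by rewrite ler_wpM2l ?normc_ge0// lef_pV2.
Qed.

Lemma modular_scale f C t : 0 < C -> 0 < t <= 1 -> mnormc f ->
  (mod_ f (C / t) <= t%:E * mod_ f C)%E.
Proof.
move=> C0 /andP[t0 t1] mf; rewrite -ge0_integralZl//; first last.
- by rewrite lee_fin ltW.
- by move=> x _; exact: psi_normc_ge0.
- by apply/measurable_EFinP; exact: measurable_psi_normc.
have Ct0 : 0 < C / t by rewrite divr_gt0.
apply: ge0_le_integral => //.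
- by move=> x _; exact: psi_normc_ge0.
- by apply/measurable_EFinP; exact: measurable_psi_normc.
- by apply/measurable_EFinP; apply: measurable_funM => //; exact: measurable_psi_normc.
- move=> x _; rewrite -EFinM lee_fin.
  have -> : normc (f x) / (C / t) = t * (normc (f x) / C) by field; rewrite !gt_eqF.
  by rewrite orlicz_scale// ?(ltW t0)// divr_ge0 ?normc_ge0// ltW.
Qed.

(** Triangle inequality of the Luxemburg norm: |f - h| / (a + b) is at most the mean of |f - g| / a
    and |g - h| / b with weights a / (a + b) and b / (a + b), to which convexity applies. *)
Lemma modular_tri f g h a b : 0 < a -> 0 < b ->
  mfun f -> mfun g -> mfun h ->
  (mod_ (fun t => f t - g t)%R a <= 1)%E -> (mod_ (fun t => g t - h t)%R b <= 1)%E ->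
  (mod_ (fun t => f t - h t)%R (a + b) <= 1)%E.
Proof.
move=> a0 b0 mf mg mh ha hb.
have ab0 : 0 < a + b by exact: addr_gt0.
pose s := a / (a + b).
have s01 : 0 <= s <= 1.
  by rewrite /s; apply/andP; split; rewrite ?ler_pdivrMr ?ler_pdivlMr//; lra.
have s1 : 1 - s = b / (a + b) by rewrite /s; field; rewrite gt_eqF.
have m1 := measurable_psi_normc a0 (measurable_normcB mf mg).
have m2 := measurable_psi_normc b0 (measurable_normcB mg mh).
apply: (@le_trans _ _ (s%:E * mod_ (fun t => f t - g t)%R a +
                       (1 - s)%:E * mod_ (fun t => g t - h t)%R b)%E).
  rewrite /orlicz_modular -!ge0_integralZl//; first last.
  - by rewrite lee_fin; case/andP: s01.
  - by move=> x _; exact: psi_normc_ge0.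
  - exact/measurable_EFinP.
  - by rewrite lee_fin subr_ge0; case/andP: s01.
  - by move=> x _; exact: psi_normc_ge0.
  - exact/measurable_EFinP.
  rewrite -ge0_integralD//; first last.
  - by apply/measurable_EFinP; exact: measurable_funM.
  - move=> x _; rewrite mule_ge0// ?lee_fin ?subr_ge0; first by case/andP: s01.
    by rewrite -lee_fin; exact: psi_normc_ge0.
  - by apply/measurable_EFinP; exact: measurable_funM.
  - move=> x _; rewrite mule_ge0// ?lee_fin; first by case/andP: s01.
    by rewrite -lee_fin; exact: psi_normc_ge0.
  apply: ge0_le_integral => //.
  - by move=> x _; exact: psi_normc_ge0.
  - by apply/measurable_EFinP; apply: (@measurable_psi_normc (fun t => f t - h t)%R) => //; exact: (measurable_normcB mf mh).
  - by apply/measurable_EFinP; apply: measurable_funD; exact: measurable_funM.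
  - move=> x _; rewrite -!EFinM -EFinD lee_fin.
    apply: (@le_trans _ _ (psi (s * (normc (f x - g x) / a) + (1 - s) * (normc (g x - h x) / b)))).
      apply: orlicz_le => //; first by rewrite divr_ge0 ?normc_ge0// ltW.
      have -> : s * (normc (f x - g x) / a) + (1 - s) * (normc (g x - h x) / b) =
        (normc (f x - g x) + normc (g x - h x)) / (a + b).
        by rewrite s1 /s; field; rewrite !gt_eqF.
      by rewrite ler_wpM2r ?normcB_tri// invr_ge0 ltW.
    by apply: orlicz_convex; rewrite // divr_ge0 ?normc_ge0// ltW.
apply: (@le_trans _ _ (s%:E * 1 + (1 - s)%:E * 1)%E).
  by apply: leeD; apply: lee_wpmul2l => //; rewrite lee_fin; lra.
by rewrite !mule1 -EFinD lee_fin; lra.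
Qed.

Lemma luxemburg_lt f e : (luxemburg mu D psi f < e%:E)%E ->
  exists2 C, 0 < C < e & (mod_ f C <= 1)%E.
Proof.
move=> /ereal_inf_lt[_ [C [C0 hC] <-]]; rewrite lte_fin => Ce.
by exists C => //; rewrite C0.
Qed.

Lemma luxemburg_le f C : 0 < C -> (mod_ f C <= 1)%E ->
  (luxemburg mu D psi f <= C%:E)%E.
Proof. by move=> C0 hC; apply: ereal_inf_lbound; exists C. Qed.

Local Notation X := (orlicz_type mu D psi).

(** Describing neighborhoods by the modular at scale e instead of the norm avoids asking whether the
    infimum in the norm is attained; halving e passes from one description to the other. *)
Lemma nbhs_orliczP (f : X) (U : set X) :
  nbhs f U <-> exists2 e, 0 < e & forall g : X,
    (mod_ (fun x => sval g x - sval f x)%R e <= 1)%E -> U g.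
Proof.
split.
  rewrite nbhsE => -[V [oV Vf] VU].
  have [e e0 he] : exists2 e, 0 < e & forall g : X,
    (luxemburg mu D psi (fun x => sval g x - sval f x)%R < e%:E)%E -> V g.
    exact: oV.
  exists (e / 2); first lra.
  move=> g hg; apply/VU/he; apply: le_lt_trans (luxemburg_le _ hg) _; first lra.
  by rewrite lte_fin; lra.
move=> [e e0 hU]; rewrite nbhsE.
exists [set g : X | (luxemburg mu D psi (fun x => sval g x - sval f x)%R < e%:E)%E].
  split.
    rewrite /open /= => g /luxemburg_lt[C /andP[C0 Ce] hC].
    exists (e - C); first lra.
    move=> h /luxemburg_lt[C' /andP[C'0 C'e] hC'].
    apply: (@le_lt_trans _ _ (C' + C)%:E); last by rewrite lte_fin; lra.
    apply: luxemburg_le; first lra.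
    by apply: (modular_tri (g := sval g)) => //;
      [case: (svalP h)|case: (svalP g)|case: (svalP f)].
  apply: (@le_lt_trans _ _ (e / 2)%:E); last by rewrite lte_fin; lra.
  apply: luxemburg_le; first lra.
  rewrite /orlicz_modular; under eq_integral do rewrite subrr Normc.normc0 mul0r orlicz_0//.
  by rewrite integral0.
move=> g /luxemburg_lt[C /andP[C0 Ce] hC]; apply: hU.
apply: le_trans hC; apply: modular_le => //; first exact: ltW.
by apply: measurable_normcB; [case: (svalP g)|case: (svalP f)].
Qed.

End luxemburg_facts.

(** * Holomorphic functions of one variable *)

Section lebesgue_shift.
Context (R : realType).
Local Notation leb := (@lebesgue_measure R).

Let addr_ (t x : measurableTypeR R) : measurableTypeR R := x + t.

Let measurable_addr_ (t : R) : measurable_fun setT (addr_ t).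
Proof. exact: measurable_funD. Qed.

Lemma lebesgue_measure_shift (t : R) (A : set R) : measurable A ->
  pushforward leb (addr_ t) A = leb A.
Proof.
move=> mA; pose m' : {measure set (measurableTypeR R) -> \bar R} :=
  measure_function_pushforward__canonical__measure_function_Measure leb (@measurable_addr_ t).
apply/esym/(@lebesgue_measure_unique R m') => //= _ [[a b] _ <-] /=.
rewrite /m' /= /pushforward (_ : _ @^-1` _ = `](a - t), (b - t)]%classic); last first.
  by apply/seteqP; split => x /=; rewrite /addr_ !in_itv/= => /andP[? ?]; apply/andP; split; lra.
rewrite !lebesgue_measure_itv/= !lte_fin ltrD2r.
by case: ifPn => // _; rewrite -!EFinB opprB addrA subrK.
Qed.

Lemma ge0_integral_shift (t : R) (D : set R) (f : R -> \bar R) : measurable D ->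
  measurable_fun D f -> (forall x, D x -> (0 <= f x)%E) ->
  (\int[leb]_(x in (fun x => x + t)%R @^-1` D) f (x + t)%R = \int[leb]_(x in D) f x)%E.
Proof.
move=> mD mf f0.
rewrite -[LHS](@ge0_integral_pushforward _ _ _ _ _ (addr_ t)) //; last first.
- by move=> y; rewrite inE; exact: f0.
by apply: eq_measure_integral => //= A mA AS; exact: lebesgue_measure_shift.
Qed.

End lebesgue_shift.

Section segment_integral.
Context (R : realType).
Local Notation leb := (@lebesgue_measure R).
Implicit Types (phi : R -> R) (a b : R).

Definition segint a b phi := \int[leb]_(x in `[a, b]) phi x.

Definition contI a b phi := forall x, a <= x <= b -> {for x, continuous phi}.

Lemma contID a b phi xi : contI a b phi -> contI a b xi -> contI a b (fun x => phi x + xi x).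
Proof. by move=> h1 h2 x xab; apply: cvgD; [exact: h1|exact: h2]. Qed.

Lemma contIB a b phi xi : contI a b phi -> contI a b xi -> contI a b (fun x => phi x - xi x).
Proof. by move=> h1 h2 x xab; apply: cvgB; [exact: h1|exact: h2]. Qed.

Lemma contI_norm a b phi : contI a b phi -> contI a b (fun x => `|phi x|).
Proof. by move=> h1 x xab; apply: cvg_norm; exact: h1. Qed.

Lemma contI_integrable a b phi : contI a b phi ->
  leb.-integrable `[a, b] (EFin \o phi).
Proof.
move=> h; apply: continuous_compact_integrable; first exact: segment_compact.
by apply: continuous_in_subspaceT => x; rewrite inE/= in_itv/=; exact: h.
Qed.

Lemma segintD a b phi xi : contI a b phi -> contI a b xi ->
  segint a b (fun x => phi x + xi x) = segint a b phi + segint a b xi.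
Proof. by move=> h1 h2; apply: RintegralD => //; exact: contI_integrable. Qed.

Lemma segintB a b phi xi : contI a b phi -> contI a b xi ->
  segint a b (fun x => phi x - xi x) = segint a b phi - segint a b xi.
Proof. by move=> h1 h2; apply: RintegralB => //; exact: contI_integrable. Qed.

Lemma segint_cst a b (k : R) : a <= b -> segint a b (fun=> k) = k * (b - a).
Proof.
move=> ab; rewrite /segint Rintegral_cst//; congr (_ * _).
apply: etrans (congr1 fine (@lebesgue_measure_itv R `[a, b])) _; rewrite /= lte_fin.
by move: ab; rewrite le_eqVlt => /predU1P[->|->//]; rewrite ltxx subrr.
Qed.

Lemma segint_le a b phi xi : contI a b phi -> contI a b xi ->
  (forall x, a <= x <= b -> phi x <= xi x) -> segint a b phi <= segint a b xi.
Proof.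
move=> h1 h2 h; apply: le_Rintegral => //; exact: contI_integrable.
Qed.

Lemma eq_segint a b phi xi : (forall x, a <= x <= b -> phi x = xi x) ->
  segint a b phi = segint a b xi.
Proof. by move=> h; apply: eq_Rintegral => x; rewrite inE/= in_itv/=; exact: h. Qed.

Lemma contI_cst a b (k : R) : contI a b (fun=> k).
Proof. by move=> x _; exact: cvg_cst. Qed.

Lemma segint_near a b phi k M : a <= b -> contI a b phi ->
  (forall x, a <= x <= b -> `|phi x - k| <= M) ->
  `|segint a b phi - k * (b - a)| <= M * (b - a).
Proof.
move=> ab h1 h; have hp x : a <= x <= b -> k - M <= phi x <= k + M.
  by move=> /h; rewrite ler_norml => /andP[? ?]; apply/andP; split; lra.
have l1 : segint a b phi <= (k + M) * (b - a).
  rewrite -segint_cst//; apply: segint_le => //; first exact: contI_cst.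
  by move=> x /hp/andP[].
have l2 : (k - M) * (b - a) <= segint a b phi.
  rewrite -segint_cst//; apply: segint_le => //; first exact: contI_cst.
  by move=> x /hp/andP[].
rewrite ler_norml; apply/andP; split; lra.
Qed.

Lemma segint_split a b m phi : a <= m -> m <= b -> contI a b phi ->
  segint a b phi = segint a m phi + segint m b phi.
Proof.
move=> am mb h; have hi := contI_integrable h.
have := @Rintegral_itvB R phi (BLeft a) (BRight b) m hi.
rewrite !bnd_simp => /(_ am mb); rewrite Rintegral_itv_obnd_cbnd.
  by rewrite /segint => <-; rewrite addrC subrK.
apply: integrableS hi => //; apply: subset_itvr; rewrite bnd_simp//.
Qed.

Lemma segint_abs a b phi : contI a b phi -> `|segint a b phi| <= segint a b (fun x => `|phi x|).
Proof. by move=> h; apply: le_normr_Rintegral => //; exact: contI_integrable. Qed.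

Lemma segint_shift a b t phi : (forall x, 0 <= phi x) -> continuous phi ->
  segint a b (fun x => phi (x + t)) = segint (a + t) (b + t) phi.
Proof.
move=> p0 cp; rewrite /segint /Rintegral; congr fine.
rewrite -(@ge0_integral_shift _ t `[a + t, b + t] (fun x => (phi x)%:E))//; first last.
- by move=> x _; rewrite lee_fin.
- apply/measurable_EFinP; apply: measurable_funTS; exact: continuous_measurable_fun.
congr (integral _ _ _); apply/seteqP.
by split => x /=; rewrite !in_itv/= => /andP[? ?]; apply/andP; split; lra.
Qed.

Lemma EFin_segint a b phi : contI a b phi ->
  (segint a b phi)%:E = (\int[leb]_(x in `[a, b]) (phi x)%:E)%E.
Proof.
move=> /contI_integrable h; rewrite /segint /Rintegral fineK//.
exact: integrable_fin_num.
Qed.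

End segment_integral.

(** * Goursat's theorem on rectangles *)

Section goursat.
Context (R : realType).
Local Notation normc := Normc.normc.
Local Notation Re := complex.Re.
Local Notation Im := complex.Im.
Implicit Types (F G : R[i] -> R[i]) (z w : R[i]) (a b c d x y : R).

(** Complex differentiability with real moduli, so that all epsilons are real although the norm of
    [R[i]] takes its values in [R[i]]. *)
Definition cdiff F z (D : R[i]) := forall e, 0 < e -> exists2 del, 0 < del &
  forall w, normc (w - z) < del -> normc (F w - F z - D * (w - z)) <= e * normc (w - z).

Definition ccont F z := forall e, 0 < e -> exists2 del, 0 < del &
  forall w, normc (w - z) < del -> normc (F w - F z) < e.

Lemma cdiff_ccont F z D : cdiff F z D -> ccont F z.
Proof.
move=> h e e0; have [del del0 hd] := h 1 ltr01.
have C0 : 0 < 1 + normc D by rewrite ltr_pwDl// normc_ge0.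
exists (Num.min del (e / (1 + normc D))); first by rewrite lt_min del0 divr_gt0.
move=> w; rewrite lt_min => /andP[/hd h1]; rewrite ltr_pdivlMr// => h2.
have -> : F w - F z = (F w - F z - D * (w - z)) + D * (w - z) by rewrite subrK.
apply: le_lt_trans (normcD_le _ _) _; rewrite Normc.normcM.
lra.
Qed.

Lemma ccont_path (L : R[i] -> R) (p : R -> R[i]) F (s : R) :
  (forall u v, `|L u - L v| <= normc (u - v)) ->
  (forall s s', normc (p s - p s') <= `|s - s'|) ->
  ccont F (p s) -> {for s, continuous (fun s => L (F (p s)))}.
Proof.
move=> hL hp hF; apply/cvgrPdist_lt => e /hF[del del0 hd].
exists del => //= s' hs; rewrite distrC; apply: le_lt_trans (hL _ _) _; apply: hd.
by apply: le_lt_trans (hp _ _) _; rewrite distrC.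
Qed.

Lemma Re_lip z w : `|Re z - Re w| <= normc (z - w).
Proof. by apply: le_trans (Re_le_normc _); case: z; case: w. Qed.

Lemma Im_lip z w : `|Im z - Im w| <= normc (z - w).
Proof. by apply: le_trans (Im_le_normc _); case: z; case: w. Qed.

Lemma normc_lip z w : `|normc z - normc w| <= normc (z - w).
Proof.
rewrite ler_norml; apply/andP; split.
  have := normcD_le (w - z) z; rewrite subrK normcB_sym; lra.
by have := normcD_le (z - w) w; rewrite subrK; lra.
Qed.

Lemma hpath_lip y x x' : normc (Complex x y - Complex x' y) <= `|x - x'|.
Proof. by apply: le_trans (normc_le_ReIm _) _; rewrite /= subrr normr0 addr0. Qed.

Lemma vpath_lip x y y' : normc (Complex x y - Complex x y') <= `|y - y'|.
Proof. by apply: le_trans (normc_le_ReIm _) _; rewrite /= subrr normr0 add0r. Qed.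

(* Real part of the integral of [F] along the boundary of [a, b] x [c, d]; scalar
   multiples of [F] give the other components. *)
Definition rectint a b c d F :=
  segint a b (fun x => Re (F (Complex x c)) - Re (F (Complex x d))) -
  segint c d (fun y => Im (F (Complex b y)) - Im (F (Complex a y))).

Lemma contI_Re_h F a b y : (forall x, a <= x <= b -> ccont F (Complex x y)) ->
  contI a b (fun x => Re (F (Complex x y))).
Proof.
move=> h x /h; apply: (ccont_path (p := fun x => Complex x y)); [exact: Re_lip|exact: hpath_lip].
Qed.

Lemma contI_Im_v F c d x : (forall y, c <= y <= d -> ccont F (Complex x y)) ->
  contI c d (fun y => Im (F (Complex x y))).
Proof.
move=> h y /h; apply: (ccont_path (p := fun y => Complex x y)); [exact: Im_lip|exact: vpath_lip].
Qed.

Lemma rectint_splitx a m b c d F : a <= m -> m <= b -> c <= d ->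
  (forall x y, a <= x <= b -> c <= y <= d ->
     [|| x == a, x == m, x == b, y == c | y == d] -> ccont F (Complex x y)) ->
  rectint a b c d F = rectint a m c d F + rectint m b c d F.
Proof.
move=> am mb cd H; have ab := le_trans am mb.
have hor y : (y == c) || (y == d) -> contI a b (fun x => Re (F (Complex x y))).
  move=> hy; apply: contI_Re_h => x xab; apply: H => //.
    by case/orP: hy => /eqP ->; rewrite lexx ?cd.
  by case/orP: hy => ->; rewrite !orbT.
have ver x : [|| x == a, x == m | x == b] -> contI c d (fun y => Im (F (Complex x y))).
  move=> hx; apply: contI_Im_v => y ycd; apply: H => //.
    by case/or3P: hx => /eqP ->; rewrite ?lexx ?am ?mb ?ab.
  by case/or3P: hx => ->; rewrite ?orbT.
have [Hc Hd] := (hor c, hor d); rewrite !eqxx ?orbT in Hc Hd.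
have [Ha Hm Hb] := And3 (ver a) (ver m) (ver b); rewrite !eqxx ?orbT in Ha Hm Hb.
rewrite /rectint (segint_split am mb); last by apply: contIB; [exact: Hc|exact: Hd].
rewrite (segintB (Hb isT) (Ha isT)) (segintB (Hm isT) (Ha isT)) (segintB (Hb isT) (Hm isT)).
ring.
Qed.

Lemma rectint_splity a b c m d F : c <= m -> m <= d -> a <= b ->
  (forall x y, a <= x <= b -> c <= y <= d ->
     [|| x == a, x == b, y == c, y == m | y == d] -> ccont F (Complex x y)) ->
  rectint a b c d F = rectint a b c m F + rectint a b m d F.
Proof.
move=> cm md ab H; have cd := le_trans cm md.
have hor y : [|| y == c, y == m | y == d] -> contI a b (fun x => Re (F (Complex x y))).
  move=> hy; apply: contI_Re_h => x xab; apply: H => //.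
    by case/or3P: hy => /eqP ->; rewrite ?lexx ?cd ?cm ?md.
  by case/or3P: hy => ->; rewrite ?orbT.
have ver x : (x == a) || (x == b) -> contI c d (fun y => Im (F (Complex x y))).
  move=> hx; apply: contI_Im_v => y ycd; apply: H => //.
    by case/orP: hx => /eqP ->; rewrite ?lexx ?ab.
  by case/orP: hx => ->; rewrite ?orbT.
have [Ha Hb] := (ver a, ver b); rewrite !eqxx ?orbT in Ha Hb.
have [Hc Hm Hd] := And3 (hor c) (hor m) (hor d); rewrite !eqxx ?orbT in Hc Hm Hd.
rewrite /rectint (segint_split cm md); last by apply: contIB; [exact: Hb|exact: Ha].
rewrite (segintB (Hc isT) (Hd isT)) (segintB (Hc isT) (Hm isT)) (segintB (Hm isT) (Hd isT)).
ring.
Qed.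

(** The affine part of F integrates to 0: the constants it leaves on the horizontal and on the
    vertical sides, both equal to Im D times the area, cancel. Only the error eta along the sides
    remains. *)
Lemma rectint_affine a b c d F z D eta : a <= b -> c <= d ->
  (forall x y, a <= x <= b -> c <= y <= d -> ccont F (Complex x y)) ->
  (forall x y, a <= x <= b -> c <= y <= d ->
     normc (F (Complex x y) - F z - D * (Complex x y - z)) <= eta) ->
  `|rectint a b c d F| <= 2 * eta * ((b - a) + (d - c)).
Proof.
move=> ab cd H hE.
have hor y : c <= y <= d -> contI a b (fun x => Re (F (Complex x y))).
  by move=> hy; apply: contI_Re_h => x xab; exact: H.
have ver x : a <= x <= b -> contI c d (fun y => Im (F (Complex x y))).
  by move=> hy; apply: contI_Im_v => x' xab; exact: H.
have [aab bab ccd dcd] : [/\ a <= a <= b, a <= b <= b, c <= c <= d & c <= d <= d].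
  by rewrite !lexx ab cd.
have h1 : `|segint a b (fun x => Re (F (Complex x c)) - Re (F (Complex x d))) -
   (- Im D * (c - d)) * (b - a)| <= (2 * eta) * (b - a).
  apply: segint_near => //; first by apply: contIB; exact: hor.
  move=> x xab; have e1 := hE _ _ xab ccd; have e2 := hE _ _ xab dcd.
  have -> : Re (F (Complex x c)) - Re (F (Complex x d)) - - Im D * (c - d) =
     Re (F (Complex x c) - F z - D * (Complex x c - z)) -
     Re (F (Complex x d) - F z - D * (Complex x d - z)).
    by case: (F _) => ? ?; case: (F _) => ? ?; case: (F _) => ? ?; case: D {hE e1 e2} => ? ?; case: z => ? ? /=; ring.
  have := Re_le_normc (F (Complex x c) - F z - D * (Complex x c - z)).
  have := Re_le_normc (F (Complex x d) - F z - D * (Complex x d - z)).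
  set u := Re _; set v := Re _ => hu hv.
  apply: le_trans (ler_normB _ _) _; lra.
have h2 : `|segint c d (fun y => Im (F (Complex b y)) - Im (F (Complex a y))) -
   (Im D * (b - a)) * (d - c)| <= (2 * eta) * (d - c).
  apply: segint_near => //; first by apply: contIB; exact: ver.
  move=> y yab; have e1 := hE _ _ bab yab; have e2 := hE _ _ aab yab.
  have -> : Im (F (Complex b y)) - Im (F (Complex a y)) - Im D * (b - a) =
     Im (F (Complex b y) - F z - D * (Complex b y - z)) -
     Im (F (Complex a y) - F z - D * (Complex a y - z)).
    by case: (F _) => ? ?; case: (F _) => ? ?; case: (F _) => ? ?; case: D {hE e1 e2 h1} => ? ?; case: z => ? ? /=; ring.
  have := Im_le_normc (F (Complex b y) - F z - D * (Complex b y - z)).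
  have := Im_le_normc (F (Complex a y) - F z - D * (Complex a y - z)).
  set u := Im _; set v := Im _ => hu hv.
  apply: le_trans (ler_normB _ _) _; lra.
rewrite /rectint; move: h1 h2; set A := segint _ _ _; set B := segint _ _ _ => h1 h2.
have -> : A - B = (A - - Im D * (c - d) * (b - a)) - (B - Im D * (b - a) * (d - c)) by ring.
by apply: le_trans (ler_normB _ _) _; rewrite [leRHS]mulrDr lerD.
Qed.

(** The squared half perimeter is divided by 4 in each quarter, while the four integrals add up to
    the original one, so some quarter keeps the lower bound with the same e. *)
Lemma bisect_rect (a b c d e : R) F : a <= b -> c <= d ->
  (forall x y, a <= x <= b -> c <= y <= d -> ccont F (Complex x y)) ->
  e * ((b - a) + (d - c)) ^+ 2 < `|rectint a b c d F| ->
  exists a' b' c' d', [/\ a <= a', b' <= b, c <= c' & d' <= d] /\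
    [/\ b' - a' = (b - a) / 2, d' - c' = (d - c) / 2 &
      e * ((b' - a') + (d' - c')) ^+ 2 < `|rectint a' b' c' d' F|].
Proof.
move=> ab cd H hb; set m := (a + b) / 2; set n := (c + d) / 2.
have [am mb] : a <= m /\ m <= b by rewrite /m; split; lra.
have [cn nd] : c <= n /\ n <= d by rewrite /n; split; lra.
have E : rectint a b c d F = (rectint a m c n F + rectint a m n d F) +
    (rectint m b c n F + rectint m b n d F).
  rewrite (rectint_splitx am mb cd); last by move=> x y ? ? _; exact: H.
  by congr (_ + _); apply: rectint_splity => // x y /andP[? ?] ? _; apply: H => //;
    apply/andP; split; lra.
have [ma bm nc dn] : [/\ m - a = (b - a) / 2, b - m = (b - a) / 2, n - c = (d - c) / 2
    & d - n = (d - c) / 2] by rewrite /m /n; split; lra.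
pose p := (b - a) / 2 + (d - c) / 2.
have pE : e * (b - a + (d - c)) ^+ 2 = e * p ^+ 2 *+ 4 by rewrite /p; field.
case: (ltP (e * p ^+ 2) `|rectint a m c n F|) => h1.
  by exists a, m, c, n; rewrite ma nc; split.
case: (ltP (e * p ^+ 2) `|rectint a m n d F|) => h2.
  by exists a, m, n, d; rewrite ma dn; split.
case: (ltP (e * p ^+ 2) `|rectint m b c n F|) => h3.
  by exists m, b, c, n; rewrite bm nc; split.
case: (ltP (e * p ^+ 2) `|rectint m b n d F|) => h4.
  by exists m, b, n, d; rewrite bm dn; split.
move: hb; rewrite pE E ltNge => /negP[].
apply: le_trans (ler_normD _ _) _.
have := ler_normD (rectint a m c n F) (rectint a m n d F).
have := ler_normD (rectint m b c n F) (rectint m b n d F).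
rewrite -mulr_natr; lra.
Qed.

Lemma dist_itv (u v lo hi : R) : lo <= u <= hi -> lo <= v <= hi -> `|u - v| <= hi - lo.
Proof.
by move=> /andP[? ?] /andP[? ?]; rewrite ler_norml; apply/andP; split; lra.
Qed.

(** A nonzero integral would persist, relatively to the squared perimeter, in nested rectangles
    shrinking to a point; differentiability there makes the integral small compared with that
    square. *)
Lemma goursat (a b c d : R) F : a <= b -> c <= d ->
  (forall x y, a <= x <= b -> c <= y <= d -> exists D, cdiff F (Complex x y) D) ->
  rectint a b c d F = 0.
Proof.
move=> ab cd H; apply/eqP; apply/negP => /negP Q0.
have Hc x y : a <= x <= b -> c <= y <= d -> ccont F (Complex x y).
  by move=> hx hy; have [D] := H _ _ hx hy; exact: cdiff_ccont.
set q := rectint a b c d F in Q0; have q0 : 0 < `|q| by rewrite normr_gt0.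
(* The summand 1 keeps the denominator positive when the rectangle is reduced to a point. *)
pose p0 := (b - a) + (d - c); pose e := `|q| / (p0 ^+ 2 + 1) / 2.
have P1 : 0 < p0 ^+ 2 + 1 by rewrite ltr_wpDl// sqr_ge0.
have e0 : 0 < e by rewrite !divr_gt0.
pose st := (R * R * (R * R))%type.
pose inside (s : st) := [/\ a <= s.1.1, s.1.1 <= s.1.2 & s.1.2 <= b] /\
   [/\ c <= s.2.1, s.2.1 <= s.2.2 & s.2.2 <= d].
pose bad (s : st) := e * ((s.1.2 - s.1.1) + (s.2.2 - s.2.1)) ^+ 2 <
   `|rectint s.1.1 s.1.2 s.2.1 s.2.2 F|.
pose sub_ (s s' : st) := [/\ s.1.1 <= s'.1.1, s'.1.2 <= s.1.2, s.2.1 <= s'.2.1 & s'.2.2 <= s.2.2] /\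
  (s'.1.2 - s'.1.1 = (s.1.2 - s.1.1) / 2 /\ s'.2.2 - s'.2.1 = (s.2.2 - s.2.1) / 2).
have /choice[f hf] : forall s, exists s', inside s /\ bad s ->
    (inside s' /\ bad s') /\ sub_ s s'.
  move=> s; have [[hi hb]|hn] := pselect (inside s /\ bad s); last by exists s.
  have [[a1 ab1 b1] [c1 cd1 d1]] := hi.
  have Hs x y : s.1.1 <= x <= s.1.2 -> s.2.1 <= y <= s.2.2 -> ccont F (Complex x y).
    move=> /andP[h1 h2] /andP[h3 h4].
    by apply: Hc; rewrite ?(le_trans a1 h1) ?(le_trans h2 b1) ?(le_trans c1 h3) ?(le_trans h4 d1).
  have [a' [b' [c' [d' [[h1 h2 h3 h4] [eb ed h]]]]]] := bisect_rect ab1 cd1 Hs hb.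
  exists ((a', b'), (c', d')) => _; split; last by [].
  have b'a' : a' <= b' by rewrite -subr_ge0 eb divr_ge0// subr_ge0.
  have d'c' : c' <= d' by rewrite -subr_ge0 ed divr_ge0// subr_ge0.
  split => //; split; split => //=.
  - exact: le_trans a1 h1.
  - exact: le_trans h2 b1.
  - exact: le_trans c1 h3.
  - exact: le_trans h4 d1.
pose s0 : st := ((a, b), (c, d)).
have s0P : inside s0 /\ bad s0.
  split; first by rewrite /inside /= !lexx.
  rewrite /bad /= -/q -/p0 /e mulrAC ltr_pdivrMr// mulrAC ltr_pdivrMr//.
  by rewrite -mulrA ltr_pM2l//; have := sqr_ge0 p0; lra.
pose s n := iter n f s0.
have sP n : inside (s n) /\ bad (s n).
  by elim: n => [//|n /hf[]].
have sS n : sub_ (s n) (s n.+1) by have [] := hf _ (sP n).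
have mono n k : [/\ (s n).1.1 <= (s (n + k)%N).1.1, (s (n + k)%N).1.2 <= (s n).1.2,
   (s n).2.1 <= (s (n + k)%N).2.1 & (s (n + k)%N).2.2 <= (s n).2.2].
  elim: k => [|k [i1 i2 i3 i4]]; first by rewrite addn0 !lexx.
  rewrite addnS; have [[j1 j2 j3 j4] _] := sS (n + k)%N.
  by split; [exact: le_trans j1|exact: le_trans i2|exact: le_trans j3|exact: le_trans i4].
have nest n k : (s n).1.1 <= (s k).1.2 /\ (s n).2.1 <= (s k).2.2.
  have [[_ hx _] [_ hy _]] := proj1 (sP (n + k)%N).
  have [i1 _ i3 _] := mono n k; have [_ i2 _ i4] := mono k n; rewrite addnC in i2 i4.
  by split; [exact: le_trans (le_trans i1 hx) i2|exact: le_trans (le_trans i3 hy) i4].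
pose x := sup [set (s n).1.1 | n in setT]; pose y := sup [set (s n).2.1 | n in setT].
have xP n : (s n).1.1 <= x <= (s n).1.2.
  apply/andP; split.
    apply: ub_le_sup; last by exists n.
    by exists (s 0).1.2 => _ [k _ <-]; have [] := nest k 0.
  by apply: ge_sup; [exists (s 0).1.1; exists 0|move=> _ [k _ <-]; have [] := nest k n].
have yP n : (s n).2.1 <= y <= (s n).2.2.
  apply/andP; split.
    apply: ub_le_sup; last by exists n.
    by exists (s 0).2.2 => _ [k _ <-]; have [] := nest k 0.
  by apply: ge_sup; [exists (s 0).2.1; exists 0|move=> _ [k _ <-]; have [] := nest k n].
have wd n : ((s n).1.2 - (s n).1.1) + ((s n).2.2 - (s n).2.1) = p0 / 2 ^+ n.
  elim: n => [|n IH]; first by rewrite expr0 divr1.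
  have [_ [-> ->]] := sS n; rewrite -mulrDl IH exprSr invfM mulrA//.
have [D hD] := H x y (xP 0%N) (yP 0%N).
have [del del0 hdel] := hD (e / 2) (divr_gt0 e0 (ltr0Sn _ _)).
have [n hn] : exists n, p0 / 2 ^+ n < del.
  have p00 : 0 <= p0 by rewrite /p0; lra.
  exists (Num.truncn (p0 / del)).+1; rewrite ltr_pdivrMr ?exprn_gt0//.
  rewrite mulrC -ltr_pdivrMr//; apply: lt_trans (truncnS_gt _) _.
  by rewrite -natrX ltr_nat ltn_expl.
have [[_ hx _] [_ hy _]] := proj1 (sP n).
have := proj2 (sP n); rewrite /bad ltNge => /negP; apply.
(* With eta equal to e / 2 times the half perimeter, the bound 2 eta times the half perimeter is
   exactly e times its square, which contradicts [bad]. *)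
have := @rectint_affine (s n).1.1 (s n).1.2 (s n).2.1 (s n).2.2 F (Complex x y) D
  (e / 2 * (p0 / 2 ^+ n)) hx hy.
rewrite wd => h; apply: le_trans (h _ _) _; last 1 first.
- by rewrite expr2; lra.
- move=> x' y' /andP[h1 h2] /andP[h3 h4]; have [[k1 _ k2] [k3 _ k4]] := proj1 (sP n).
  by apply: Hc; rewrite ?(le_trans k1 h1) ?(le_trans h2 k2) ?(le_trans k3 h3) ?(le_trans h4 k4).
move=> x' y' hx' hy'.
have dist : normc (Complex x' y' - Complex x y) <= p0 / 2 ^+ n.
  by apply: le_trans (normc_le_ReIm _) _; rewrite -wd /= lerD ?dist_itv.
apply: le_trans (hdel _ (le_lt_trans dist hn)) _.
by rewrite ler_wpM2l// divr_ge0 ?ltW.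
Qed.

Lemma cdiff_scale F z D (k : R[i]) : cdiff F z D -> cdiff (fun w => k * F w) z (k * D).
Proof.
move=> h e e0; have k0 : 0 < 1 + normc k by rewrite ltr_pwDl// normc_ge0.
have [del del0 hd] := h (e / (1 + normc k)) (divr_gt0 e0 k0).
exists del => // w /hd {}hd; rewrite -mulrA -!mulrBr Normc.normcM.
apply: le_trans (ler_wpM2l (normc_ge0 _) hd) _.
rewrite mulrA ler_wpM2r ?normc_ge0// mulrCA ger_pMr// ler_pdivrMr//; lra.
Qed.

Let div_expand (K : fieldType) (a b D u t : K) : u != 0 -> u + t != 0 ->
  a / (u + t) - b / u - (D / u - b / u ^+ 2) * t =
  (a - b - D * t) / (u + t) + t * t * (b / u ^+ 2 - D / u) / (u + t).
Proof. by move=> u0 ut0; field; rewrite ?u0 ?ut0. Qed.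

(** In the expansion [div_expand] the first term carries the remainder of F and the second is
    quadratic in t; both denominators are controlled by |u + t| >= |u| / 2. *)
Lemma cdiff_div F z z0 D : cdiff F z D -> z != z0 ->
  exists D', cdiff (fun w => F w / (w - z0)) z D'.
Proof.
move=> h zz0; set u := z - z0; have u0 : u != 0 by rewrite subr_eq0.
have nu : 0 < normc u by rewrite normc_gt0.
exists (D / u - F z / u ^+ 2) => e e0.
pose K := normc (F z) / normc u ^+ 2 + normc D / normc u.
have K0 : 0 <= K by rewrite addr_ge0// divr_ge0 ?normc_ge0// exprn_ge0 ?normc_ge0.
have e1 : 0 < e * normc u / 4 by rewrite divr_gt0// mulr_gt0.
have [del del0 hd] := h _ e1.
have K1 : 0 < K + 1 by lra.
exists (Num.min del (Num.min (normc u / 2) (e * normc u / 4 / (K + 1)))).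
  by rewrite !lt_min; apply/and3P; split => //; exact: divr_gt0.
move=> w; set t := w - z; rewrite !lt_min => /and3P[/hd h1 t1 t2].
have wE : w - z0 = u + t by rewrite /u /t; ring.
have nut : normc u / 2 <= normc (u + t).
  by have := normcB_tri u (- t) 0; rewrite !opprK !subr0 normcN => k; lra.
have nut0 : 0 < normc (u + t) by apply: lt_le_trans nut; rewrite divr_gt0.
have ut0 : u + t != 0 by rewrite -normc_gt0.
rewrite wE.
have -> : F w / (u + t) - F z / u - (D / u - F z / u ^+ 2) * t =
   (F w - F z - D * t) / (u + t) + t * t * (F z / u ^+ 2 - D / u) / (u + t).
  exact: div_expand.
apply: le_trans (normcD_le _ _) _.
rewrite !Normc.normcM !Normc.normcV -mulrDl ler_pdivrMr//.
have hK : normc (F z / u ^+ 2 - D / u) <= K.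
  apply: le_trans (normcD_le _ _) _.
  by rewrite normcN !Normc.normcM !Normc.normcV normcX.
have t0 := normc_ge0 t.
have h3 : normc t * normc t * normc (F z / u ^+ 2 - D / u) <= normc t * (e * normc u / 4).
  rewrite -mulrA ler_wpM2l//; apply: (@le_trans _ _ (normc t * (K + 1))).
    by rewrite ler_wpM2l//; lra.
  by rewrite -ler_pdivlMr// ltW.
have h4 : e * normc t * (normc u / 2) <= e * normc t * normc (u + t).
  by rewrite ler_wpM2l// mulr_ge0// ltW.
by move: h1; rewrite -/t => h1; lra.
Qed.

(** Four cuts around the small square leave four rectangles avoiding the singular point, and
    Goursat's theorem applies to each of them. *)
Lemma rectint_shrink (a b c d x0 y0 e : R) F : 0 < e ->
  [/\ a <= x0 - e, x0 + e <= b, c <= y0 - e & y0 + e <= d] ->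
  (forall x y, a <= x <= b -> c <= y <= d -> Complex x y != Complex x0 y0 ->
     exists D, cdiff F (Complex x y) D) ->
  rectint a b c d F = rectint (x0 - e) (x0 + e) (y0 - e) (y0 + e) F.
Proof.
move=> e0 [a1 b1 c1 d1] H.
have H' x y : a <= x <= b -> c <= y <= d -> (x != x0) || (y != y0) ->
    exists D, cdiff F (Complex x y) D.
  by move=> hx hy hxy; apply: H => //; rewrite eq_complex /= negb_and.
have Hc x y : a <= x <= b -> c <= y <= d -> (x != x0) || (y != y0) -> ccont F (Complex x y).
  by move=> hx hy hxy; have [D] := H' _ _ hx hy hxy; exact: cdiff_ccont.
have [n1 n2] : (x0 - e != x0) /\ (x0 + e != x0) by split; apply/eqP; lra.
have [n3 n4] : (y0 - e != y0) /\ (y0 + e != y0) by split; apply/eqP; lra.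
have [na nb nc nd] : [/\ a != x0, b != x0, c != y0 & d != y0] by split; apply/eqP; lra.
rewrite (@rectint_splitx a (x0 - e) b c d) //; try lra; last first.
  move=> x y hx hy hxy; apply: Hc => //.
  by case/orP: hxy => [/eqP ->|/or4P[]/eqP ->]; rewrite ?na ?n1 ?nb ?nc ?nd ?orbT.
rewrite (@rectint_splitx (x0 - e) (x0 + e) b c d) //; try lra; last first.
  move=> x y hx hy hxy; apply: Hc => //; first by apply/andP; split; lra.
  by case/orP: hxy => [/eqP ->|/or4P[]/eqP ->]; rewrite ?n1 ?n2 ?nb ?nc ?nd ?orbT.
rewrite (@rectint_splity (x0 - e) (x0 + e) c (y0 - e) d) //; try lra; last first.
  move=> x y hx hy hxy; apply: Hc => //; first by apply/andP; split; lra.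
  by case/orP: hxy => [/eqP ->|/or4P[]/eqP ->]; rewrite ?n1 ?n2 ?n3 ?nc ?nd ?orbT.
rewrite (@rectint_splity (x0 - e) (x0 + e) (y0 - e) (y0 + e) d) //; try lra; last first.
  move=> x y hx hy hxy; apply: Hc => //; [by apply/andP; split; lra|by apply/andP; split; lra|].
  by case/orP: hxy => [/eqP ->|/or4P[]/eqP ->]; rewrite ?n1 ?n2 ?n3 ?n4 ?nd ?orbT.
rewrite (@goursat a (x0 - e)); [|lra|lra|]; last first.
  move=> x y /andP[? ?] /andP[? ?]; apply: H'; try (by apply/andP; split; lra).
  by apply/orP; left; apply/eqP; lra.
rewrite (@goursat (x0 + e) b); [|lra|lra|]; last first.
  move=> x y /andP[? ?] /andP[? ?]; apply: H'; try (by apply/andP; split; lra).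
  by apply/orP; left; apply/eqP; lra.
rewrite (@goursat (x0 - e) (x0 + e) c); [|lra|lra|]; last first.
  move=> x y /andP[? ?] /andP[? ?]; apply: H'; try (by apply/andP; split; lra).
  by apply/orP; right; apply/eqP; lra.
rewrite (@goursat (x0 - e) (x0 + e) (y0 + e)); [|lra|lra|]; last first.
  move=> x y /andP[? ?] /andP[? ?]; apply: H'; try (by apply/andP; split; lra).
  by apply/orP; right; apply/eqP; lra.
by rewrite !add0r !addr0.
Qed.

End goursat.

(** * Cauchy's formula on squares and its consequences *)

Section cauchy.
Context (R : realType).
Local Notation normc := Normc.normc.
Local Notation Re := complex.Re.
Local Notation Im := complex.Im.
Implicit Types (F G : R[i] -> R[i]) (z w : R[i]) (a b c d x y : R).

(* Up to sign, the contribution of one side of the square of center z and half side [e]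
   to the real part of the integral of i / (w - z) along its boundary; only [1 <= pk e]
   is used, so that pi does not appear in the Cauchy formula. *)
Definition pk (e : R) := segint (- e) e (fun s => e / (s ^+ 2 + e ^+ 2)).

Let pk_den (e s : R) : 0 < e -> 0 < s ^+ 2 + e ^+ 2.
Proof. by move=> e0; rewrite ltr_wpDl ?sqr_ge0// exprn_gt0. Qed.

Let continuous_pk (e : R) : 0 < e -> continuous (fun s : R => e / (s ^+ 2 + e ^+ 2)).
Proof.
move=> e0 s; apply: cvgM; first exact: cvg_cst.
apply: cvgV; first by rewrite gt_eqF// pk_den.
by apply: cvgD; [exact: exprn_continuous|exact: cvg_cst].
Qed.

Lemma segintZ a b (phi : R -> R) k : contI a b phi ->
  segint a b (fun x => k * phi x) = k * segint a b phi.
Proof. by move=> h; apply: RintegralZl => //; exact: contI_integrable. Qed.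

(** The exact value is pi / 2; the bound only uses s^2 + e^2 <= 2 e^2 on the segment. *)
Lemma pk_ge1 (e : R) : 0 < e -> 1 <= pk e.
Proof.
move=> e0; have -> : 1 = segint (- e) e (fun=> (2 * e)^-1).
  by rewrite segint_cst; [field; rewrite gt_eqF|lra].
apply: segint_le; first exact: contI_cst.
  by move=> s _; exact: continuous_pk.
move=> s /andP[s1 s2]; rewrite ler_pdivlMr ?pk_den// mulrC ler_pdivrMr; last lra.
have : 0 <= (e - s) * (e + s) by rewrite mulr_ge0//; lra.
by rewrite !expr2; lra.
Qed.

Lemma pk_shift (e x0 : R) : 0 < e ->
  segint (x0 - e) (x0 + e) (fun x => e / ((x - x0) ^+ 2 + e ^+ 2)) = pk e.
Proof.
move=> e0; rewrite (@segint_shift _ _ _ (- x0) (fun s => e / (s ^+ 2 + e ^+ 2))).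
- by rewrite /pk addrAC subrr add0r [x0 + e]addrC addrK.
- by move=> s; rewrite divr_ge0 ?ltW// pk_den.
- exact: continuous_pk.
Qed.

Let invcE (s t : R) : (Complex s t)^-1 =
  Complex (s / (s ^+ 2 + t ^+ 2)) (- (t / (s ^+ 2 + t ^+ 2))).
Proof. by []. Qed.

Let cauchy_h (p q s e : R) : 0 < e ->
  Re (Complex p q / Complex s (- e)) - Re (Complex p q / Complex s e) =
  - (2 * q) * (e / (s ^+ 2 + e ^+ 2)).
Proof.
move=> e0; have d0 := pk_den s e0; rewrite !invcE sqrrN /=.
by field; rewrite gt_eqF.
Qed.

Let cauchy_v (p q s e : R) : 0 < e ->
  Im (Complex p q / Complex e s) - Im (Complex p q / Complex (- e) s) =
  (2 * q) * (e / (s ^+ 2 + e ^+ 2)).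
Proof.
move=> e0; have d0 := pk_den s e0; rewrite !invcE sqrrN addrC [e ^+ 2 + _]addrC /=.
by field; rewrite gt_eqF.
Qed.

Let mid_ends (x e : R) : 0 < e -> (x - e <= x - e <= x + e) * (x - e <= x + e <= x + e).
Proof. by move=> e0; rewrite !lexx !andbT; split; lra. Qed.

Lemma cauchy_limit (a b c d x0 y0 : R) F : a < x0 < b -> c < y0 < d ->
  (forall x y, a <= x <= b -> c <= y <= d -> exists D, cdiff F (Complex x y) D) ->
  forall eta, 0 < eta -> exists2 e0, 0 < e0 & forall e, 0 < e < e0 ->
    `|rectint a b c d (fun w => F w / (w - Complex x0 y0)) +
      4 * pk e * Im (F (Complex x0 y0))| <= eta.
Proof.
move=> /andP[ax xb] /andP[cy yd] H eta eta0; set z0 := Complex x0 y0.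
have [D0 /cdiff_ccont hc] : exists D, cdiff F z0 D by apply: H; rewrite !ltW.
have [del del0 hd] := hc (eta / 8) (divr_gt0 eta0 (ltr0Sn _ _)).
exists (Num.min (del / 2) (Num.min (Num.min (x0 - a) (b - x0)) (Num.min (y0 - c) (d - y0)))).
  by rewrite !lt_min !subr_gt0 ax xb cy yd divr_gt0.
move=> e /andP[e0]; rewrite !lt_min => /andP[ed /andP[/andP[e1 e2] /andP[e3 e4]]].
rewrite (@rectint_shrink _ a b c d x0 y0 e)//; last 2 first.
- by split; lra.
- by move=> x y hx hy hxy; have [D hD] := H x y hx hy; exact: cdiff_div hD hxy.
case E : (F z0) => [p q] /=.
set G := (fun w => F w / (w - z0)).
have He x y : x0 - e <= x <= x0 + e -> y0 - e <= y <= y0 + e -> Complex x y != z0 ->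
    ccont G (Complex x y).
  move=> /andP[? ?] /andP[? ?] hn; have [D hD] : exists D, cdiff F (Complex x y) D.
    by apply: H; apply/andP; split; lra.
  by have [D'] := cdiff_div hD hn; exact: cdiff_ccont.
have dz x y : Complex x y - z0 = Complex (x - x0) (y - y0) by [].
have far x y : (`|x - x0| == e) || (`|y - y0| == e) -> Complex x y != z0 /\ e <= normc (Complex x y - z0).
  move=> h; have : e <= normc (Complex x y - z0).
    case/orP: h => /eqP <-.
      by apply: le_trans (Re_le_normc _); rewrite dz.
    by apply: le_trans (Im_le_normc _); rewrite dz.
  by move=> h'; split => //; rewrite -subr_eq0 -normc_gt0; exact: lt_le_trans h'.
have near_ x y : x0 - e <= x <= x0 + e -> y0 - e <= y <= y0 + e ->
  (`|x - x0| == e) || (`|y - y0| == e) ->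
  normc (G (Complex x y) - Complex p q / (Complex x y - z0)) <= eta / 8 / e.
  move=> hx hy hf; have [f1 f2] := far _ _ hf.
  rewrite /G -mulrBl Normc.normcM Normc.normcV.
  apply: ler_pM; [exact: normc_ge0|by rewrite invr_ge0 normc_ge0| |].
    rewrite -E; apply/ltW/hd; apply: le_lt_trans (normc_le_ReIm _) _; rewrite dz /=.
    have : `|x - x0| <= e by rewrite ler_norml; move: hx => /andP[? ?]; apply/andP; split; lra.
    have : `|y - y0| <= e by rewrite ler_norml; move: hy => /andP[? ?]; apply/andP; split; lra.
    by lra.
  by rewrite lef_pV2// posrE// (lt_le_trans e0).
have e8 : 0 < eta / 8 / e by rewrite !divr_gt0.
have [xl xr yl yr] : [/\ `|x0 - e - x0| == e, `|x0 + e - x0| == e, `|y0 - e - y0| == e & `|y0 + e - y0| == e].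
  by split; rewrite addrAC subrr add0r ?normrN gtr0_norm.
have [xlP xrP ylP yrP] : [/\ x0 - e <= x0 - e <= x0 + e, x0 - e <= x0 + e <= x0 + e,
  y0 - e <= y0 - e <= y0 + e & y0 - e <= y0 + e <= y0 + e].
  by split; rewrite !mid_ends.
have horc y : (`|y - y0| == e) -> y0 - e <= y <= y0 + e -> contI (x0 - e) (x0 + e) (fun x => Re (G (Complex x y))).
  move=> hy hy'; apply: contI_Re_h => x hx; apply: He => //.
  by apply: (far x y _).1; rewrite hy orbT.
have verc x : (`|x - x0| == e) -> x0 - e <= x <= x0 + e -> contI (y0 - e) (y0 + e) (fun y => Im (G (Complex x y))).
  move=> hy hy'; apply: contI_Im_v => y hx; apply: He => //.
  by apply: (far x y _).1; rewrite hy.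
have kcont (x1 : R) : contI (x1 - e) (x1 + e) (fun x => e / ((x - x1) ^+ 2 + e ^+ 2)).
  move=> x _; apply: (@continuous_comp _ _ _ (fun x => x - x1) (fun s => e / (s ^+ 2 + e ^+ 2))).
    by apply: cvgB; [exact: cvg_id|exact: cvg_cst].
  exact: continuous_pk.
pose phi (k x1 : R) := fun x : R => k * (e / ((x - x1) ^+ 2 + e ^+ 2)).
have phic k x1 : contI (x1 - e) (x1 + e) (phi k x1).
  by move=> x hx; apply: cvgM; [exact: cvg_cst|exact: kcont].
have phiI k x1 : segint (x1 - e) (x1 + e) (phi k x1) = k * pk e.
  by rewrite -(pk_shift x1 e0) -segintZ//; exact: kcont.
have h1 : `|segint (x0 - e) (x0 + e) (fun x => Re (G (Complex x (y0 - e))) - Re (G (Complex x (y0 + e))))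
   - (- (2 * q)) * pk e| <= eta / 2.
  rewrite -(phiI _ x0) -segintB//; last by apply: contIB; exact: horc.
  rewrite -[X in `|X|]subr0 -[0](mul0r (x0 + e - (x0 - e))).
  have -> : eta / 2 = (eta / 8 / e + eta / 8 / e) * (x0 + e - (x0 - e)) by field; rewrite gt_eqF.
  apply: segint_near; first lra.
    by apply: contIB => //; apply: contIB; exact: horc.
  move=> x hx; rewrite subr0 /phi -(cauchy_h p)//.
  have := Re_lip (G (Complex x (y0 - e))) (Complex p q / (Complex x (y0 - e) - z0)).
  have := Re_lip (G (Complex x (y0 + e))) (Complex p q / (Complex x (y0 + e) - z0)).
  have := near_ x (y0 - e) hx ylP; rewrite yl orbT => /(_ isT).
  have := near_ x (y0 + e) hx yrP; rewrite yr orbT => /(_ isT).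
  rewrite !dz [y0 - e - y0]addrAC [y0 + e - y0]addrAC !subrr !add0r.
  set A := Re (G _); set B := Re (G _); set A' := Re (_ / _); set B' := Re (_ / _).
  move=> n1 n2 n3 n4; have -> : A - B - (B' - A') = (A - B') - (B - A') by ring.
  by apply: le_trans (ler_normB _ _) _; lra.
have h2 : `|segint (y0 - e) (y0 + e) (fun y => Im (G (Complex (x0 + e) y)) - Im (G (Complex (x0 - e) y)))
   - 2 * q * pk e| <= eta / 2.
  rewrite -(phiI _ y0) -segintB//; last by apply: contIB; exact: verc.
  rewrite -[X in `|X|]subr0 -[0](mul0r (y0 + e - (y0 - e))).
  have -> : eta / 2 = (eta / 8 / e + eta / 8 / e) * (y0 + e - (y0 - e)) by field; rewrite gt_eqF.
  apply: segint_near; first lra.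
    by apply: contIB => //; apply: contIB; exact: verc.
  move=> y hy; rewrite subr0 /phi -(cauchy_v p)//.
  have := Im_lip (G (Complex (x0 - e) y)) (Complex p q / (Complex (x0 - e) y - z0)).
  have := Im_lip (G (Complex (x0 + e) y)) (Complex p q / (Complex (x0 + e) y - z0)).
  have := near_ (x0 - e) y xlP hy; rewrite xl => /(_ isT).
  have := near_ (x0 + e) y xrP hy; rewrite xr => /(_ isT).
  rewrite !dz [x0 - e - x0]addrAC [x0 + e - x0]addrAC !subrr !add0r.
  set A := Im (G _); set B := Im (G _); set A' := Im (_ / _); set B' := Im (_ / _).
  move=> n1 n2 n3 n4; have -> : A - B - (A' - B') = (A - A') - (B - B') by ring.
  by apply: le_trans (ler_normB _ _) _; lra.
rewrite /rectint; move: h1 h2; set A := segint _ _ _; set B := segint _ _ _ => h1 h2.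
have -> : A - B + 4 * pk e * q = (A - - (2 * q) * pk e) - (B - 2 * q * pk e) by ring.
by apply: le_trans (ler_normB _ _) _; lra.
Qed.

Lemma contI_normc_h F a b y : (forall x, a <= x <= b -> ccont F (Complex x y)) ->
  contI a b (fun x => normc (F (Complex x y))).
Proof.
move=> h x /h; apply: (ccont_path (p := fun x => Complex x y)); [exact: normc_lip|exact: hpath_lip].
Qed.

Lemma contI_normc_v F c d x : (forall y, c <= y <= d -> ccont F (Complex x y)) ->
  contI c d (fun y => normc (F (Complex x y))).
Proof.
move=> h y /h; apply: (ccont_path (p := fun y => Complex x y)); [exact: normc_lip|exact: vpath_lip].
Qed.

Lemma rectint_le_sides F a b c d :
  (forall x, a <= x <= b -> ccont F (Complex x c) /\ ccont F (Complex x d)) ->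
  (forall y, c <= y <= d -> ccont F (Complex a y) /\ ccont F (Complex b y)) ->
  `|rectint a b c d F| <=
    segint a b (fun x => normc (F (Complex x c)) + normc (F (Complex x d))) +
    segint c d (fun y => normc (F (Complex b y)) + normc (F (Complex a y))).
Proof.
move=> hh hv.
have [hc hd] : (forall x, a <= x <= b -> ccont F (Complex x c)) /\
  (forall x, a <= x <= b -> ccont F (Complex x d)) by split=> x /hh[].
have [ha hb] : (forall y, c <= y <= d -> ccont F (Complex a y)) /\
  (forall y, c <= y <= d -> ccont F (Complex b y)) by split=> y /hv[].
apply: le_trans (ler_normB _ _) _; apply: lerD.
  have hc1 := contIB (contI_Re_h hc) (contI_Re_h hd).
  apply: le_trans (segint_abs hc1) _; apply: segint_le.
  - exact: contI_norm.
  - by apply: contID; exact: contI_normc_h.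
  - by move=> x _; apply: le_trans (ler_normB _ _) _; apply: lerD; exact: Re_le_normc.
have hc1 := contIB (contI_Im_v hb) (contI_Im_v ha).
apply: le_trans (segint_abs hc1) _; apply: segint_le.
- exact: contI_norm.
- by apply: contID; exact: contI_normc_v.
- by move=> x _; apply: le_trans (ler_normB _ _) _; apply: lerD; exact: Im_le_normc.
Qed.

(** The formula sees only an imaginary part; multiplying F by a unimodular constant turns that part
    into a modulus. *)
Lemma rotate_to_negi (z : R[i]) : exists k, normc k = 1 /\ Im (k * z) = - normc z.
Proof.
have [->|z0] := eqVneq z 0; first by exists 1; rewrite Normc.normc1 mulr0 Normc.normc0 oppr0.
have nz : 0 < normc z by rewrite normc_gt0.
case: z z0 nz => p q z0 nz; set n := normc _ in nz *.
exists (Complex (- (q / n)) (- (p / n))).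
have n2 : n ^+ 2 = p ^+ 2 + q ^+ 2 by rewrite /n normc_sqr.
split.
  rewrite /= !sqrrN !expr_div_n -mulrDl [q ^+ 2 + _]addrC -n2 divff ?sqrtr1//.
  by rewrite expf_neq0// gt_eqF.
have -> : Im (Complex (- (q / n)) (- (p / n)) * Complex p q) = - ((p ^+ 2 + q ^+ 2) / n).
  by rewrite /=; field; rewrite gt_eqF.
by rewrite -n2; field; rewrite gt_eqF.
Qed.

Definition holo_square F (r : R) := forall x y, - r <= x <= r -> - r <= y <= r ->
  exists D, cdiff F (Complex x y) D.

Lemma holo_square_sub F r r' : r' <= r -> holo_square F r -> holo_square F r'.
Proof.
by move=> rr h x y /andP[? ?] /andP[? ?]; apply: h; apply/andP; split; lra.
Qed.

(** Cauchy's formula bounds 4 [pk e] |F 0| by the boundary integral of |F| / |w|; here |w| >= r on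
    the boundary, and [pk e] >= 1. *)
Lemma holo_square_sides F r : 0 < r -> holo_square F r ->
  4 * r * normc (F 0) <=
    segint (- r) r (fun x => normc (F (Complex x (- r))) + normc (F (Complex x r))) +
    segint (- r) r (fun y => normc (F (Complex r y)) + normc (F (Complex (- r) y))).
Proof.
move=> r0 H; have [k [nk hk]] := rotate_to_negi (F 0).
pose F' w := k * F w; pose G w := F' w / (w - Complex 0 0).
have H' x y : - r <= x <= r -> - r <= y <= r -> exists D, cdiff F' (Complex x y) D.
  by move=> hx hy; have [D hD] := H x y hx hy; exists (k * D); exact: cdiff_scale.
have rr : - r < 0 < r by rewrite oppr_lt0 r0.
have rP : (- r <= - r <= r) * (- r <= r <= r) by rewrite !lexx andbT/=; split; lra.
have Gc x y : (`|x| == r) || (`|y| == r) -> - r <= x <= r -> - r <= y <= r -> ccont G (Complex x y).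
  move=> hn hx hy; have [D hD] := H' x y hx hy.
  have n0 : Complex x y != Complex 0 0.
    rewrite eq_complex negb_and /=; case/orP: hn => /eqP h; apply/orP; [left|right].
      by rewrite -normr_gt0 h.
    by rewrite -normr_gt0 h.
  by have [D'] := cdiff_div hD n0; exact: cdiff_ccont.
have Fc x y : - r <= x <= r -> - r <= y <= r -> ccont F (Complex x y).
  by move=> hx hy; have [D] := H x y hx hy; exact: cdiff_ccont.
have nr : (`|r| == r) * (`|- r| == r) by rewrite normrN gtr0_norm.
have bound x y : (`|x| == r) || (`|y| == r) -> normc (G (Complex x y)) <= normc (F (Complex x y)) / r.
  move=> hn; rewrite /G /F' Normc.normcM Normc.normcV Normc.normcM nk mul1r.
  have key : r <= normc (Complex x y).
    by case/orP: hn => /eqP <-;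
      [exact: (Re_le_normc (Complex x y))|exact: (Im_le_normc (Complex x y))].
  have e0 : Complex x y - Complex 0 0 = Complex x y by congr Complex; exact: subr0.
  by rewrite e0 ler_wpM2l ?normc_ge0// lef_pV2// posrE (lt_le_trans r0 key).
suff h : 4 * normc (F 0) <= `|rectint (- r) r (- r) r G|.
  have {}h := le_trans h (rectint_le_sides (F := G) (a := - r) (b := r) (c := - r) (d := r) _ _).
  have : 4 * normc (F 0) <= r^-1 *
    (segint (- r) r (fun x => normc (F (Complex x (- r))) + normc (F (Complex x r))) +
    segint (- r) r (fun y => normc (F (Complex r y)) + normc (F (Complex (- r) y)))).
    apply: le_trans (h _ _) _.
    - by move=> x hx; split; apply: Gc; rewrite ?nr ?orbT ?rP.
    - by move=> x hx; split; apply: Gc; rewrite ?nr ?orbT ?rP.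
    rewrite mulrDr -!segintZ; first apply: lerD.
    - apply: segint_le.
      + by apply: contID; apply: contI_normc_h => x hx; apply: Gc; rewrite ?nr ?orbT ?rP.
      + move=> x hx; apply: cvgM; first exact: cvg_cst.
        have := @contID _ (- r) r _ _ (contI_normc_h (F := F) (y := - r) _) (contI_normc_h (F := F) (y := r) _).
        by apply => // x' hx'; apply: Fc; rewrite ?rP.
      + by move=> x hx; rewrite mulrC mulrDl lerD// bound// nr ?orbT.
    - apply: segint_le.
      + by apply: contID; apply: contI_normc_v => x hx; apply: Gc; rewrite ?nr ?orbT ?rP.
      + move=> x hx; apply: cvgM; first exact: cvg_cst.
        have := @contID _ (- r) r _ _ (contI_normc_v (F := F) (x := r) _) (contI_normc_v (F := F) (x := - r) _).
        by apply => // x' hx'; apply: Fc; rewrite ?rP.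
      + by move=> x hx; rewrite mulrC mulrDl lerD// bound// nr ?orbT.
    - by apply: contID; apply: contI_normc_v => x hx; apply: Fc; rewrite ?rP.
    - by apply: contID; apply: contI_normc_h => x hx; apply: Fc; rewrite ?rP.
  by rewrite ler_pdivlMl// mulrCA mulrA.
apply/ler_addgt0Pr => eta eta0.
have [e0 e00 he] := cauchy_limit rr rr H' eta0.
have e2 : 0 < e0 / 2 < e0 by apply/andP; split; lra.
have h : `|rectint (- r) r (- r) r G + 4 * pk (e0 / 2) * - normc (F 0)| <= eta.
  by rewrite -hk; exact: he.
have p1 := pk_ge1 (proj1 (andP e2)).
have n0 := normc_ge0 (F 0).
have : 4 * normc (F 0) <= 4 * pk (e0 / 2) * normc (F 0) by rewrite ler_wpM2r//; lra.
have := ler_norm (rectint (- r) r (- r) r G).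
by move: h; rewrite mulrN ler_norml => /andP[h _]; lra.
Qed.

Lemma ccontB F G z : ccont F z -> ccont G z -> ccont (fun w => F w - G w) z.
Proof.
move=> hF hG e e0; have e2 : 0 < e / 2 by rewrite divr_gt0.
have [d1 d10 h1] := hF _ e2; have [d2 d20 h2] := hG _ e2.
exists (Num.min d1 d2) => [|w]; first by rewrite lt_min d10.
rewrite lt_min => /andP[/h1 {}h1 /h2 {}h2].
have -> : F w - G w - (F z - G z) = (F w - F z) - (G w - G z) by ring.
by apply: le_lt_trans (normcD_le _ _) _; rewrite normcN; lra.
Qed.

Lemma rectintB F G a b c d :
  (forall x, a <= x <= b -> (ccont F (Complex x c) /\ ccont F (Complex x d)) /\
     (ccont G (Complex x c) /\ ccont G (Complex x d))) ->
  (forall y, c <= y <= d -> (ccont F (Complex a y) /\ ccont F (Complex b y)) /\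
     (ccont G (Complex a y) /\ ccont G (Complex b y))) ->
  rectint a b c d (fun w => F w - G w) = rectint a b c d F - rectint a b c d G.
Proof.
move=> hh hv.
have h1 : contI a b (fun x => Re (F (Complex x c)) - Re (F (Complex x d))).
  by apply: contIB; apply: contI_Re_h => x /hh[[]].
have h2 : contI a b (fun x => Re (G (Complex x c)) - Re (G (Complex x d))).
  by apply: contIB; apply: contI_Re_h => x /hh[_ []].
have h3 : contI c d (fun y => Im (F (Complex b y)) - Im (F (Complex a y))).
  by apply: contIB; apply: contI_Im_v => x /hv[[]].
have h4 : contI c d (fun y => Im (G (Complex b y)) - Im (G (Complex a y))).
  by apply: contIB; apply: contI_Im_v => x /hv[_ []].
have ReB u v : Re (u - v) = Re u - Re v by case: u; case: v.
have ImB u v : Im (u - v) = Im u - Im v by case: u; case: v.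
rewrite /rectint.
have -> : segint a b (fun x => Re (F (Complex x c) - G (Complex x c)) - Re (F (Complex x d) - G (Complex x d))) =
  segint a b (fun x => Re (F (Complex x c)) - Re (F (Complex x d))) -
  segint a b (fun x => Re (G (Complex x c)) - Re (G (Complex x d))).
  by rewrite -segintB//; apply: eq_segint => x _; rewrite !ReB; ring.
have -> : segint c d (fun y => Im (F (Complex b y) - G (Complex b y)) - Im (F (Complex a y) - G (Complex a y))) =
  segint c d (fun y => Im (F (Complex b y)) - Im (F (Complex a y))) -
  segint c d (fun y => Im (G (Complex b y)) - Im (G (Complex a y))).
  by rewrite -segintB//; apply: eq_segint => x _; rewrite !ImB; ring.
ring.
Qed.

(** Cauchy's formulas at 1 and at 0 are subtracted: the difference of the kernels is 1 / (w (w -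
    1)), at most 2 / r^2 on the boundary since r >= 2, and the boundary has length 8 r. *)
Lemma holo_square_lip F r M : 2 <= r -> holo_square F r ->
  (forall x y, - r <= x <= r -> - r <= y <= r -> normc (F (Complex x y)) <= M) ->
  normc (F 1 - F 0) <= 4 * M / r.
Proof.
move=> r2 H hM; have r0 : 0 < r by lra.
have M0 : 0 <= M.
  by apply: le_trans (normc_ge0 (F 0)) _; apply: hM; rewrite oppr_le0 ltW.
have [k [nk hk]] := rotate_to_negi (F 1 - F 0).
pose F' w := k * F w; pose G0 w := F' w / (w - Complex 0 0).
pose G1 w := F' w / (w - Complex 1 0).
have H' x y : - r <= x <= r -> - r <= y <= r -> exists D, cdiff F' (Complex x y) D.
  by move=> hx hy; have [D hD] := H x y hx hy; exists (k * D); exact: cdiff_scale.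
have rr : - r < 0 < r by rewrite oppr_lt0 r0.
have rr1 : - r < 1 < r by apply/andP; split; lra.
have rP : (- r <= - r <= r) * (- r <= r <= r) by rewrite !lexx andbT/=; split; lra.
have nr : (`|r| == r) * (`|- r| == r) by rewrite normrN gtr0_norm.
have far x y (t : R) : 0 <= t <= 1 -> (`|x| == r) || (`|y| == r) ->
   r - t <= normc (Complex x y - Complex t 0).
  move=> /andP[t0 t1] /orP[]/eqP <-.
    apply: le_trans (Re_le_normc _); rewrite /=.
    by have := lerB_dist x t; rewrite (ger0_norm t0).
  by apply: le_trans (Im_le_normc _); rewrite /= subr0; lra.
have t01 : (0 <= (0 : R) <= 1) * (0 <= (1 : R) <= 1) by rewrite !lexx ler01.
have far0 x y (t : R) : 0 <= t <= 1 -> (`|x| == r) || (`|y| == r) -> Complex x y != Complex t 0.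
  move=> ht hn; rewrite -subr_eq0 -normc_gt0; apply: lt_le_trans (far _ _ _ ht hn).
  by move: ht => /andP[]; lra.
have Gc (t x y : R) : 0 <= t <= 1 -> (`|x| == r) || (`|y| == r) -> - r <= x <= r -> - r <= y <= r ->
    ccont (fun w => F' w / (w - Complex t 0)) (Complex x y).
  move=> ht hn hx hy; have [D hD] := H' x y hx hy.
  by have [D'] := cdiff_div hD (far0 _ _ _ ht hn); exact: cdiff_ccont.
have bound x y : (`|x| == r) || (`|y| == r) -> - r <= x <= r -> - r <= y <= r ->
   normc (G1 (Complex x y) - G0 (Complex x y)) <= 2 * M / r ^+ 2.
  move=> hn hx hy; have w0 := far0 _ _ _ t01.1 hn; have w1 := far0 _ _ _ t01.2 hn.
  have -> : G1 (Complex x y) - G0 (Complex x y) =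
     F' (Complex x y) / ((Complex x y - Complex 0 0) * (Complex x y - Complex 1 0)).
    rewrite /G1 /G0 (_ : Complex 1 0 = 1)// (_ : Complex 0 0 = 0)// in w0 w1 *.
    by rewrite subr0; field; rewrite ?w0 ?subr_eq0 ?w1.
  rewrite Normc.normcM Normc.normcV !Normc.normcM nk mul1r mulrAC mulrC.
  have f0 := far _ _ _ t01.1 hn; have f1 := far _ _ _ t01.2 hn.
  have d0 : r * (r / 2) <= normc (Complex x y - Complex 0 0) * normc (Complex x y - Complex 1 0).
    by apply: ler_pM; lra.
  have r2' : 0 < r * (r / 2) by rewrite mulr_gt0// divr_gt0.
  have -> : 2 / r ^+ 2 * M = (r * (r / 2))^-1 * M by field; rewrite gt_eqF.
  apply: ler_pM; rewrite ?invr_ge0 ?mulr_ge0 ?normc_ge0//; last exact: hM.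
  by rewrite lef_pV2// posrE//; exact: lt_le_trans d0.
have E : rectint (- r) r (- r) r (fun w => G1 w - G0 w) = rectint (- r) r (- r) r G1 - rectint (- r) r (- r) r G0.
  by apply: rectintB => x hx; (split; split); apply: Gc; rewrite ?nr ?orbT ?rP ?t01.
have key : `|rectint (- r) r (- r) r G1 - rectint (- r) r (- r) r G0| <= 16 * M / r.
  rewrite -E; apply: le_trans (rectint_le_sides _ _) _.
  - by move=> x hx; split; apply: ccontB; apply: Gc; rewrite ?nr ?orbT ?rP ?t01.
  - by move=> x hx; split; apply: ccontB; apply: Gc; rewrite ?nr ?orbT ?rP ?t01.
  have -> : 16 * M / r = (2 * M / r ^+ 2 + 2 * M / r ^+ 2) * (r - - r) +
                         (2 * M / r ^+ 2 + 2 * M / r ^+ 2) * (r - - r).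
    by field; rewrite gt_eqF.
  have rNr : - r <= r by have /andP[] := rP.1.
  rewrite -!(segint_cst _ rNr); apply: lerD; apply: segint_le; try exact: contI_cst.
  - by apply: contID; apply: (contI_normc_h (F := fun w => G1 w - G0 w)) => x hx; apply: ccontB; apply: Gc; rewrite ?nr ?orbT ?rP ?t01.
  - by move=> x hx; apply: lerD; apply: bound; rewrite ?nr ?orbT ?rP.
  - by apply: contID; apply: (contI_normc_v (F := fun w => G1 w - G0 w)) => x hx; apply: ccontB; apply: Gc; rewrite ?nr ?orbT ?rP ?t01.
  - by move=> x hx; apply: lerD; apply: bound; rewrite ?nr ?orbT ?rP.
suff h : 4 * normc (F 1 - F 0) <= 16 * M / r.
  by rewrite -mulrA in h; rewrite -mulrA; move: (M / r) h => Mr h; lra.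
apply/ler_addgt0Pr => eta eta0; have eta2 : 0 < eta / 2 by rewrite divr_gt0.
have [e0 e00 he0] := cauchy_limit rr rr H' eta2.
have [e1 e10 he1] := cauchy_limit rr1 rr H' eta2.
pose e := Num.min e0 e1 / 2; have m0 : 0 < Num.min e0 e1 by rewrite lt_min e00.
have [ee0 ee1] : 0 < e < e0 /\ 0 < e < e1.
  have : Num.min e0 e1 <= e0 by rewrite ge_min lexx.
  have : Num.min e0 e1 <= e1 by rewrite ge_min lexx orbT.
  by rewrite /e; split; apply/andP; split; lra.
have h0 : `|rectint (- r) r (- r) r G0 + 4 * pk e * Im (F' 0)| <= eta / 2 by exact: he0.
have h1 : `|rectint (- r) r (- r) r G1 + 4 * pk e * Im (F' 1)| <= eta / 2 by exact: he1.
have p1 := pk_ge1 (proj1 (andP ee0)).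
have n0 := normc_ge0 (F 1 - F 0).
have hI : Im (F' 1) - Im (F' 0) = - normc (F 1 - F 0).
  by rewrite -hk /F' mulrBr; case: (k * F 1) => ? ?; case: (k * F 0).
have : 4 * normc (F 1 - F 0) <= 4 * pk e * normc (F 1 - F 0) by rewrite ler_wpM2r//; lra.
have -> : normc (F 1 - F 0) = Im (F' 0) - Im (F' 1) by lra.
have := ler_norm (rectint (- r) r (- r) r G1 - rectint (- r) r (- r) r G0).
by move: h0 h1; rewrite !ler_norml => /andP[_ h0] /andP[h1 _]; lra.
Qed.

End cauchy.

(** * Sub-mean value inequality on a square *)

Section submean.
Context (R : realType).
Local Notation normc := Normc.normc.
Local Notation leb := (@lebesgue_measure R).

Lemma ge0_integral_opp (f : R -> \bar R) :
  measurable_fun setT f -> (forall x, (0 <= f x)%E) ->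
  (\int[leb]_x f (- x)%R = \int[leb]_x f x)%E.
Proof.
move=> mf f0.
rewrite -[LHS](@ge0_integral_pushforward _ _ _ _ _ (-%R : measurableTypeR R -> measurableTypeR R) _ _ setT) //.
by apply: eq_measure_integral => //= A mA AS; exact: lebesgue_measureN.
Qed.

Lemma lebesgue_itvcc (a b : R) : a <= b -> leb `[a, b] = (b - a)%:E.
Proof.
move=> ab; rewrite [LHS](@lebesgue_measure_itv R `[a, b]) /= lte_fin -EFinB.
by move: ab; rewrite le_eqVlt => /predU1P[->|->//]; rewrite ltxx subrr.
Qed.

Lemma integral_itv_cst (a b k : R) : a <= b ->
  (\int[leb]_(x in `[a, b]) k%:E = (k * (b - a))%:E)%E.
Proof.
move=> ab; rewrite integral_cst// EFinM.
exact: (congr1 (fun m => k%:E * m)%E (lebesgue_itvcc ab)).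
Qed.

Definition square (r : R) : set (R * R) := `[- r, r] `*` `[- r, r].

Lemma measurable_square r : measurable (square r).
Proof. by apply: measurableX. Qed.

Lemma erestrict_le (T : Type) (D : set T) (f h : T -> \bar R) x :
  (0 <= h x)%E -> (D x -> (f x <= h x)%E) -> ((f \_ D) x <= h x)%E.
Proof. by move=> h0 hD; rewrite patchE; case: ifPn => //; rewrite inE. Qed.

(** [holo_square_sides] is integrated over the half side rho in [r / 2, r]. With F extended by 0 off
    the square, [V x] and [Hh y] dominate the integrals along the sides of every smaller square, and
    by Tonelli each of the four terms contributes at most the integral over the square. *)
Lemma holo_square_submean F r : 0 < r -> holo_square F r ->
  measurable_fun (square r) (fun p => normc (F (Complex p.1 p.2))) ->
  ((r ^+ 2 * normc (F 0))%:E <=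
    4%:E * \int[leb \x leb]_(p in square r) (normc (F (Complex p.1 p.2)))%:E)%E.
Proof.
move=> r0 H mF; have mS := measurable_square r.
pose g (p : R * R) := (normc (F (Complex p.1 p.2)))%:E.
pose gt := g \_ (square r).
have mgt : measurable_fun setT gt.
  by apply/(measurable_restrictT _ mS)/measurable_EFinP.
have gt0 p : (0 <= gt p)%E by apply: erestrict_ge0 => q _; rewrite lee_fin normc_ge0.
have gtE p : square r p -> gt p = g p by move=> hp; rewrite /gt patchE ifT// inE.
pose V x := (\int[leb]_y gt (x, y))%E; pose Hh y := (\int[leb]_x gt (x, y))%E.
have mV : measurable_fun setT V by exact: measurable_fun_fubini_tonelli_F.
have mH : measurable_fun setT Hh by exact: measurable_fun_fubini_tonelli_G.
have V0 x : (0 <= V x)%E by apply: integral_ge0.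
have H0 x : (0 <= Hh x)%E by apply: integral_ge0.
set I := (\int[leb \x leb]_(p in square r) _)%E.
have IV : I = (\int[leb]_x V x)%E by rewrite /I integral_mkcond fubini_tonelli1.
have IH : I = (\int[leb]_x Hh x)%E by rewrite /I integral_mkcond fubini_tonelli2.
have Fc x y : - r <= x <= r -> - r <= y <= r -> ccont F (Complex x y).
  by move=> hx hy; have [D] := H x y hx hy; exact: cdiff_ccont.
have vb rho x : 0 <= rho <= r -> - r <= x <= r ->
    ((segint (- rho) rho (fun y => normc (F (Complex x y))))%:E <= V x)%E.
  move=> /andP[rho0 rhor] hx.
  have cy : contI (- rho) rho (fun y => normc (F (Complex x y))).
    by apply: contI_normc_v => y /andP[? ?]; apply: Fc => //; apply/andP; split; lra.
  rewrite EFin_segint// integral_mkcond; apply: ge0_le_integral => //.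
  - by move=> y _; apply: erestrict_ge0 => q _; rewrite lee_fin normc_ge0.
  - by have /integrableP[h _] := contI_integrable cy; apply/(measurable_restrictT _ (measurable_itv _)).
  - by apply: measurableT_comp.
  - move=> y _; apply: (@erestrict_le _ _ _ (fun y => gt (x, y))) => //=; rewrite in_itv/= => /andP[? ?].
    rewrite gtE//; split => /=; rewrite in_itv//=.
    by apply/andP; split; lra.
have hb rho y : 0 <= rho <= r -> - r <= y <= r ->
    ((segint (- rho) rho (fun x => normc (F (Complex x y))))%:E <= Hh y)%E.
  move=> /andP[rho0 rhor] hx.
  have cy : contI (- rho) rho (fun x => normc (F (Complex x y))).
    by apply: contI_normc_h => x /andP[? ?]; apply: Fc => //; apply/andP; split; lra.
  rewrite EFin_segint// integral_mkcond; apply: ge0_le_integral => //.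
  - by move=> x _; apply: erestrict_ge0 => q _; rewrite lee_fin normc_ge0.
  - by have /integrableP[h _] := contI_integrable cy; apply/(measurable_restrictT _ (measurable_itv _)).
  - by apply: measurableT_comp.
  - move=> x _; apply: (@erestrict_le _ _ _ (fun x => gt (x, y))) => //=; rewrite in_itv/= => /andP[? ?].
    rewrite gtE//; split => /=; rewrite in_itv//=.
    by apply/andP; split; lra.
have key rho : r / 2 <= rho <= r ->
    ((2 * r * normc (F 0))%:E <= (V rho + V (- rho)%R) + (Hh rho + Hh (- rho)%R))%E.
  move=> /andP[h1 h2]; have rho0 : 0 < rho by lra.
  have rhoP : 0 <= rho <= r by rewrite (ltW rho0).
  have e1 : - r <= rho <= r by apply/andP; split; lra.
  have e2 : - r <= - rho <= r by apply/andP; split; lra.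
  have := holo_square_sides rho0 (holo_square_sub h2 H).
  have ch y : - r <= y <= r -> contI (- rho) rho (fun x => normc (F (Complex x y))).
    by move=> hy; apply: contI_normc_h => x /andP[? ?]; apply: Fc => //; apply/andP; split; lra.
  have cv x : - r <= x <= r -> contI (- rho) rho (fun y => normc (F (Complex x y))).
    by move=> hy; apply: contI_normc_v => y /andP[? ?]; apply: Fc => //; apply/andP; split; lra.
  rewrite (segintD (ch _ e2) (ch _ e1)) (segintD (cv _ e1) (cv _ e2)) => h.
  apply: (@le_trans _ _ (4 * rho * normc (F 0))%:E).
    by rewrite lee_fin ler_wpM2r ?normc_ge0//; lra.
  move: h; rewrite -lee_fin => /le_trans; apply.
  rewrite addrC !EFinD; apply: leeD; first by apply: leeD; exact: vb.
  by rewrite addeC; apply: leeD; exact: hb.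
have mVN : measurable_fun setT (fun x : R => V (- x)%R) by apply: (measurableT_comp mV); exact: oppr_measurable.
have mHN : measurable_fun setT (fun x : R => Hh (- x)%R) by apply: (measurableT_comp mH); exact: oppr_measurable.
have -> : (4%:E * I = (I + I) + (I + I))%E.
  by rewrite mule_natl -addeA.
have -> : ((r ^+ 2 * normc (F 0))%:E = \int[leb]_(x in `[(r / 2)%R, r]) (2 * r * normc (F 0))%:E)%E.
  rewrite integral_itv_cst; last lra.
  by congr EFin; field.
have E1 : (\int[leb]_(x in setT) ((V x + V (- x)%R) + (Hh x + Hh (- x)%R)) = (I + I) + (I + I))%E.
  rewrite ge0_integralD//; first last.
  - exact: emeasurable_funD.
  - by move=> x _; rewrite adde_ge0.
  - exact: emeasurable_funD.
  - by move=> x _; rewrite adde_ge0.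
  have EV := ge0_integral_opp mV V0; have EH := ge0_integral_opp mH H0.
  have EVV : (\int[leb]_x (V x + V (- x)%R) = I + I)%E.
    by apply: etrans (ge0_integralD _ _ _ _ _ _) _ => //; rewrite [X in (_ + X)%E]EV -IV.
  have EHH : (\int[leb]_x (Hh x + Hh (- x)%R) = I + I)%E.
    by apply: etrans (ge0_integralD _ _ _ _ _ _) _ => //; rewrite [X in (_ + X)%E]EH -IH.
  by congr (_ + _)%E; [exact: EVV|exact: EHH].
rewrite -E1 integral_mkcond; apply: ge0_le_integral => //.
- move=> x _; apply: erestrict_ge0 => y _; rewrite lee_fin mulr_ge0 ?normc_ge0//; lra.
- by apply/(measurable_restrictT _ (measurable_itv _)).
- by apply: emeasurable_funD; exact: emeasurable_funD.
- move=> x _; apply: (@erestrict_le _ _ _ (fun x => ((V x + V (- x)%R) + (Hh x + Hh (- x)%R))%E)).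
    by apply: adde_ge0; apply: adde_ge0.
  by rewrite /= in_itv/= => /key.
Qed.

Lemma square_measure r : 0 <= r -> ((leb \x leb)%E (square r) = (4 * r ^+ 2)%:E).
Proof.
move=> r0; rewrite /square product_measure1E//.
have h : leb `[- r, r] = (r - - r)%:E by apply: lebesgue_itvcc; lra.
by apply: etrans (congr1 (fun m => m * m)%E h) _; rewrite -EFinM; congr EFin; ring.
Qed.

(** The preceding inequality reads |F 0| / 16 <= mean of |F|, the square having area 4 r^2; Jensen's
    inequality then keeps the 16 inside psi. *)
Lemma holo_square_jensen psi F r K : orlicz_function psi -> 0 < r -> 0 < K -> holo_square F r ->
  measurable_fun (square r) (fun p => normc (F (Complex p.1 p.2))) ->
  ((psi (normc (F 0) / (16 * K)))%:E <= ((4 * r ^+ 2)^-1)%:E *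
     \int[leb \x leb]_(p in square r) (psi (normc (F (Complex p.1 p.2)) / K))%:E)%E.
Proof.
move=> hpsi r0 K0 H mF; have r2 : 0 < 4 * r ^+ 2 by rewrite mulr_gt0// exprn_gt0.
have mFK : measurable_fun (square r) (fun p => normc (F (Complex p.1 p.2)) / K).
  exact: measurable_funM.
apply: (@orlicz_jensen R psi hpsi _ _ (leb \x leb)%E (square r) _ _
  (fun p : R * R => normc (F (Complex p.1 p.2)) / K) (measurable_square r) _ _ mFK).
- by rewrite invr_ge0 ltW.
- by rewrite [X in (_ * X)%E](square_measure (ltW r0)) -EFinM mulVf// gt_eqF.
- by move=> p _; rewrite divr_ge0 ?normc_ge0// ltW.
- by rewrite divr_ge0 ?normc_ge0// mulr_ge0// ltW.
have := holo_square_submean r0 H mF; set I := (X in (4%:E * X)%E) => hI.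
have -> : (\int[leb \x leb]_(x in square r) (normc (F (Complex x.1 x.2)) / K)%:E = K^-1%:E * I)%E.
  rewrite /I -ge0_integralZl//.
  - by apply: eq_integral => p _; rewrite -EFinM mulrC.
  - exact: measurable_square.
  - exact/measurable_EFinP.
  - by move=> p _; rewrite lee_fin normc_ge0.
  - by rewrite lee_fin invr_ge0 ltW.
rewrite muleA -EFinM.
have -> : (normc (F 0) / (16 * K))%:E = (((4 * r ^+ 2)^-1 / K / 4)%:E * (r ^+ 2 * normc (F 0))%:E)%E.
  by rewrite -EFinM; congr EFin; field; rewrite !gt_eqF.
apply: le_trans (lee_wpmul2l _ hI) _.
  by rewrite lee_fin !divr_ge0 ?invr_ge0 ?ltW.
by rewrite muleA -EFinM divfK.
Qed.

End submean.

(** * Iterated integrals on C^N *)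

Section tuple_integral.
Context (R : realType).
Local Notation leb := (@lebesgue_measure R).

Definition tset n (t : n.-tuple R) (i : 'I_n) (x : R) : n.-tuple R :=
  [tuple if k == i then x else tnth t k | k < n].

Lemma tnth_tset n (t : n.-tuple R) i x k :
  tnth (tset t i x) k = if k == i then x else tnth t k.
Proof. by rewrite tnth_mktuple. Qed.

Lemma tsetC n (t : n.-tuple R) i j x y : i != j ->
  tset (tset t i x) j y = tset (tset t j y) i x.
Proof.
move=> ij; apply: eq_from_tnth => k; rewrite !tnth_tset.
by case: eqVneq => // ->; rewrite eq_sym (negbTE ij).
Qed.

Lemma measurable_tset_pair n (i : 'I_n) :
  measurable_fun setT (fun p : n.-tuple R * R => tset p.1 i p.2).
Proof.
apply/measurable_fun_tnthP => k /=.
rewrite (_ : _ \o _ = fun p => if k == i then p.2 else tnth p.1 k); last first.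
  by apply/funext => p /=; rewrite tnth_tset.
case: (k == i) => /=; first exact: measurable_snd.
by apply: (measurableT_comp (@measurable_tnth _ R n k)); exact: measurable_fst.
Qed.

Lemma measurable_tset n (i : 'I_n) (t : n.-tuple R) :
  measurable_fun setT (fun x : R => tset t i x).
Proof. exact: (measurableT_comp (g := fun x : R => (t, x)) (measurable_tset_pair i) (measurable_pair1 t)). Qed.

(** The result remains a function of the whole tuple, constant in coordinate i, so that partial
    integrals compose and commute without reindexing. *)
Definition pint n (i : 'I_n) (F : n.-tuple R -> \bar R) (t : n.-tuple R) : \bar R :=
  (\int[leb]_x F (tset t i x))%E.

Definition nnm n (F : n.-tuple R -> \bar R) :=
  measurable_fun setT F /\ forall t, (0 <= F t)%E.

Lemma nnm_pint n (i : 'I_n) F : nnm F -> nnm (pint i F).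
Proof.
move=> [mF F0]; split; last by move=> t; apply: integral_ge0.
apply: (@measurable_fun_fubini_tonelli_F _ _ _ _ _ leb (fun p : n.-tuple R * R => F (tset p.1 i p.2))) => //.
by apply: (measurableT_comp mF); exact: measurable_tset_pair.
Qed.

Lemma pintC n (i j : 'I_n) F t : nnm F -> pint i (pint j F) t = pint j (pint i F) t.
Proof.
move=> [mF F0]; have [->//|ij] := eqVneq i j.
have m2 : measurable_fun setT (fun p : R * R => tset (tset t i p.1) j p.2).
  apply: (measurableT_comp (g := fun p : R * R => (tset t i p.1, p.2)) (measurable_tset_pair j)).
  apply: measurable_fun_pair; last exact: measurable_snd.
  by apply: (measurableT_comp (measurable_tset i t)); exact: measurable_fst.
rewrite /pint.
have := @fubini_tonelli _ _ _ _ _ leb leb (fun p => F (tset (tset t i p.1) j p.2)) (measurableT_comp mF m2) (fun p => F0 _).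
move=> /= ->; apply: eq_integral => y _; apply: eq_integral => x _.
by rewrite tsetC.
Qed.

Definition pints n (s : seq 'I_n) F := foldr (@pint n) F s.

Lemma nnm_pints n (s : seq 'I_n) F : nnm F -> nnm (pints s F).
Proof. by move=> h; elim: s => //= i s; exact: nnm_pint. Qed.

Lemma eq_pint n i (F G : n.-tuple R -> \bar R) : F =1 G -> pint i F =1 pint i G.
Proof. by move=> h t; apply: eq_integral => x _; rewrite h. Qed.

Lemma pints_rot n (s1 s2 : seq 'I_n) i F : nnm F ->
  pints (s1 ++ i :: s2) F =1 pint i (pints (s1 ++ s2) F).
Proof.
move=> hF; elim: s1 => //= j s1 IH t.
by rewrite (eq_pint _ IH) pintC//; exact: nnm_pints.
Qed.

(** Tonelli for an arbitrary order of integration. It serves to group the two parts of each complex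
    coordinate, and to integrate innermost the coordinate that carries the singularity of the
    weight. *)
Lemma perm_pints n (s s' : seq 'I_n) F : nnm F -> perm_eq s s' ->
  pints s F =1 pints s' F.
Proof.
move=> hF; elim: s' s => [|i s' IH] s.
  by move=> /perm_nilP ->.
move=> h; have is_ : i \in s by rewrite (perm_mem h) mem_head.
case/splitPr: is_ h => s1 s2 h t; rewrite pints_rot//=.
apply: eq_pint; apply: IH.
by rewrite -(perm_cons i) -[i :: s1 ++ s2]/([:: i] ++ s1 ++ s2) -(perm_catCA s1 [:: i] s2).
Qed.

Let tset_cons0 n (x y : R) (t : n.-tuple R) :
  tset [tuple of x :: t] ord0 y = [tuple of y :: t].
Proof.
apply: eq_from_tnth => k; rewrite tnth_tset.
by case: (unliftP ord0 k) => [j ->|->]; rewrite ?eqxx ?tnthS// eq_sym (negbTE (neq_lift _ _)) !tnthS.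
Qed.

Let tset_consS n (x y : R) (t : n.-tuple R) j :
  tset [tuple of x :: t] (lift ord0 j) y = [tuple of x :: tset t j y].
Proof.
apply: eq_from_tnth => k; rewrite tnth_tset.
case: (unliftP ord0 k) => [j' ->|->]; last by rewrite (negbTE (neq_lift _ _)).
by rewrite !tnthS tnth_tset (inj_eq lift_inj).
Qed.

Let pints_cons n (s : seq 'I_n) F (x : R) (t : n.-tuple R) :
  pints (map (lift ord0) s) F [tuple of x :: t] = pints s (fun u : n.-tuple R => F [tuple of x :: u]) t.
Proof.
elim: s t => //= j s IH t; apply: eq_integral => y _.
by rewrite tset_consS IH.
Qed.

Lemma integral_tuple_measure n F t : nnm F ->
  (\int[tuple_measure leb n]_u F u = pints (enum 'I_n) F t)%E.
Proof.
elim: n F t => [|n IH] F t [mF F0].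
  rewrite (_ : enum 'I_0 = [::]) /=; last by apply/size0nil; rewrite size_enum_ord.
  by rewrite integral_dirac// diracT mul1e (tuple0 t).
rewrite enum_ordSl /=.
have mc : measurable_fun setT (@tuple_cons _ R n) by exact: measurable_cons.
transitivity (\int[leb \x tuple_measure leb n]_p F (tuple_cons p))%E.
  have := @ge0_integral_pushforward _ _ _ _ R (@tuple_cons _ (measurableTypeR R) n) mc (leb \x tuple_measure leb n)%E setT F.
  move=> /(_ measurableT mF) h. apply: etrans (h _) _ => //.
rewrite fubini_tonelli1//; last exact: (measurableT_comp (f := F) (g := @tuple_cons _ R n) mF mc).
apply: eq_integral => x _.
rewrite (tuple_eta t) tset_cons0 pints_cons; apply: IH; split => // .
exact: (measurableT_comp (f := F \o @tuple_cons _ R n) (g := fun u => (x, u))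
  (measurableT_comp mF mc) (pair1_measurable x)).
Qed.

Lemma pints_vanish n (s : seq 'I_n) F k (P : R -> Prop) : k \notin s ->
  (forall t, ~ P (tnth t k) -> F t = 0%E) ->
  forall t, ~ P (tnth t k) -> pints s F t = 0%E.
Proof.
move=> ks h; elim: s ks => //= i s IH; rewrite inE negb_or => /andP[ki ks] t Pt.
rewrite /pint integral0_eq// => x _; apply: IH => //.
by rewrite tnth_tset (negbTE ki).
Qed.

Lemma pint_bound n i (F : n.-tuple R -> \bar R) t (a b M : R) : nnm F -> a <= b -> 0 <= M ->
  (forall x, (F (tset t i x) <= M%:E)%E) ->
  (forall x, ~ (a <= x <= b) -> F (tset t i x) = 0%E) ->
  (pint i F t <= ((b - a) * M)%:E)%E.
Proof.
move=> [mF F0] ab M0 hM h0; rewrite mulrC -integral_itv_cst// integral_mkcond.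
apply: ge0_le_integral => //.
- exact: (measurableT_comp mF (measurable_tset i t)).
- by apply/(measurable_restrictT _ (measurable_itv _)).
- move=> x _; rewrite patchE; case: ifPn => [_|]; first exact: hM.
  by rewrite notin_setE /= in_itv /= => /h0 ->.
Qed.

(** F vanishes when a coordinate of L leaves its interval, so each of them costs a factor l; the
    innermost coordinates s are bounded separately by M. *)
Lemma pints_bound n (L s : seq 'I_n) (F : n.-tuple R -> \bar R) (M l : R) (a b : 'I_n -> R) :
  nnm F -> uniq (L ++ s) -> 0 <= M -> (forall k, a k <= b k /\ b k - a k <= l) ->
  (forall k t, k \in L -> ~ (a k <= tnth t k <= b k) -> F t = 0%E) ->
  (forall t, (pints s F t <= M%:E)%E) ->
  forall t, (pints (L ++ s) F t <= (l ^+ size L * M)%:E)%E.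
Proof.
move=> hF; elim: L => [|k L IH] /= uL M0 ab h hs t; first by rewrite mul1r.
move: uL => /andP[kn uL]; have [abk lk] := ab k.
have l0 : 0 <= l by apply: le_trans lk; rewrite subr_ge0.
have hM := IH uL M0 ab (fun k' t' hk' => h k' t' (@mem_behead _ (k :: L) k' hk')) hs.
apply: (@le_trans _ _ ((b k - a k) * (l ^+ size L * M))%:E).
  apply: pint_bound => //; first exact: nnm_pints.
    by rewrite mulr_ge0// exprn_ge0.
  move=> x hx; apply: (pints_vanish (k := k) (P := fun x => a k <= x <= b k)) => //.
    by move=> t' ht'; apply: (h k) => //; rewrite mem_head.
  by rewrite tnth_tset eqxx.
by rewrite lee_fin exprS -mulrA ler_wpM2r// mulr_ge0// exprn_ge0.
Qed.

Section Cn.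
Variable N : nat.
Local Notation CN := 'rV[R[i]]_N.

Lemma measurable_complex_coords :
  @measurable_fun _ _ ((N + N).-tuple (measurableTypeR R)) (borel CN) setT (@complex_coords R N).
Proof.
by apply: measurable_fun_rV => j;
  under eq_fun do rewrite mxE /=; exact: measurable_tnth.
Qed.

Lemma nnm_coords (G : borel CN -> \bar R) : measurable_fun setT G ->
  (forall z, (0 <= G z)%E) -> nnm (G \o @complex_coords R N).
Proof.
by move=> mG G0; split => [|t]; [exact: (measurableT_comp mG measurable_complex_coords)|exact: G0].
Qed.

Lemma integral_lebesgue_Cn (G : borel CN -> \bar R) s t : measurable_fun setT G ->
  (forall z, (0 <= G z)%E) -> perm_eq (enum 'I_(N + N)) s ->
  (\int[@lebesgue_Cn R N]_z G z = pints s (G \o @complex_coords R N) t)%E.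
Proof.
move=> mG G0 hs; have h := nnm_coords mG G0.
rewrite -(perm_pints h hs) -integral_tuple_measure//.
have := @ge0_integral_pushforward _ _ ((N + N).-tuple (measurableTypeR R)) (borel CN) R
  (@complex_coords R N) measurable_complex_coords (tuple_measure leb (N + N)) setT G measurableT mG.
move=> h'; exact: (h' (fun z _ => G0 z)).
Qed.

End Cn.

End tuple_integral.

(** * Geometry of the ball *)

Section hermitian_space.
Context (R : realType) (N : nat).
Local Notation CN := 'rV[R[i]]_N.
Local Notation normc := Normc.normc.
Local Notation Re := complex.Re.
Local Notation Im := complex.Im.
Implicit Types (z w u v : CN) (c : R[i]).

(* Sealed copies of [enorm] and [inner]: unification never unfolds them. *)
Fact hnorm_seal : {f : CN -> R | f = @enorm R N}.
Proof. by exists (@enorm R N). Qed.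

Definition hnorm : CN -> R := sval hnorm_seal.

Fact hdot_seal : {f : CN -> CN -> R[i] | f = @inner R N}.
Proof. by exists (@inner R N). Qed.

Definition hdot : CN -> CN -> R[i] := sval hdot_seal.

Lemma enormE : @enorm R N = hnorm.
Proof. by rewrite /hnorm; case: hnorm_seal. Qed.

Lemma hdotE : @inner R N = hdot.
Proof. by rewrite /hdot; case: hdot_seal. Qed.

Local Notation enorm := hnorm.
Local Notation inner := hdot.

Lemma innerE z w : inner z w = \sum_(j < N) z ord0 j * conjc (w ord0 j).
Proof. by rewrite -hdotE /Defs.inner dotmxE mxE; apply: eq_bigr => j _; rewrite !mxE. Qed.

Lemma innerDl z w u : inner (z + w) u = inner z u + inner w u.
Proof. by rewrite !innerE -big_split; apply: eq_bigr => j _; rewrite mxE mulrDl. Qed.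

Lemma innerZl c z w : inner (c *: z) w = c * inner z w.
Proof. by rewrite !innerE mulr_sumr; apply: eq_bigr => j _; rewrite mxE mulrA. Qed.

Lemma innerC z w : inner w z = conjc (inner z w).
Proof.
rewrite !innerE rmorph_sum; apply: eq_bigr => j _ /=.
case: (z _ _) => a b; case: (w _ _) => a' b'.
by apply/eqP; rewrite eq_complex /=; apply/andP; split; apply/eqP; ring.
Qed.

Lemma innerNl z w : inner (- z) w = - inner z w.
Proof. by rewrite -scaleN1r innerZl mulN1r. Qed.

Lemma innerBl z w u : inner (z - w) u = inner z u - inner w u.
Proof. by rewrite innerDl innerNl. Qed.

Lemma normcJ c : normc (conjc c) = normc c.
Proof. by case: c => a b; rewrite /= sqrrN. Qed.

Lemma enorm_ge0 z : 0 <= enorm z.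
Proof. by rewrite -enormE; exact: sqrtr_ge0. Qed.

Lemma inner_cauchy_schwarz z w : `|inner z w| ^+ 2 <= inner z z * inner w w.
Proof. by rewrite -hdotE; have [] := CauchySchwarz (@dotmx _ N) z w. Qed.

Lemma enorm_sqr_normc z : enorm z ^+ 2 = \sum_(j < N) normc (z ord0 j) ^+ 2.
Proof. by rewrite -enormE enorm_sqr; apply: eq_bigr => j _; rewrite normc_sqr. Qed.

Lemma inner_self z : inner z z = real_complex R (enorm z ^+ 2).
Proof.
rewrite innerE -enormE enorm_sqr rmorph_sum; apply: eq_bigr => j _.
case: (z ord0 j) => a b /=; rewrite -[RHS]/(Complex _ _) /=.
by congr Complex; rewrite /=; ring.
Qed.

Lemma enorm_le z (a : R) : 0 <= a -> (enorm z <= a) = (enorm z ^+ 2 <= a ^+ 2).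
Proof. by move=> a0; rewrite ler_pXn2r// nnegrE enorm_ge0. Qed.

Lemma normc_coord_le z j : normc (z ord0 j) <= enorm z.
Proof.
rewrite -(@ler_pXn2r _ 2) ?nnegrE ?normc_ge0 ?enorm_ge0// enorm_sqr_normc (bigD1 j)//=.
by rewrite lerDl sumr_ge0// => k _; rewrite exprn_ge0// normc_ge0.
Qed.

Lemma enorm0 : enorm 0 = 0.
Proof.
apply/eqP; rewrite -sqrf_eq0 enorm_sqr_normc big1// => j _.
by rewrite mxE Normc.normc0 expr0n.
Qed.

Lemma enorm0_eq0 z : enorm z = 0 -> z = 0.
Proof.
move=> z0; apply/rowP => j; rewrite mxE; apply: Normc.eq0_normc; apply/eqP.
by rewrite eq_le normc_ge0 andbT -z0 normc_coord_le.
Qed.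

Lemma enormZ c z : enorm (c *: z) = normc c * enorm z.
Proof.
have E u : (forall j, u ord0 j = c * z ord0 j) -> enorm u = normc c * enorm z.
  move=> hu; apply/eqP; rewrite -(@eqrXn2 _ 2) ?enorm_ge0 ?mulr_ge0 ?normc_ge0 ?enorm_ge0//.
  rewrite [X in _ == X]exprMn.
  rewrite [X in X == _]enorm_sqr_normc.
  rewrite [X in _ == _ * X]enorm_sqr_normc.
  rewrite mulr_sumr.
  apply/eqP; apply: eq_bigr => j _.
  by rewrite hu Normc.normcM exprMn.
by apply: E => j; rewrite mxE.
Qed.

Lemma enormN z : enorm (- z) = enorm z.
Proof. by rewrite -scaleN1r enormZ normcN Normc.normc1 mul1r. Qed.

Lemma cauchy_schwarz z w : normc (inner z w) <= enorm z * enorm w.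
Proof.
rewrite -(@ler_pXn2r _ 2) ?nnegrE ?mulr_ge0 ?normc_ge0 ?enorm_ge0//.
have h := inner_cauchy_schwarz z w.
rewrite !inner_self -[`|inner z w|]/(real_complex R (normc (inner z w))) in h.
rewrite -rmorphXn -rmorphM lecR in h; apply: (le_trans h).
by move: (enorm z) (enorm w) => a b; rewrite exprMn.
Qed.

Lemma enormD_sqr z w : enorm (z + w) ^+ 2 = enorm z ^+ 2 + 2 * Re (inner z w) + enorm w ^+ 2.
Proof.
have h u : enorm u ^+ 2 = Re (inner u u) by rewrite inner_self.
have D2 u v v' : inner u (v + v') = inner u v + inner u v'.
  rewrite (innerC (v + v') u) innerDl (innerC v u) (innerC v' u).
  by case: (inner v u) => ? ?; case: (inner v' u) => ? ?; rewrite /= opprD.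
have key s : inner s s = (inner z z + inner z w) + (inner w z + inner w w) ->
    enorm s ^+ 2 = enorm z ^+ 2 + 2 * Re (inner z w) + enorm w ^+ 2.
  move=> E; have hs := h s; have hz := h z; have hw := h w; have hc := innerC z w.
  rewrite hs hz hw E hc.
  by case: (inner z z) => ? ?; case: (inner z w) => ? ?; case: (inner w w) => ? ? /=; ring.
by apply: key; rewrite innerDl !D2.
Qed.

Lemma enormD z w : enorm (z + w) <= enorm z + enorm w.
Proof.
have h := le_trans (ler_norm _) (le_trans (Re_le_normc _) (cauchy_schwarz z w)).
by rewrite enorm_le ?addr_ge0 ?enorm_ge0// enormD_sqr sqrrD -mulr_natl; lra.
Qed.

Lemma enorm_le_sum z : enorm z <= \sum_(j < N) normc (z ord0 j).
Proof.
rewrite enorm_le ?sumr_ge0// => [|j _]; last exact: normc_ge0.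
rewrite enorm_sqr_normc expr2 mulr_suml; apply: ler_sum => j _.
rewrite expr2 ler_wpM2l ?normc_ge0// (bigD1 j)//= lerDl sumr_ge0// => k _.
exact: normc_ge0.
Qed.

Lemma continuous_enorm_dist w : continuous (fun z : CN => enorm (z - w)).
Proof.
have -> : (fun z : CN => enorm (z - w)) =
    (fun z => Num.sqrt (\sum_(j < N) ((Re (z ord0 j) - Re (w ord0 j)) ^+ 2 + (Im (z ord0 j) - Im (w ord0 j)) ^+ 2))).
  apply/funext => z; rewrite -[LHS]ger0_norm ?enorm_ge0// -sqrtr_sqr -enormE enorm_sqr.
  congr Num.sqrt; apply: eq_bigr => j _; rewrite !mxE.
  by case: (z ord0 j) => ? ?; case: (w ord0 j).
have csq (f : CN -> R) (a : R) : continuous f -> continuous (fun z => (f z - a) ^+ 2).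
  move=> cf z; apply: (@continuous_comp _ _ _ f (fun x : R => (x - a) ^+ 2)); first exact: cf.
  apply: (@continuous_comp _ _ _ (fun x : R => x - a) (fun x : R => x ^+ 2)); last exact: exprn_continuous.
  by apply: cvgB; [exact: cvg_id|exact: cvg_cst].
have cD (f g : CN -> R) : continuous f -> continuous g -> continuous (fun z => f z + g z).
  by move=> cf cg z; apply: (@cvgD _ _ _ (nbhs z) _ f g); [exact: cf|exact: cg].
move=> z; apply: (continuous_comp (g := Num.sqrt)); last exact: sqrt_continuous.
move: z; apply: continuous_big; first exact: add_continuous.
move=> j _; apply: cD; apply: csq => z.
  by apply: continuous_comp; [exact: coord_continuous|exact: continuous_Re].
by apply: continuous_comp; [exact: coord_continuous|exact: continuous_Im].
Qed.

Lemma open_enorm_ball w (e : R) : open [set z : CN | enorm (z - w) < e].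
Proof.
have /continuousP := @continuous_enorm_dist w.
by move=> /(_ _ (@open_lt _ e)).
Qed.

Lemma open_unit_ball : open (@unit_ball R N).
Proof.
have := @open_enorm_ball 0 1.
by rewrite /unit_ball enormE; congr open; apply/seteqP; split => z /=; rewrite subr0.
Qed.

Lemma nbhs_normc (c : R[i]) (P : set R[i]) : nbhs c P ->
  exists2 r : R, 0 < r & forall w : R[i], normc (w - c) < r -> P w.
Proof.
move=> /nbhs_ballP[[e e']]; rewrite /= ltcE /= => /andP[/eqP -> e0] eP.
exists e => // w hw; apply: eP; rewrite /ball /= -[`|c - w|]/(real_complex R _).
by rewrite -[Complex e 0]/(real_complex R e) ltcR normcB_sym.
Qed.

Lemma normc_nbhs (c : R[i]) (r : R) : 0 < r -> nbhs c [set w : R[i] | normc (w - c) < r].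
Proof.
move=> r0; apply/nbhs_ballP; exists (real_complex R r) => /=; first by rewrite ltcR.
move=> w; rewrite /ball /= -[`|c - w|]/(real_complex R _) ltcR.
by rewrite normcB_sym.
Qed.

Lemma continuous_enorm_normc (f : CN -> R[i]) z :
  (forall e, 0 < e -> exists2 del, 0 < del & forall w, enorm (w - z) < del ->
     normc (f w - f z) < e) -> {for z, continuous f}.
Proof.
move=> h P /nbhs_normc[r r0 rP]; have [del del0 hd] := h r r0.
rewrite nbhsE; exists [set w | enorm (w - z) < del].
  by split; [exact: open_enorm_ball|rewrite /= subrr enorm0].
by move=> w /hd; exact: rP.
Qed.

Lemma measurable_continuous_on (D : set CN) (f : CN -> R[i]) : open D ->
  (forall z, D z -> {for z, continuous f}) ->
  @measurable_fun _ _ (borel CN) (borel R[i]) D f.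
Proof.
move=> oD cf; apply: (@measurability _ _ (borel CN) (borel R[i]) D f (@open R[i])) => //.
move=> _ [U oU <-]; apply: sub_sigma_algebra; rewrite openE => z [Dz Uz].
rewrite /interior; apply: filterI.
  by rewrite openE in oD; exact: oD.
by apply: cf => //; apply: open_nbhs_nbhs.
Qed.

Lemma differentiable_cdiff (f : CN -> R[i]) z v (u0 : R[i]) : differentiable f (z + u0 *: v) ->
  exists D, cdiff (fun c => f (z + c *: v)) u0 D.
Proof.
move=> /diff_derivable - /(_ v) /cvg_ex[D hD]; exists D => e e0.
have /hD : nbhs D [set w : R[i] | normc (w - D) < e] by exact: normc_nbhs.
rewrite /= => /nbhs_normc[r r0 hr]; exists r => // w hw.
have [->|wu0] := eqVneq w u0; first by rewrite !subrr mulr0 subr0 Normc.normc0 mulr0.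
have h0 : w - u0 != 0 by rewrite subr_eq0.
have := hr (w - u0); rewrite subr0 => /(_ hw h0) /=.
rewrite scalerBl addrA [(_ - _) + z]addrC -addrA subrK.
set A := f _ - f _; rewrite -[_ *: A]/((w - u0)^-1 * A) => /ltW h.
have -> : A - D * (w - u0) = ((w - u0)^-1 * A - D) * (w - u0).
  by rewrite mulrBl mulrAC mulVf// mul1r.
by rewrite Normc.normcM ler_wpM2r ?normc_ge0.
Qed.

Lemma holomorphic_cdiff (U : set CN) (f : CN -> R[i]) z v (u0 : R[i]) : holomorphic_on U f ->
  U (z + u0 *: v) -> exists D, cdiff (fun c => f (z + c *: v)) u0 D.
Proof. by move=> hf /hf; exact: differentiable_cdiff. Qed.

Lemma differentiable_one_sub_hdot a z : differentiable (fun z : CN => 1 - inner z a : R[i]) z.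
Proof.
have -> : (fun z : CN => 1 - inner z a : R[i]) =
    cst 1 - \sum_(j < N) (fun z : CN => conjc (a ord0 j) *: (z ord0 j : R[i]^o)).
  by apply/funext => w; rewrite !fctE innerE; congr (_ - _); rewrite fct_sumE; apply: eq_bigr => j _; rewrite mulrC.
apply: differentiableB; first exact: differentiable_cst.
apply: differentiable_sum => j; apply: differentiableZ.
exact: differentiable_coord.
Qed.

Lemma differentiable_test (K : R[i]) a M z : 1 - inner z a != 0 ->
  differentiable (fun z : CN => K * ((1 - inner z a)^-1) ^+ M.+1 : R[i]) z.
Proof.
move=> h0.
have d1 : differentiable (fun z : CN => (1 - inner z a)^-1 : R[i]) z.
  exact: (differentiableV (differentiable_one_sub_hdot a z)).
have d2 := differentiableX M d1.
rewrite (_ : (fun _ => _) = K *: (fun z : CN => (1 - inner z a)^-1 : R[i]^o) ^+ M.+1).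
  exact: differentiableZ.
by apply/funext => w; rewrite exprfctE.
Qed.

Lemma holomorphic_measurable (f : CN -> R[i]) : holomorphic_on (@unit_ball R N) f ->
  @measurable_fun _ _ (borel CN) (borel R[i]) (@unit_ball R N) f.
Proof.
move=> hf; apply: measurable_continuous_on; first exact: open_unit_ball.
by move=> z /hf; exact: differentiable_continuous.
Qed.


End hermitian_space.

(** * Sub-mean value inequality in the ball *)

Section iterated_submean.
Context (R : realType) (N : nat).
Local Notation CN := 'rV[R[i]]_N.
Local Notation normc := Normc.normc.
Local Notation leb := (@lebesgue_measure R).
Local Notation Re := complex.Re.
Local Notation Im := complex.Im.

Definition cset (w : CN) (k : 'I_N) (c : R[i]) : CN :=
  \row_j (if j == k then c else w ord0 j).

Definition tup (w : borel CN) : (N + N).-tuple R :=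
  [tuple match fintype.split i with inl j => Re ((w : CN) ord0 j) | inr j => Im ((w : CN) ord0 j) end | i < (N + N)%N].

Lemma tupK w : @complex_coords R N (tup w) = w.
Proof.
apply/rowP => j; rewrite !mxE !tnth_mktuple.
rewrite -[lshift N j]/(unsplit (inl j)) -[rshift N j]/(unsplit (inr j)) !unsplitK.
by case: ((w : CN) ord0 j).
Qed.

Lemma measurable_coord_Re j : @measurable_fun _ _ (borel CN) R setT (fun w : borel CN => Re ((w : CN) ord0 j)).
Proof.
apply: continuous_borel_measurable => z.
by apply: continuous_comp; [exact: coord_continuous|exact: continuous_Re].
Qed.

Lemma measurable_coord_Im j : @measurable_fun _ _ (borel CN) R setT (fun w : borel CN => Im ((w : CN) ord0 j)).
Proof.
apply: continuous_borel_measurable => z.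
by apply: continuous_comp; [exact: coord_continuous|exact: continuous_Im].
Qed.

Lemma measurable_tup : measurable_fun setT tup.
Proof.
apply/measurable_fun_tnthP => i /=.
rewrite (_ : _ \o _ = fun w : borel CN => match fintype.split i with inl j => Re ((w : CN) ord0 j) | inr j => Im ((w : CN) ord0 j) end); last first.
  by apply/funext => w /=; rewrite tnth_mktuple.
by case: (fintype.split i) => j; [exact: measurable_coord_Re|exact: measurable_coord_Im].
Qed.

Lemma coords_tset (t : (N + N).-tuple R) k x y :
  @complex_coords R N (tset (tset t (lshift N k) x) (rshift N k) y) =
  cset (@complex_coords R N t) k (Complex x y).
Proof.
apply/rowP => j; rewrite !mxE !tnth_tset.
rewrite eq_lrshift !(inj_eq (@lshift_inj _ _)) !(inj_eq (@rshift_inj _ _)) eq_rlshift.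
by case: eqP.
Qed.

Definition cint k (G : CN -> \bar R) (w : CN) : \bar R :=
  (\int[leb]_x \int[leb]_y G (cset w k (Complex x y)))%E.

Definition cints (s : seq 'I_N) (G : CN -> \bar R) := foldr cint G s.

Definition reals_of (s : seq 'I_N) : seq 'I_(N + N) :=
  flatten [seq [:: lshift N k; rshift N k] | k <- s].

Lemma cints_coords s G t :
  cints s G (@complex_coords R N t) = pints (reals_of s) (G \o @complex_coords R N) t.
Proof.
elim: s t => [//|k s IH] t /=; rewrite /cint /pint.
apply: eq_integral => x _; apply: eq_integral => y _.
by rewrite -IH coords_tset.
Qed.

Definition nnmC (G : CN -> \bar R) :=
  @measurable_fun _ _ (borel CN) (\bar R) setT G /\ forall z, (0 <= G z)%E.

Lemma nnmC_cints s G : nnmC G -> nnmC (cints s G).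
Proof.
move=> [mG G0]; have [mP P0] := nnm_pints (reals_of s) (nnm_coords mG G0).
have E : cints s G = pints (reals_of s) (G \o @complex_coords R N) \o tup.
  by apply/funext => w; rewrite /comp -{1}(tupK w) cints_coords.
by split; rewrite E; [exact: (measurableT_comp mP measurable_tup)|move=> z; exact: P0].
Qed.

Lemma perm_reals_of s : perm_eq (enum 'I_N) s -> perm_eq (enum 'I_(N + N)) (reals_of s).
Proof.
move=> hs; apply: uniq_perm; first exact: enum_uniq.
- have us : uniq s by rewrite -(perm_uniq hs) enum_uniq.
  elim: s us {hs} => //= k s IH /andP[ks /IH ->]; rewrite andbT !inE.
  have h1 : lshift N k \notin reals_of s.
    apply: contra ks => /flattenP[_ /mapP[j js ->]]; rewrite !inE.
    by rewrite (inj_eq (@lshift_inj _ _)) eq_lrshift orbF => /eqP ->.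
  have h2 : rshift N k \notin reals_of s.
    apply: contra ks => /flattenP[_ /mapP[j js ->]]; rewrite !inE.
    by rewrite (inj_eq (@rshift_inj _ _)) eq_rlshift /= => /eqP ->.
  by rewrite eq_lrshift /= h1.
- move=> i; rewrite mem_enum inE; apply/esym/flattenP.
  have [j] : exists j : 'I_N, i = lshift N j \/ i = rshift N j.
    by rewrite -(splitK i); case: (fintype.split i) => j; exists j; [left|right].
  move=> hj; exists [:: lshift N j; rshift N j].
    by apply/mapP; exists j => //; rewrite -(perm_mem hs) mem_enum.
  by case: hj => ->; rewrite !inE eqxx ?orbT.
Qed.

Lemma integral_cints s G w : nnmC G -> perm_eq (enum 'I_N) s ->
  (\int[@lebesgue_Cn R N]_z G z = cints s G w)%E.
Proof.
move=> [mG G0] hs; rewrite -(tupK w) cints_coords.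
exact: integral_lebesgue_Cn (perm_reals_of hs).
Qed.

Lemma cints_agree (s : seq 'I_N) G (w w' : CN) : (forall i, i \notin s -> w ord0 i = w' ord0 i) ->
  cints s G w = cints s G w'.
Proof.
elim: s w w' => [|k s IH] w w' h /=.
  by congr G; apply/rowP => i; exact: h.
apply: eq_integral => x _; apply: eq_integral => y _; apply: IH => i is_.
rewrite !mxE; case: eqP => // ik; apply: h; rewrite inE negb_or is_ andbT.
exact/eqP.
Qed.

Lemma measurable_cset_line (w : CN) k (a b : R) :
  @measurable_fun _ _ (R * R)%type (borel CN) setT (fun p => cset w k (Complex (a + p.1) (b + p.2))).
Proof.
apply: measurable_fun_rV => j.
  rewrite (_ : (fun _ => _) = (fun p : R * R => if j == k then a + p.1 else Re (w ord0 j))); last first.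
    by apply/funext => p; rewrite mxE; case: eqP.
  by case: (j == k) => //; apply: measurable_funD => //; exact: measurable_fst.
rewrite (_ : (fun _ => _) = (fun p : R * R => if j == k then b + p.2 else Im (w ord0 j))); last first.
  by apply/funext => p; rewrite mxE; case: eqP.
by case: (j == k) => //; apply: measurable_funD => //; exact: measurable_snd.
Qed.

Lemma square_le_cint k G (w : CN) r : nnmC G ->
  (\int[leb \x leb]_(p in square r) G (cset w k (w ord0 k + Complex p.1 p.2)%R) <= cint k G w)%E.
Proof.
move=> [mG G0]; case E : (w ord0 k) => [a b].
have ml := measurable_cset_line w k.
have m1 : measurable_fun setT (fun p : R * R => G (cset w k (Complex (a + p.1) (b + p.2)))).
  exact: (measurableT_comp (f := (G : borel CN -> \bar R)) mG (ml a b)).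
have h1 : (\int[leb \x leb]_(p in square r) G (cset w k (Complex a b + Complex p.1 p.2)%R) <=
    \int[leb \x leb]_p G (cset w k (Complex (a + p.1)%R (b + p.2)%R)))%E.
  by apply: ge0_subset_integral => //; exact: measurable_square.
apply: (le_trans h1) => {h1}; rewrite fubini_tonelli1//.
have m0 : measurable_fun setT (fun p : R * R => G (cset w k (Complex p.1 p.2))).
  have := measurableT_comp (f := (G : borel CN -> \bar R)) mG (ml 0 0).
  by under eq_fun do rewrite !add0r.
pose H (x : R) : \bar R := (\int[leb]_y G (cset w k (Complex x y)))%E.
have mH : measurable_fun setT H.
  by apply: (@measurable_fun_fubini_tonelli_F _ _ _ _ _ leb (fun p : R * R => G (cset w k (Complex p.1 p.2)))).
rewrite /fubini_F /= /cint -(ge0_integral_shift a measurableT mH); last first.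
  by move=> x _; exact: integral_ge0.
rewrite le_eqVlt; apply/orP; left; apply/eqP.
apply: eq_integral => x _; rewrite /H.
have mx : measurable_fun setT (fun y : R => G (cset w k (Complex (x + a) y))).
  exact: (measurableT_comp (g := fun y : R => (x + a, y)) m0 (pair1_measurable _)).
rewrite -(ge0_integral_shift b measurableT mx)//.
by apply: eq_integral => y _; rewrite [b + y]addrC [a + x]addrC.
Qed.

(* [reach v r s w E]: all points w + sum_k c_k v_k with c_k in the square of half side
   r_k belong to [E]. [adapted v s] means that the matrix of the v_k is unitriangular in
   the order [s], so that integrating along the v_k is the same as along the axes. *)
Fixpoint reach (v : 'I_N -> CN) (r : 'I_N -> R) (s : seq 'I_N) (w : CN) (E : set CN) : Prop :=
  if s is k :: s' then forall c : R[i], `|Re c| <= r k -> `|Im c| <= r k ->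
    reach v r s' (w + c *: v k) E
  else E w.

Fixpoint adapted (v : 'I_N -> CN) (s : seq 'I_N) : Prop :=
  if s is k :: s' then (forall i, i \notin s' -> v k ord0 i = (i == k)%:R) /\ adapted v s'
  else True.

Lemma reach_mem v r s w E : (forall k, 0 < r k) -> reach v r s w E -> E w.
Proof.
move=> r0; elim: s w => [//|k s IH] w /= h; apply: IH.
by have := h 0; rewrite scale0r addr0 /= normr0 => /(_ (ltW (r0 k)) (ltW (r0 k))).
Qed.

Lemma measurable_line (w v : CN) :
  @measurable_fun _ _ (R * R)%type (borel CN) setT (fun p => w + Complex p.1 p.2 *: v).
Proof.
have ReE (p : R * R) j : Re ((w + Complex p.1 p.2 *: v) ord0 j) =
    Re (w ord0 j) + (p.1 * Re (v ord0 j) - p.2 * Im (v ord0 j)).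
  by rewrite !mxE; case: (w ord0 j) => ? ?; case: (v ord0 j).
have ImE (p : R * R) j : Im ((w + Complex p.1 p.2 *: v) ord0 j) =
    Im (w ord0 j) + (p.1 * Im (v ord0 j) + p.2 * Re (v ord0 j)).
  by rewrite !mxE; case: (w ord0 j) => ? ?; case: (v ord0 j).
apply: measurable_fun_rV => j.
  under eq_fun do rewrite ReE; apply: measurable_funD => //; apply: measurable_funB;
    by apply: measurable_funM.
under eq_fun do rewrite ImE; apply: measurable_funD => //; apply: measurable_funD;
  by apply: measurable_funM.
Qed.

Lemma measurable_unit_ballC : @measurable _ (borel CN) (@unit_ball R N).
Proof. by apply: sub_sigma_algebra; exact: open_unit_ball. Qed.

(** Induction along s: the one-variable inequality at w in the direction v_k, then the induction
    hypothesis at each w + c v_k. The factors 16 accumulate inside psi, and cutting off by E lets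
    every integral run over the whole plane. *)
Lemma iterated_jensen psi f (E : set CN) v r s w K : orlicz_function psi ->
  holomorphic_on (@unit_ball R N) f -> E `<=` @unit_ball R N -> @measurable _ (borel CN) E ->
  (forall k, 0 < r k) -> 0 < K -> adapted v s -> reach v r s w E ->
  ((psi (normc (f w) / (16 ^+ size s * K)))%:E <=
   (\prod_(k <- s) (4 * r k ^+ 2)^-1)%:E *
     cints s ((fun z => (psi (normc (f z) / K))%:E) \_ E) w)%E.
Proof.
move=> hpsi hf EB mE r0 K0; pose G := (fun z => (psi (normc (f z) / K))%:E) \_ E.
have mf : @measurable_fun _ _ (borel CN) (borel R[i]) (@unit_ball R N) f by exact: holomorphic_measurable.
have nG : nnmC G.
  split; last by move=> z; apply: erestrict_ge0 => x _; exact: psi_normc_ge0.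
  apply/(measurable_restrictT _ mE)/measurable_EFinP.
  apply: (measurable_psi_normc (T := borel CN)) => //.
  apply: (measurable_normc (T := borel CN)).
  exact: (measurable_funS measurable_unit_ballC EB mf).
elim: s w => [|k s IH] w.
  move=> _ /= Ew; rewrite big_nil mul1e expr0 mul1r /G patchE ifT//.
  by rewrite inE.
move=> [vk ads] hre /=.
pose F c := f (w + c *: v k); pose K' := 16 ^+ size s * K.
have K'0 : 0 < K' by rewrite mulr_gt0// exprn_gt0.
have inB c : `|Re c| <= r k -> `|Im c| <= r k -> @unit_ball R N (w + c *: v k).
  by move=> h1 h2; apply/EB/(reach_mem r0 (hre c h1 h2)).
have absP x : - r k <= x <= r k -> `|x| <= r k by rewrite ler_norml.
have hF : holo_square F (r k).
  move=> x y hx hy; apply: (holomorphic_cdiff hf).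
  by apply: inB => /=; exact: absP.
have sqP p : square (r k) p -> `|p.1| <= r k /\ `|p.2| <= r k.
  by move=> [] /=; rewrite !in_itv/= => h1 h2; split; exact: absP.
have mF : measurable_fun (square (r k)) (fun p => normc (F (Complex p.1 p.2))).
  apply: (measurable_normc (T := (R * R)%type)).
  have hsub : [set w + Complex p.1 p.2 *: v k | p in square (r k)] `<=` @unit_ball R N.
    by move=> _ [p /sqP[h1 h2] <-]; exact: inB.
  exact: (measurable_comp (f := (f : borel CN -> borel R[i])) measurable_unit_ballC hsub mf
    (measurable_funTS (measurable_line w (v k)))).
have := holo_square_jensen hpsi (r0 k) K'0 hF mF.
have -> : F 0 = f w by rewrite /F scale0r addr0.
have -> : 16 ^+ (size (k :: s)) * K = 16 * K' by rewrite /= exprS -mulrA.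
move=> /le_trans; apply.
set C' := \prod_(j <- s) (4 * r j ^+ 2)^-1.
have C'0 : 0 <= C' by apply: prodr_ge0 => j _; rewrite invr_ge0 mulr_ge0// exprn_ge0// ltW.
have rk2 : 0 <= (4 * r k ^+ 2)^-1 by rewrite invr_ge0 mulr_ge0// exprn_ge0// ltW.
rewrite big_cons -/C' EFinM -muleA; apply: lee_wpmul2l; first by rewrite lee_fin.
have nGs := nnmC_cints s nG; have [mGs Gs0] := nGs.
(* Among the coordinates not integrated by [cints s], a displacement along v_k changes only the
   k-th: this is where the unitriangular form replaces a change of variables. *)
have agree (c : R[i]) : cints s G (w + c *: v k) = cints s G (cset w k (w ord0 k + c)).
  apply: cints_agree => i is_; rewrite !mxE vk//; case: (eqVneq i k) => [->|_]; first by rewrite mulr1.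
  by rewrite mulr0 addr0.
apply: (@le_trans _ _ (\int[leb \x leb]_(p in square (r k))
   (C'%:E * cints s G (cset w k (w ord0 k + Complex p.1 p.2)%R)))%E).
  apply: ge0_le_integral => //.
  - exact: measurable_square.
  - by move=> p _; exact: psi_normc_ge0.
  - apply/measurable_EFinP.
    exact: (measurable_psi_normc (f := fun p : R * R => F (Complex p.1 p.2)) (measurable_square (r k)) hpsi K'0 mF).
  - apply: measurable_funeM; case: (w ord0 k) => a b.
    exact: measurable_funTS (measurableT_comp (f := (cints s G : borel CN -> \bar R)) mGs (measurable_cset_line w k a b)).
  - by move=> p /sqP[h1 h2]; rewrite -agree /F; apply: IH => //; exact: hre.
rewrite ge0_integralZl//.
- by apply: lee_wpmul2l; [rewrite lee_fin|exact: square_le_cint].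
- exact: measurable_square.
- case: (w ord0 k) => a b.
  exact: measurable_funTS (measurableT_comp (f := (cints s G : borel CN -> \bar R)) mGs (measurable_cset_line w k a b)).
Qed.

End iterated_submean.

(** * Volume of the non-isotropic caps *)

Section integral_bounds.
Context d (T : measurableType d) (R : realType).

Lemma sum_geometric_le (C q : R) n : 0 <= C -> 0 <= q < 1 ->
  \sum_(0 <= k < n) C * q ^+ k <= C / (1 - q).
Proof.
move=> C0 /andP[q0 q1]; have q1' : 0 < 1 - q by lra.
suff -> : \sum_(0 <= k < n) C * q ^+ k = C * (1 - q ^+ n) / (1 - q).
  by rewrite ler_pM2r ?invr_gt0// ler_piMr// lerBlDr lerDl exprn_ge0.
elim: n => [|n IH]; first by rewrite big_geq// expr0 subrr mulr0 mul0r.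
by rewrite big_nat_recr//= IH exprS; field; rewrite gt_eqF.
Qed.

Lemma integral_cover_geometric (m : {measure set T -> \bar R}) (A : nat -> set T) (D : set T)
    (f : T -> \bar R) (C q : R) :
  measurable D -> (forall n, measurable (A n)) -> measurable_fun setT f -> (forall x, (0 <= f x)%E) ->
  D `<=` \bigcup_n A n -> 0 <= C -> 0 <= q < 1 ->
  (forall n, \int[m]_(x in A n) f x <= (C * q ^+ n)%:E)%E ->
  (\int[m]_(x in D) f x <= (C / (1 - q))%:E)%E.
Proof.
move=> mD mA mf f0 DA C0 q01 hA.
have mS k : measurable (seqDU A k).
  by apply: measurableD => //; exact: bigsetU_measurable.
apply: (@le_trans _ _ (\int[m]_(x in \bigcup_n A n) f x)%E).
  apply: ge0_subset_integral => //; first exact: bigcup_measurable.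
  exact: measurable_funTS.
rewrite seqDU_bigcup_eq ge0_integral_bigcup//; last exact: measurable_funTS.
apply: lime_le; first by apply: is_cvg_nneseries => n _ _; exact: integral_ge0.
apply: nearW => n; apply: (@le_trans _ _ (\sum_(0 <= k < n) (C * q ^+ k)%:E)%E).
  apply: lee_sum => k _; apply: le_trans (hA k).
  apply: ge0_subset_integral => //; first exact: measurable_funTS.
  exact: subset_seqDU.
by rewrite sumEFin lee_fin sum_geometric_le.
Qed.

Import HBNNSimple.

(** A simple function below f restricted to E vanishes off E, so its nonzero level sets lie in E,
    where the two measures compare. *)
Lemma ge0_le_measure_integral_on (m1 m2 : {measure set T -> \bar R}) (E : set T) (f : T -> \bar R) :
  measurable E -> (forall S, measurable S -> S `<=` E -> (m1 S <= m2 S)%E) ->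
  measurable_fun E f -> (forall x, E x -> (0 <= f x)%E) ->
  (\int[m1]_(x in E) f x <= \int[m2]_(x in E) f x)%E.
Proof.
move=> mE m12 mf f0; rewrite !ge0_integralE//= ge_ereal_sup// => _ [h/= hf] <-.
apply: le_ereal_sup_tmp; exists (sintegral m2 h); first by exists h.
rewrite !sintegralE lee_fsum// => r [t _ <-].
have [->|ht0] := eqVneq (h t) 0; first by rewrite !mul0e.
apply: lee_wpmul2l; first by rewrite lee_fin.
apply: m12 => // x /= hx; apply: contrapT => Ex.
have := hf x; rewrite patchE ifF; last by apply/negbTE; rewrite notin_setE.
rewrite lee_fin hx => ht; move: ht0; rewrite (_ : h t = 0) ?eqxx//.
by apply/eqP; rewrite eq_le ht /=.
Qed.

End integral_bounds.

Section cap_integral.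
Context (R : realType).
Local Notation leb := (@lebesgue_measure R).

Lemma ler_powR_npos (x y b : R) : 0 < x -> x <= y -> b <= 0 -> y `^ b <= x `^ b.
Proof.
move=> x0 xy b0; rewrite -(opprK b) !(powRN _ (- b)).
have y0 : 0 < y by exact: lt_le_trans xy.
rewrite lef_pV2 ?posrE ?powR_gt0//; apply: ge0_ler_powR => //; rewrite ?nnegrE; lra.
Qed.

Lemma powR_mulS (u g : R) : 0 < u -> u `^ g * u = u `^ (g + 1).
Proof. by move=> u0; rewrite powRD ?(gt_eqF u0) ?implybT// powRr1// ltW. Qed.

Lemma powR_half_pow (l g : R) n : 0 <= l -> (l * 2^-1 ^+ n) `^ g = l `^ g * 2 `^ (- g) ^+ n.
Proof.
move=> l0; have h2 : 0 <= 2^-1 :> R by rewrite invr_ge0.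
rewrite powRM ?exprn_ge0//; congr (_ * _).
elim: n => [|n IH]; first by rewrite !expr0 powR1.
rewrite !exprS powRM ?exprn_ge0// IH; congr (_ * _).
by rewrite -powR_inv1// -powRrM mulN1r.
Qed.

Lemma powR2N_lt1 (g : R) : 0 < g -> 2 `^ (- g) < 1.
Proof.
move=> g0; rewrite powRN invf_lt1 ?powR_gt0//.
have := @gt0_ltr_powR R g g0 1 2; rewrite powR1 !nnegrE; apply=> //; lra.
Qed.

(* The dyadic pieces of this set at distance l / 2^n from its upper end, with
   l = q - p, make the integral of a negative power of b - x^2 a geometric series. *)
Definition half_cap (b c p q : R) := [set x : R | p < x < q /\ c <= x /\ x ^+ 2 < b].

Lemma measurable_half_cap b c p q : measurable (half_cap b c p q).
Proof.
rewrite (_ : half_cap _ _ _ _ = `]p, q[ `&` (`[c, +oo[ `&` (fun x => x ^+ 2) @^-1` `]-oo, b[)); last first.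
  by apply/seteqP; split => x; rewrite /half_cap/= !in_itv/= andbT; tauto.
apply: measurableI => //; apply: measurableI => //; rewrite -[X in measurable X]setTI.
exact: (measurable_funX 2 (@measurable_id _ _ setT)).
Qed.

(** B is an upper end of the set. On the n-th piece, of length u = l / 2^(n+1), the product (sqrt b
    + x) (sqrt b - x) is at least c u, hence the integrand at most (c u)^beta because beta <= 0. The
    pieces contribute a multiple of u^(beta+1), summable because beta + 1 > 0. *)
Lemma powR_half_cap (b c p q beta : R) : -1 < beta <= 0 -> 0 < c -> p < q ->
  (\int[leb]_(x in half_cap b c p q) ((b - x ^+ 2) `^ beta)%:E <=
   (c `^ beta * (q - p) `^ (beta + 1) / (1 - 2 `^ (- (beta + 1))))%:E)%E.
Proof.
move=> /andP[beta1 beta0] c0 pq.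
pose D := half_cap b c p q.
pose B := Num.min q (Num.sqrt b); pose l := q - p.
have l0 : 0 < l by rewrite subr_gt0.
have mf : measurable_fun setT (fun x : R => ((b - x ^+ 2) `^ beta)%:E).
  apply/measurable_EFinP; apply: (measurableT_comp (@measurable_powR R beta)).
  by apply: measurable_funB => //; exact: measurable_funX.
have mD : measurable D by exact: measurable_half_cap.
pose A n := [set x : R | D x /\ B - l * 2^-1 ^+ n <= x <= B - l * 2^-1 ^+ n.+1].
have mA n : measurable (A n).
  rewrite (_ : A n = D `&` `[B - l * 2^-1 ^+ n, B - l * 2^-1 ^+ n.+1]); first exact: measurableI.
  by apply/seteqP; split => x; rewrite /A/= in_itv.
have DB x : D x -> x < B.
  move=> [/andP[_ xq] [cx xb]]; rewrite lt_min xq /=.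
  have x0 : 0 < x by exact: lt_le_trans cx.
  rewrite -(@ltr_pXn2r _ 2) ?nnegrE ?sqrtr_ge0 ?(ltW x0)// sqr_sqrtr//.
  by apply/ltW/(le_lt_trans _ xb); exact: sqr_ge0.
have -> : c `^ beta * (q - p) `^ (beta + 1) / (1 - 2 `^ (- (beta + 1))) =
   (c `^ beta * l `^ (beta + 1)) / (1 - 2 `^ (- (beta + 1))) by [].
(* The n-th piece yields (l / 2)^(beta+1) times the n-th power of the ratio; the 1 / 2 is given up
   at the end. *)
apply: le_trans (_ : (((c `^ beta * (l * 2^-1) `^ (beta + 1)) / (1 - 2 `^ (- (beta + 1))))%:E <= _)%E).
apply: (@integral_cover_geometric _ _ R leb A D _ _ _ mD mA mf) => //.
- by move=> x; rewrite lee_fin powR_ge0.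
- move=> x Dx; have xB := DB x Dx.
  have xl : B - x <= l.
    move: Dx => [/andP[px _] _]; rewrite /l.
    by apply: lerB; [rewrite /B ge_min lexx|exact: ltW].
  have ex : exists n, l * 2^-1 ^+ n.+1 <= B - x.
    have : (fun n => l * 2^-1 ^+ n) @ \oo --> l * 0.
      apply: cvgM; first exact: cvg_cst.
      by apply: cvg_expr; rewrite ger0_norm ?invr_ge0// invf_lt1// ltr1n.
    rewrite mulr0 => /cvgrPdist_lt /(_ (B - x)); rewrite subr_gt0 => /(_ xB) [n _ hn].
    exists n; have := hn n.+1 (leqnSn n); rewrite /= sub0r normrN ger0_norm; first exact: ltW.
    by rewrite mulr_ge0 ?(ltW l0)// exprn_ge0 ?invr_ge0.
  (* The least n with l / 2^(n+1) <= B - x also satisfies B - x <= l / 2^n: by minimality if n > 0,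
     by [xl] if n = 0. *)
  exists (ex_minn ex) => //; case: ex_minnP => n hn hmin; split => //.
  apply/andP; split; last by rewrite lerBrDl -lerBrDr.
  case: n hn hmin => [|n] hn hmin; first by rewrite expr0; lra.
  suff : ~~ (l * 2^-1 ^+ n.+1 <= B - x) by rewrite -ltNge; lra.
  by apply/negP => /hmin; rewrite ltnn.
- by rewrite mulr_ge0 ?powR_ge0.
- by rewrite powR_ge0 powR2N_lt1//; lra.
- move=> n; pose u := l * 2^-1 ^+ n.+1.
  have u0 : 0 < u by rewrite mulr_gt0// exprn_gt0// invr_gt0.
  have uu : l * 2^-1 ^+ n = u + u.
    by rewrite /u exprS; field.
  pose lo : R := B - l * 2^-1 ^+ n; pose hi : R := B - l * 2^-1 ^+ n.+1.
  pose J : set R := [set` `[lo, hi]].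
  have h1 : (\int[leb]_(x in A n) ((b - x ^+ 2) `^ beta)%:E <=
      \int[leb]_(x in A n) (c `^ beta * u `^ beta)%:E)%E.
    apply: ge0_le_integral => //.
    - exact: mA.
    - by move=> x _; rewrite lee_fin powR_ge0.
    - exact: (measurable_funTS mf).
    - move=> x [Dx /andP[_ hx]]; have xB := DB x Dx.
      move: Dx => [/andP[px xq] [cx xb]].
      rewrite lee_fin -powRM ?(ltW c0) ?(ltW u0)//; apply: ler_powR_npos => //; first exact: mulr_gt0.
      have b0 : 0 <= b by apply/ltW/(le_lt_trans _ xb); exact: sqr_ge0.
      have hs : x < Num.sqrt b by apply: (lt_le_trans xB); rewrite /B ge_min lexx orbT.
      have -> : b - x ^+ 2 = (Num.sqrt b + x) * (Num.sqrt b - x) by rewrite -{1}(sqr_sqrtr b0); ring.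
      have hu : u <= Num.sqrt b - x.
        have : B <= Num.sqrt b by rewrite /B ge_min lexx orbT.
        by rewrite -/u in hx; lra.
      have hc : c <= Num.sqrt b + x by have := sqrtr_ge0 b; lra.
      by apply: ler_pM => //; exact: ltW.
  have h2 : (\int[leb]_(x in A n) (c `^ beta * u `^ beta)%:E <=
      \int[leb]_(x in J) (c `^ beta * u `^ beta)%:E)%E.
    apply: ge0_subset_integral => //.
    - exact: mA.
    - by rewrite /J; exact: measurable_itv.
    - by move=> x _; rewrite lee_fin mulr_ge0 ?powR_ge0.
    - by move=> x [_] /=; rewrite /J/= in_itv.
  apply: (le_trans h1); apply: (le_trans h2).
  rewrite integral_itv_cst /lo /hi; last by rewrite uu -/u; lra.
  rewrite lee_fin uu -/u.
  have -> : B - u - (B - (u + u)) = u by ring.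
  rewrite -!mulrA ler_wpM2l ?powR_ge0//.
  rewrite powR_mulS// (_ : u = (l * 2^-1) * 2^-1 ^+ n); last by rewrite /u exprS mulrA.
  by rewrite powR_half_pow// mulr_ge0// ltW.
rewrite lee_fin ler_wpM2r//.
  rewrite invr_ge0 subr_ge0; apply/ltW/powR2N_lt1; lra.
rewrite ler_wpM2l ?powR_ge0//; apply: ge0_ler_powR; rewrite ?nnegrE; lra.
Qed.

Definition cap_const (c beta : R) := 2 * c `^ beta / (1 - 2 `^ (- (beta + 1))).

Lemma cap_const_ge0 c beta : -1 < beta -> 0 <= cap_const c beta.
Proof.
move=> b1; rewrite /cap_const divr_ge0 ?mulr_ge0 ?powR_ge0// subr_ge0.
apply/ltW/powR2N_lt1; lra.
Qed.

(** The part where x < 0 is reflected, and [powR_half_cap] is applied twice; this is the factor 2 of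
    [cap_const]. *)
Lemma powR_cap (b c p q beta : R) (f : R -> \bar R) : -1 < beta <= 0 -> 0 < c -> p < q ->
  (forall x, 0 <= f x)%E ->
  (forall x, f x != 0%E -> p < x < q /\ c <= `|x| /\ x ^+ 2 < b /\ (f x <= ((b - x ^+ 2) `^ beta)%:E)%E) ->
  measurable_fun setT f ->
  (\int[leb]_x f x <= (cap_const c beta * (q - p) `^ (beta + 1))%:E)%E.
Proof.
move=> hb c0 pq f0 hf mf.
pose g (x : R) : \bar R := ((b - x ^+ 2) `^ beta)%:E.
have mg : measurable_fun setT g.
  apply/measurable_EFinP; apply: (measurableT_comp (@measurable_powR R beta)).
  by apply: measurable_funB => //; exact: measurable_funX.
have g0 x : (0 <= g x)%E by rewrite lee_fin powR_ge0.
pose g1 : R -> \bar R := g \_ (half_cap b c p q); pose g2 : R -> \bar R := g \_ (half_cap b c (- q) (- p)).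
have mg1 : measurable_fun setT g1.
  by apply/(measurable_restrictT _ (measurable_half_cap _ _ _ _)); exact: measurable_funTS.
have mg2 : measurable_fun setT g2.
  by apply/(measurable_restrictT _ (measurable_half_cap _ _ _ _)); exact: measurable_funTS.
have g10 x : (0 <= g1 x)%E by exact: erestrict_ge0.
have g20 x : (0 <= g2 x)%E by exact: erestrict_ge0.
have mg2N : measurable_fun setT (fun x : R => g2 (- x)%R).
  exact: (measurableT_comp mg2 (@oppr_measurable R setT)).
have h1 : (\int[leb]_x f x <= \int[leb]_x (g1 x + g2 (- x)%R))%E.
  apply: ge0_le_integral => //; first exact: emeasurable_funD.
  move=> x _; have [->|fx] := eqVneq (f x) 0%E; first exact: adde_ge0.
  have [/andP[px xq] [cx [xb fg]]] := hf x fx; apply: (le_trans fg).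
  have [x0|x0] := leP 0 x.
    rewrite -[leLHS]adde0; apply: leeD => //.
    rewrite /g1 patchE ifT// inE; split; first by rewrite px.
    by split => //; rewrite ger0_norm in cx.
  rewrite -[leLHS]add0e; apply: leeD => //.
  rewrite /g2 patchE ifT ?/g ?sqrrN// inE; split; first by rewrite !ltrN2 px xq.
  by split; rewrite ?sqrrN// ltr0_norm in cx *.
apply: (le_trans h1); rewrite ge0_integralD// (ge0_integral_opp mg2 g20).
rewrite /g1 /g2 -!integral_mkcond.
have h2 := powR_half_cap b hb c0 pq.
have h3 : (\int[leb]_(x in half_cap b c (- q) (- p)) g x <=
  (c `^ beta * (- p - - q) `^ (beta + 1) / (1 - 2 `^ (- (beta + 1))))%:E)%E.
  by apply: (powR_half_cap b hb c0); rewrite ltrN2.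
apply: (le_trans (leeD h2 h3)).
rewrite -EFinD lee_fin opprK [- p + q]addrC /cap_const le_eqVlt; apply/orP; left; apply/eqP; ring.
Qed.

End cap_integral.

(** * Non-isotropic neighborhoods and the local estimate *)

Section local_estimate.
Context (R : realType) (N : nat).
Local Notation CN := 'rV[R[i]]_N.
Local Notation normc := Normc.normc.
Local Notation Re := complex.Re.
Local Notation Im := complex.Im.
Implicit Types z w : CN.

Definition defect z : R := 1 - hnorm z ^+ 2.

(** The two comparisons of defects make the weight nearly constant on the neighborhood and the
    relation usable from either point; the last condition places z in a Carleson window attached to
    w. *)
Definition near_set z : set CN := [set w | @unit_ball R N w /\
  defect z <= 2 * defect w /\ defect w <= 2 * defect z /\ normc (1 - hdot w z) <= 2 * defect z].

Lemma unit_ball_defect z : @unit_ball R N z <-> 0 < defect z.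
Proof.
rewrite /unit_ball/= enormE /defect subr_gt0 -{2}(expr1n R 2) ltr_pXn2r//.
  by rewrite nnegrE enorm_ge0.
by rewrite nnegrE.
Qed.

Lemma measurable_defect : @measurable_fun _ _ (borel CN) R setT defect.
Proof.
rewrite /defect -enormE; apply: measurable_funB => //; exact: measurable_enorm_sqr.
Qed.

Lemma normc_one_sub_hdot z w : normc (1 - hdot w z) =
  Num.sqrt ((1 - \sum_(j < N) (Re (w ord0 j) * Re (z ord0 j) + Im (w ord0 j) * Im (z ord0 j))) ^+ 2 +
   (\sum_(j < N) (Im (w ord0 j) * Re (z ord0 j) - Re (w ord0 j) * Im (z ord0 j))) ^+ 2).
Proof.
rewrite normcE_ReIm; congr Num.sqrt; rewrite innerE.
have ReS (F : 'I_N -> R[i]) : Re (\sum_j F j) = \sum_j Re (F j).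
  by rewrite (big_morph (@complex.Re R) (id1 := 0) (op1 := +%R)) => [|[? ?] [? ?]|].
have ImS (F : 'I_N -> R[i]) : Im (\sum_j F j) = \sum_j Im (F j).
  by rewrite (big_morph (@complex.Im R) (id1 := 0) (op1 := +%R)) => [|[? ?] [? ?]|].
have ReB (u v : R[i]) : Re (u - v) = Re u - Re v by case: u; case: v.
have ImB (u v : R[i]) : Im (u - v) = Im u - Im v by case: u; case: v.
rewrite ReB ImB ReS ImS /= sub0r sqrrN; congr ((_ - _) ^+ 2 + _ ^+ 2); apply: eq_bigr => j _.
  by case: (w _ _) => a b; case: (z _ _) => a' b' /=; ring.
by case: (w _ _) => a b; case: (z _ _) => a' b' /=; ring.
Qed.

Lemma measurable_near_dist :
  @measurable_fun _ _ (borel CN * borel CN)%type R setT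
    (fun p : borel CN * borel CN => normc (1 - hdot (p.2 : CN) (p.1 : CN))).
Proof.
under eq_fun do rewrite normc_one_sub_hdot.
apply: (measurableT_comp (continuous_measurable_fun (@sqrt_continuous R))).
have mR1 j : measurable_fun setT (fun p : borel CN * borel CN => Re ((p.1 : CN) ord0 j)).
  exact: (measurableT_comp (@measurable_coord_Re R N j) measurable_fst).
have mR2 j : measurable_fun setT (fun p : borel CN * borel CN => Re ((p.2 : CN) ord0 j)).
  exact: (measurableT_comp (@measurable_coord_Re R N j) measurable_snd).
have mI1 j : measurable_fun setT (fun p : borel CN * borel CN => Im ((p.1 : CN) ord0 j)).
  exact: (measurableT_comp (@measurable_coord_Im R N j) measurable_fst).
have mI2 j : measurable_fun setT (fun p : borel CN * borel CN => Im ((p.2 : CN) ord0 j)).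
  exact: (measurableT_comp (@measurable_coord_Im R N j) measurable_snd).
apply: measurable_funD; apply: measurable_funX.
  apply: measurable_funB => //; apply: measurable_sum => j.
  by apply: measurable_funD; exact: measurable_funM.
by apply: measurable_sum => j; apply: measurable_funB; exact: measurable_funM.
Qed.

Definition near_rel : set (borel CN * borel CN) :=
  [set p | @unit_ball R N p.1 /\ near_set p.1 p.2].

Lemma measurable_near_rel : measurable near_rel.
Proof.
have m1 : measurable_fun setT (fun p : borel CN * borel CN => defect (p.1 : CN)).
  exact: (measurableT_comp measurable_defect measurable_fst).
have m2 : measurable_fun setT (fun p : borel CN * borel CN => defect (p.2 : CN)).
  exact: (measurableT_comp measurable_defect measurable_snd).
have mle (f g : borel CN * borel CN -> R) : measurable_fun setT f -> measurable_fun setT g ->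
    measurable [set p | f p <= g p].
  move=> mf mg; have -> : [set p | f p <= g p] = (fun p => f p - g p) @^-1` `]-oo, 0].
    by apply/seteqP; split => p /=; rewrite in_itv/= subr_le0.
  by rewrite -[X in measurable X]setTI; exact: measurable_funB.
have mlt (g : borel CN * borel CN -> R) : measurable_fun setT g ->
    measurable [set p | 0 < g p].
  move=> mg; have -> : [set p | 0 < g p] = g @^-1` `]0, +oo[.
    by apply/seteqP; split => p /=; rewrite in_itv/= andbT.
  by rewrite -[X in measurable X]setTI; exact: mg.
have -> : near_rel = [set p | 0 < defect (p.1 : CN)] `&` ([set p | 0 < defect (p.2 : CN)] `&`
   ([set p | defect (p.1 : CN) <= 2 * defect (p.2 : CN)] `&`
   ([set p | defect (p.2 : CN) <= 2 * defect (p.1 : CN)] `&`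
    [set p | normc (1 - hdot (p.2 : CN) (p.1 : CN)) <= 2 * defect (p.1 : CN)]))).
  by apply/seteqP; split => p /=; rewrite /near_rel /near_set /= !unit_ball_defect.
apply: measurableI; first exact: mlt.
apply: measurableI; first exact: mlt.
have m1' : measurable_fun setT (fun p : borel CN * borel CN => 2 * defect (p.1 : CN)) by exact: measurable_funM.
have m2' : measurable_fun setT (fun p : borel CN * borel CN => 2 * defect (p.2 : CN)) by exact: measurable_funM.
apply: measurableI; first exact: mle.
apply: measurableI; first exact: mle.
by apply: mle => //; exact: measurable_near_dist.
Qed.

Lemma measurable_near_set z : @measurable _ (borel CN) (near_set z).
Proof.
have [zB|zB] := pselect (@unit_ball R N z).
  have -> : near_set z = xsection near_rel (z : borel CN).
    rewrite /xsection; apply/seteqP; split => w /=; rewrite inE.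
      by move=> h; split.
    by case.
  exact: measurable_xsection measurable_near_rel.
suff -> : near_set z = set0 by exact: measurable0.
apply/seteqP; split => // w [/unit_ball_defect w0 [h1 [h2 _]]]; apply: zB.
by apply/unit_ball_defect; lra.
Qed.

Lemma reach_of_bounds (v : 'I_N -> CN) (r B D : 'I_N -> R) z (s : seq 'I_N) w (E : set CN) :
  (forall k (c : R[i]), `|Re c| <= r k -> `|Im c| <= r k ->
    hnorm (c *: v k) <= B k /\ normc (hdot (c *: v k) z) <= D k) ->
  (forall w', hnorm (w' - w) <= \sum_(k <- s) B k ->
     normc (hdot (w' - w) z) <= \sum_(k <- s) D k -> E w') ->
  reach v r s w E.
Proof.
move=> hv; elim: s w => [|k s IH] w /=.
  move=> hE; apply: hE; rewrite subrr big_nil ?enorm0//.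
  by rewrite -[0](scale0r (0 : CN)) innerZl mul0r Normc.normc0.
move=> hE c c1 c2; apply: IH => w' h1 h2; have [b1 b2] := hv k c c1 c2.
have e : w' - w = (w' - (w + c *: v k)) + c *: v k by rewrite opprD addrA subrK.
apply: hE; rewrite big_cons e.
  by apply: le_trans (enormD _ _) _; lra.
by rewrite innerDl; apply: le_trans (normcD_le _ _) _; lra.
Qed.

(** Since |w|^2 = |z|^2 + 2 Re <w - z, z> + |w - z|^2, only the component of w - z along z acts to
    first order on the defect. That component must be O(defect z), whereas |w - z| itself may be
    O(sqrt (defect z)). *)
Lemma near_set_of_bounds z w (t : R) : 0 < defect z -> 0 <= t <= 1/16 ->
  hnorm (w - z) ^+ 2 <= t * defect z -> normc (hdot (w - z) z) <= t * defect z -> near_set z w.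
Proof.
move=> d0 /andP[t0 t1] h1 h2.
have wz : w = z + (w - z) by rewrite addrC subrK.
have h3 := le_trans (Re_le_normc _) h2; rewrite ler_norml in h3.
have e : defect w = defect z - 2 * Re (hdot (w - z) z) - hnorm (w - z) ^+ 2.
  rewrite /defect {1}wz enormD_sqr (innerC (w - z) z).
  have -> (c : R[i]) : Re (conjc c) = Re c by case: c.
  by ring.
have e2 : 1 - hdot w z = real_complex R (defect z) - hdot (w - z) z.
  rewrite {1}wz innerDl inner_self /defect rmorphB rmorph1; ring.
have h4 := sqr_ge0 (hnorm (w - z)).
have h5 : normc (1 - hdot w z) <= 2 * defect z.
  rewrite e2; apply: le_trans (normcD_le _ _) _.
  rewrite normcN normc_real gtr0_norm//; nra.
case/andP: h3 => h3 h3'.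
have tdz : t * defect z <= 1 / 16 * defect z by apply: ler_wpM2r => //; exact: ltW.
split; first by apply/unit_ball_defect; lra.
by split; [lra|split => //; lra].
Qed.

Lemma delta_coord (k i : 'I_N) : (delta_mx 0 k : CN) ord0 i = (i == k)%:R.
Proof. by rewrite mxE eqxx. Qed.

Lemma enorm_delta (k : 'I_N) : hnorm (delta_mx 0 k : CN) = 1.
Proof.
apply/eqP; rewrite -(@eqrXn2 _ 2) ?enorm_ge0 ?ler01// expr1n enorm_sqr_normc (bigD1 k)//=.
rewrite big1 => [|i /negbTE ik]; rewrite delta_coord ?ik ?Normc.normc0 ?expr0n//.
by rewrite eqxx Normc.normc1 expr1n addr0.
Qed.

Lemma inner_delta (k : 'I_N) z : hdot (delta_mx 0 k) z = conjc (z ord0 k).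
Proof.
rewrite innerE (bigD1 k)//= big1 => [|i /negbTE ik]; rewrite delta_coord ?ik ?mul0r//.
by rewrite eqxx mul1r addr0.
Qed.

Lemma exists_pivot z : (0 < N)%N -> exists j : 'I_N, forall k, normc (z ord0 k) <= normc (z ord0 j).
Proof.
move=> N0; exists [arg max_(k > Ordinal N0) normc (z ord0 k)]%O => k.
by case: Order.TotalTheory.arg_maxP => // i _; apply.
Qed.

(** Chosen so that N displacements of norm at most 4 [submean_scale] sqrt (defect z) add up to at
    most sqrt (defect z) / 8. *)
Definition submean_scale : R := (32 * N%:R)^-1.

Definition submean_const : R := ((4 * submean_scale ^+ 2) ^+ N)^-1.

(* For a coordinate j where |z_j| is maximal, the v_k with k <> j are orthogonal to z. In
   these directions the radius is of order sqrt (defect z), in the remaining one of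
   order defect z: this gives the exponent N + 1. *)
Lemma local_estimate_leb psi (f : CN -> R[i]) K z : (0 < N)%N -> orlicz_function psi ->
  holomorphic_on (@unit_ball R N) f -> 0 < K -> 0 < defect z ->
  ((psi (normc (f z) / (16 ^+ N * K)))%:E <= (submean_const / defect z ^+ N.+1)%:E *
     \int[@lebesgue_Cn R N]_(w in near_set z) (psi (normc (f w) / K))%:E)%E.
Proof.
move=> N0 hpsi hf K0 d0; have [j hj] := exists_pivot z N0.
pose c := submean_scale; pose rd := Num.sqrt (defect z).
have N1 : 1 <= N%:R :> R by rewrite ler1n.
have cE : c * (32 * N%:R) = 1 by rewrite /c/submean_scale mulVf// gt_eqF//; lra.
have c0 : 0 < c by rewrite /c/submean_scale invr_gt0; lra.
have c32 : c * 32 <= 1.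
  by rewrite -[X in _ <= X]cE mulrA; apply: ler_peMr => //; rewrite mulr_ge0// ltW.
have rd0 : 0 < rd by rewrite sqrtr_gt0.
have rd2 : rd ^+ 2 = defect z by rewrite sqr_sqrtr// ltW.
have d1 : defect z <= 1 by rewrite /defect lerBlDr lerDl sqr_ge0.
have rd1 : rd <= 1 by rewrite -sqrtr1 ler_sqrt.
(* This coefficient makes e_k - q_k e_j orthogonal to z, and maximality of |z_j| gives |q_k| <= 1.
   If z_j = 0 then z = 0, and the quotient is 0 by the convention on division, which is still
   correct. *)
pose q (k : 'I_N) : R[i] := if k == j then 0 else conjc (z ord0 k) / conjc (z ord0 j).
pose v (k : 'I_N) : CN := delta_mx 0 k - q k *: delta_mx 0 j.
pose r (k : 'I_N) : R := c * rd * (if k == j then rd else 1).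
have r0 k : 0 < r k by rewrite /r; case: eqP => _; rewrite !mulr_gt0.
have rc k : r k <= c * rd.
  have crd : 0 <= c * rd by exact/ltW/mulr_gt0.
  by rewrite /r ler_piMr//; case: eqP.
(* The pivot comes last, so that the extra coordinate j of each v_k is always one still to be
   integrated. *)
pose s := rcons (rem j (enum 'I_N)) j.
have hs : perm_eq (enum 'I_N) s.
  by rewrite perm_sym /s perm_rcons perm_sym perm_to_rem// mem_enum.
have q1 k : normc (q k) <= 1.
  rewrite /q; case: eqP => _; first by rewrite Normc.normc0.
  have [zj|zj] := eqVneq (normc (z ord0 j)) 0.
    have := hj k; rewrite zj => zk.
    have /Normc.eq0_normc -> : normc (z ord0 k) = 0 by apply/eqP; rewrite eq_le zk normc_ge0.
    by rewrite conjc0 mul0r Normc.normc0.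
  rewrite Normc.normcM normcJ Normc.normcV normcJ ler_pdivrMr ?mul1r//.
  by rewrite lt_neqAle eq_sym zj normc_ge0.
have qz k : k != j -> q k * conjc (z ord0 j) = conjc (z ord0 k).
  move=> kj; rewrite /q (negbTE kj).
  have [zj|zj] := eqVneq (normc (z ord0 j)) 0.
    have := hj k; rewrite zj => zk.
    have /Normc.eq0_normc -> : normc (z ord0 k) = 0 by apply/eqP; rewrite eq_le zk normc_ge0.
    by rewrite conjc0 !mul0r.
  rewrite mulfVK//; apply: contraNneq zj => zj; rewrite -normcJ zj Normc.normc0.
  by [].
have vz k : hdot (v k) z = if k == j then conjc (z ord0 j) else 0.
  rewrite /v innerBl innerZl !inner_delta; case: eqVneq => [->|kj].
    by rewrite /q eqxx mul0r subr0.
  by rewrite qz// subrr.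
have vn k : hnorm (v k) <= 2.
  rewrite /v; apply: (le_trans (enormD _ _)); rewrite enormN enormZ !enorm_delta mulr1.
  by have := q1 k; lra.
have cn (u : R[i]) k : `|Re u| <= r k -> `|Im u| <= r k -> normc u <= 2 * r k.
  by move=> h1 h2; apply: (le_trans (normc_le_ReIm _)); lra.
have adS : adapted v s.
  rewrite /s; elim: (rem j (enum 'I_N)) => [|k s' IH] /=.
    by split => // i _; rewrite /v /q eqxx scale0r subr0 delta_coord.
  split => // i; rewrite mem_rcons inE negb_or => /andP[ij _].
  by rewrite !mxE (negbTE ij) andbF mulr0 subr0 eqxx.
have hre : reach v r s z (near_set z).
  pose B (k : 'I_N) := 4 * (c * rd); pose D (k : 'I_N) := if k == j then 2 * (c * defect z) else 0.
  apply: (reach_of_bounds (B := B) (D := D) (z := z)).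
    move=> k u h1 h2; have h3 := cn u k h1 h2; split.
      rewrite enormZ /B; have -> : 4 * (c * rd) = (2 * (c * rd)) * 2 by ring.
      apply: ler_pM => //; rewrite ?normc_ge0 ?enorm_ge0//.
      by apply: le_trans h3 _; have := rc k; lra.
    rewrite innerZl vz /D; case: eqVneq h3 => [->|kj] h3; last by rewrite mulr0 Normc.normc0.
    rewrite Normc.normcM normcJ.
    have zj : normc (z ord0 j) <= 1.
      apply: le_trans (normc_coord_le z j) _.
      by rewrite enorm_le// expr1n -subr_ge0 ltW.
    apply: le_trans (_ : 2 * r j * 1 <= _).
      by apply: ler_pM => //; exact: normc_ge0.
    by rewrite mulr1 /r eqxx -rd2 expr2 !mulrA.
  move=> w; rewrite -!(perm_big _ hs)/= !big_enum/= sumr_const card_ord -big_mkcond big_pred1_eq => h1 h2.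
  apply: (@near_set_of_bounds z w (1/16)) => //; first by apply/andP; split; lra.
    have h0 := enorm_ge0 (w - z).
    have h3 : hnorm (w - z) <= 1/8 * rd.
      apply: le_trans h1 _; rewrite /B.
      have -> : 4 * (c * rd) *+ N = c * (32 * N%:R) * (1 / 8 * rd) by rewrite -[LHS]mulr_natl; field.
      by rewrite cE mul1r.
    apply: le_trans (_ : (1/8 * rd) ^+ 2 <= _); first by rewrite ler_pXn2r ?nnegrE// mulr_ge0//; lra.
    by rewrite exprMn rd2 ler_wpM2r ?ltW//; lra.
  apply: (le_trans h2); rewrite mulrA ler_wpM2r//; first exact: ltW.
  by lra.
have EB : near_set z `<=` @unit_ball R N by move=> w [].
have := iterated_jensen hpsi hf EB (measurable_near_set z) r0 K0 adS hre.
have -> : size s = N by rewrite -(perm_size hs) size_enum_ord.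
have -> : \prod_(k <- s) (4 * r k ^+ 2)^-1 = submean_const / defect z ^+ N.+1.
  rewrite -(perm_big _ hs)/= big_enum/=.
  rewrite (eq_bigr (fun k => (4 * c ^+ 2 * defect z)^-1 * (if k == j then (defect z)^-1 else 1))); last first.
    move=> k _; rewrite /r; case: (k == j).
      rewrite -invfM; congr (_^-1).
      have -> : 4 * (c * rd * rd) ^+ 2 = 4 * c ^+ 2 * (rd ^+ 2 * rd ^+ 2) by ring.
      by rewrite rd2 mulrA.
    by rewrite !mulr1 exprMn rd2 mulrA.
  rewrite big_split/= prodr_const card_ord -big_mkcond big_pred1_eq /submean_const -/c.
  by set a := 4 * c ^+ 2; rewrite exprVn [_ ^+ N]exprMn exprSr !invfM mulrA.
have nG : nnmC ((fun w => (psi (normc (f w) / K))%:E) \_ (near_set z)).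
  split; last by move=> w; apply: erestrict_ge0 => x _; exact: psi_normc_ge0.
  apply/(measurable_restrictT _ (measurable_near_set z))/measurable_EFinP.
  apply: (measurable_psi_normc (T := borel CN)) => //; first exact: measurable_near_set.
  apply: (measurable_normc (T := borel CN)).
  exact: (measurable_funS (@measurable_unit_ballC R N) EB (holomorphic_measurable hf)).
move=> h; apply: (le_trans h).
have e := integral_cints z nG hs; rewrite -e.
rewrite le_eqVlt; apply/orP; left; apply/eqP; congr (_ * _)%E.
by rewrite [RHS]integral_mkcond.
Qed.

End local_estimate.

Section box_bound.
Context (R : realType).
Local Notation leb := (@lebesgue_measure R).

Definition others n (i i' : 'I_n) := [seq k <- enum 'I_n | (k != i) && (k != i')].

Lemma perm_others n (i i' : 'I_n) : i != i' -> perm_eq (enum 'I_n) (others i i' ++ [:: i'; i]).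
Proof.
move=> ii; apply: uniq_perm; first exact: enum_uniq.
  rewrite cat_uniq filter_uniq ?enum_uniq//= !inE eq_sym ii !mem_filter !eqxx /=.
  by rewrite andbF.
move=> k; rewrite mem_enum mem_cat mem_filter !inE mem_enum /= andbT.
by case: eqP => //= _; case: eqP.
Qed.

Lemma size_others n (i i' : 'I_n) : i != i' -> size (others i i') = n.-2.
Proof.
move=> ii; have := perm_size (perm_others ii).
by rewrite size_enum_ord size_cat /= addn2 => /(congr1 (fun m => m.-2)).
Qed.

(** Coordinate i is innermost: with S the sum of the squares of the others, the weight to integrate
    is a power of 1 - S - x^2, which [powR_cap] treats once K is divided out. Then i' runs over an
    interval of length l and the others over intervals of length at most L. The positions p and p'
    may vary with those other coordinates; only the lengths are fixed. *)
Lemma pints_box n (F : n.-tuple R -> \bar R) (i i' : 'I_n) (a b : 'I_n -> R) (c beta l L K : R) :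
  nnm F -> i != i' -> -1 < beta <= 0 -> 0 < c -> 0 < l -> 0 <= L -> 0 < K ->
  (forall k, a k <= b k /\ b k - a k <= L) ->
  (forall t, F t != 0%E -> (forall k, k != i -> k != i' -> a k <= tnth t k <= b k) /\
     c <= `|tnth t i| /\ \sum_k (tnth t k) ^+ 2 < 1 /\
     (F t <= (K * (1 - \sum_k (tnth t k) ^+ 2) `^ beta)%:E)%E) ->
  (forall t, exists p p' : R, forall x y, F (tset (tset t i' y) i x) != 0%E ->
     p < x < p + l /\ p' <= y <= p' + l) ->
  forall t, (pints (others i i' ++ [:: i'; i]) F t <=
    (L ^+ n.-2 * (l * (K * (cap_const c beta * l `^ (beta + 1)))))%:E)%E.
Proof.
move=> hF ii hb c0 l0 L0 Kp hab hFt hp t; have [mF F0] := hF.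
have b1 : -1 < beta by case/andP: hb.
have M0 : 0 <= K * (cap_const c beta * l `^ (beta + 1)).
  by rewrite mulr_ge0 ?(ltW Kp)// mulr_ge0 ?powR_ge0// cap_const_ge0.
rewrite -(size_others ii); apply: (pints_bound (a := a) (b := b)) => //.
- by rewrite -(perm_uniq (perm_others ii)) enum_uniq.
- by rewrite mulr_ge0// ltW.
- move=> k u; rewrite mem_filter => /andP[/andP[ki ki'] _] h.
  by have [//|/hFt[h1 _]] := eqVneq (F u) 0%E; case: h; exact: h1.
move=> u /=; have [p [p' hpp]] := hp u.
rewrite (_ : l * _ = (p' + l - p') * (K * (cap_const c beta * l `^ (beta + 1)))); last by ring.
have hFi := nnm_pint i hF.
apply: pint_bound => //; first by rewrite lerDl ltW.
- move=> y.
  pose S := \sum_(k | k != i) (tnth (tset u i' y) k) ^+ 2.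
  pose f x := (K^-1%:E * F (tset (tset u i' y) i x))%E.
  have mf0 : measurable_fun setT (fun x => F (tset (tset u i' y) i x)).
    exact: (measurableT_comp mF (measurable_tset i _)).
  have mf : measurable_fun setT f by exact: measurable_funeM.
  have Ki0 : (0 <= K^-1%:E)%E by rewrite lee_fin invr_ge0 ltW.
  have f0 x : (0 <= f x)%E by exact: mule_ge0.
  have fE x : F (tset (tset u i' y) i x) = (K%:E * f x)%E.
    by rewrite /f muleA -EFinM divff ?gt_eqF// mul1e.
  have sumE x : \sum_k (tnth (tset (tset u i' y) i x) k) ^+ 2 = x ^+ 2 + S.
    rewrite (bigD1 i)//= tnth_tset eqxx; congr (_ + _).
    by apply: eq_bigr => k /negbTE ki; rewrite tnth_tset ki.
  have := @powR_cap R (1 - S) c p (p + l) beta f hb c0.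
  rewrite ltrDl => /(_ l0 f0) h.
  have h2 : (\int[leb]_x f x <= (cap_const c beta * (p + l - p) `^ (beta + 1))%:E)%E.
    apply: h => // x fx.
    have Fx : F (tset (tset u i' y) i x) != 0%E.
      by apply: contra fx; rewrite /f => /eqP ->; rewrite mule0.
    have [px _] := hpp x y Fx; have [_ [cx [s1 hle]]] := hFt _ Fx.
    rewrite tnth_tset eqxx in cx; rewrite sumE in s1 hle.
    split => //; split => //; split; first by lra.
    have -> : 1 - S - x ^+ 2 = 1 - (x ^+ 2 + S) by ring.
    by rewrite -(@lee_pmul2l _ K%:E)// -?fE// -EFinM.
  rewrite /pint; under eq_integral do rewrite fE.
  rewrite ge0_integralZl//; last by rewrite lee_fin ltW.
  rewrite EFinM; apply: lee_wpmul2l; first by rewrite lee_fin ltW.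
  by move: h2; rewrite (_ : p + l - p = l)//; ring.
- move=> y hy; rewrite /pint integral0_eq// => x _.
  by have [//|/hpp[_ h]] := eqVneq (F (tset (tset u i' y) i x)) 0%E.
Qed.

End box_bound.

(** * Weighted volume of the ball and of the caps *)

Section volume_estimate.
Context (R : realType) (N : nat).
Local Notation CN := 'rV[R[i]]_N.
Local Notation normc := Normc.normc.
Local Notation Re := complex.Re.
Local Notation Im := complex.Im.
Local Notation coords := (@complex_coords R N).
Local Notation lam := (@lebesgue_Cn R N).
Variable alpha : R.
Hypothesis alpha1 : -1 < alpha.

Definition powdef (w : CN) : \bar R := (defect w `^ alpha)%:E.

Lemma measurable_powdef : @measurable_fun _ _ (borel CN) (\bar R) setT powdef.
Proof.
apply/measurable_EFinP; apply: (measurableT_comp (@measurable_powR R alpha)).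
exact: measurable_defect.
Qed.

Lemma powdef_ge0 w : (0 <= powdef w)%E.
Proof. by rewrite lee_fin powR_ge0. Qed.

Lemma nnm_powdef (A : set CN) : @measurable _ (borel CN) A ->
  nnm ((powdef \_ A) \o coords).
Proof.
move=> mA; apply: nnm_coords; last by move=> z; apply: erestrict_ge0 => x _; exact: powdef_ge0.
by apply/(measurable_restrictT _ mA); exact: measurable_funTS measurable_powdef.
Qed.

Lemma coordsK t : tup (coords t) = t.
Proof.
apply: eq_from_tnth => i; rewrite tnth_mktuple -{2}(splitK i).
by case: (fintype.split i) => j; rewrite !mxE.
Qed.

Lemma enorm_coords t : hnorm (coords t) ^+ 2 = \sum_k tnth t k ^+ 2.
Proof.
rewrite -enormE enorm_sqr big_split_ord big_split /=.
by congr (_ + _); apply: eq_bigr => j _; rewrite mxE.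
Qed.

Definition partner (i : 'I_(N + N)) : 'I_(N + N) :=
  match fintype.split i with inl j => rshift N j | inr j => lshift N j end.

Lemma partner_neq i : i != partner i.
Proof.
rewrite -{1}(splitK i) /partner; case: (fintype.split i) => j /=.
  by rewrite eq_lrshift.
by rewrite eq_rlshift.
Qed.

(** [powR_cap] wants a nonpositive exponent; the positive power alpha - [beta0] of the defect is
    bounded separately. *)
Definition beta0 : R := Num.min alpha 0.

Lemma beta0P : -1 < beta0 <= 0.
Proof. by rewrite /beta0 lt_min alpha1 ge_min lexx orbT ltrN10. Qed.

Lemma powdef_le_beta (w : CN) : 0 < defect w -> defect w `^ alpha <= defect w `^ beta0.
Proof.
move=> d0; apply: ger_powR; last by rewrite /beta0 ge_min lexx.
by rewrite d0 /defect lerBlDr lerDl sqr_ge0.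
Qed.

Lemma measurable_coord_ge (c : R) i :
  @measurable _ (borel CN) (@unit_ball R N `&` [set w : CN | c <= `|tnth (tup (w : borel CN)) i|]).
Proof.
apply: measurableI; first exact: measurable_unit_ballC.
have m : @measurable_fun _ _ (borel CN) R setT (fun w => `|tnth (tup (w : borel CN)) i|).
  apply: measurableT_comp => //.
  exact: (measurableT_comp (@measurable_tnth _ R (N + N) i) (@measurable_tup R N)).
rewrite (_ : [set w : CN | _] = (fun w : borel CN => `|tnth (tup w) i|) @^-1` `[c, +oo[).
  by rewrite -[X in measurable X]setTI; exact: m.
by apply/seteqP; split => w /=; rewrite in_itv/= andbT.
Qed.

Lemma tnth_sqr_lt1 (t : (N + N).-tuple R) i : \sum_k tnth t k ^+ 2 < 1 -> -1 < tnth t i < 1.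
Proof.
move=> h; have : tnth t i ^+ 2 < 1.
  apply: le_lt_trans h; rewrite (bigD1 i)//= lerDl; apply: sumr_ge0 => k _; exact: sqr_ge0.
by move=> h2; apply/andP; split; nra.
Qed.

Lemma unit_ball_coords t : @unit_ball R N (coords t) -> \sum_k tnth t k ^+ 2 < 1.
Proof. by move=> /unit_ball_defect; rewrite /defect enorm_coords subr_gt0. Qed.

Lemma coord_ge_bound (c : R) i : 0 < c -> exists2 M, 0 <= M &
  (\int[lam]_(w in @unit_ball R N `&` [set w : CN | (c <= `|tnth (tup (w : borel CN)) i|)%R]) powdef w <= M%:E)%E.
Proof.
move=> c0; set A := (X in integral _ X).
have mA : @measurable _ (borel CN) A by exact: measurable_coord_ge.
have hF := nnm_powdef mA.
have ii := partner_neq i.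
exists (2 ^+ (N + N).-2 * (2 * (1 * (cap_const c beta0 * 2 `^ (beta0 + 1))))).
  have h1 : 0 <= cap_const c beta0 by apply: cap_const_ge0; case/andP: beta0P.
  apply: mulr_ge0; first exact: exprn_ge0.
  by rewrite mul1r; apply: mulr_ge0 => //; apply: mulr_ge0 => //; exact: powR_ge0.
rewrite integral_mkcond (integral_lebesgue_Cn [tuple 0 | _ < (N + N)%N] _ _ (perm_others ii)); first last.
- by move=> z; apply: erestrict_ge0 => x _; exact: powdef_ge0.
- by apply/(measurable_restrictT _ mA); exact: measurable_funTS measurable_powdef.
have inA t : ((powdef \_ A) \o coords) t != 0%E -> A (coords t).
  by rewrite /= patchE; case: ifPn => [|_]; [rewrite inE|rewrite eqxx].
apply: (pints_box (a := fun=> -1) (b := fun=> 1) hF ii beta0P c0) => //.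
- by move=> _; split; lra.
- move=> t /[dup] Ft /inA[/[dup] hB /unit_ball_coords h1 hc'].
  have hc : c <= `|tnth t i| by have := hc'; rewrite /= coordsK.
  split; first by move=> k _ _; have /andP[/ltW -> /ltW ->] := tnth_sqr_lt1 k h1.
  split => //; split => //; rewrite -enorm_coords.
  apply: (erestrict_le (h := fun w : CN => (1 * defect w `^ beta0)%:E) (x := coords t)) => [|_].
    by rewrite lee_fin mul1r powR_ge0.
  rewrite lee_fin mul1r; apply: powdef_le_beta; exact/unit_ball_defect.
- move=> t; exists (-1), (-1) => x y /inA[/unit_ball_coords h1 _].
  have := tnth_sqr_lt1 i h1; have := tnth_sqr_lt1 (partner i) h1.
  rewrite !tnth_tset eqxx eq_sym (negbTE ii) eqxx.
  by move=> /andP[? ?] /andP[? ?]; split; apply/andP; split; lra.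
Qed.

Lemma half_ball_bound : exists2 M, 0 <= M &
  (\int[lam]_(w in [set w : CN | (hnorm (w - 0) < 1/2)%R]) powdef w <= M%:E)%E.
Proof.
set A := (X in integral _ X).
have mA : @measurable _ (borel CN) A by apply: sub_sigma_algebra; exact: open_enorm_ball.
have hF := nnm_powdef mA.
exists (2 ^+ (size (enum 'I_(N + N))) * (1/2) `^ beta0).
  by rewrite mulr_ge0 ?exprn_ge0 ?powR_ge0.
rewrite integral_mkcond (integral_lebesgue_Cn [tuple 0 | _ < (N + N)%N] _ _ (perm_refl _)); first last.
- by move=> z; apply: erestrict_ge0 => x _; exact: powdef_ge0.
- by apply/(measurable_restrictT _ mA); exact: measurable_funTS measurable_powdef.
have hA w : A w -> 1/2 <= defect w.
  rewrite /A/= subr0 /defect => h; have h0 := enorm_ge0 w.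
  suff : hnorm w ^+ 2 <= (1/2) ^+ 2 by lra.
  by rewrite ler_pXn2r ?nnegrE//; lra.
rewrite -[enum _ as X in pints X]cats0.
apply: (pints_bound (a := fun=> -1) (b := fun=> 1) hF) => //.
- by rewrite cats0 enum_uniq.
- by move=> _; split; lra.
- move=> k t _ h /=; rewrite patchE; case: ifPn => //; rewrite inE => /hA h1.
  have h2 : @unit_ball R N (coords t) by apply/unit_ball_defect; lra.
  have /andP[h3 h4] := tnth_sqr_lt1 k (unit_ball_coords h2).
  by case: h; apply/andP; split; exact: ltW.
- move=> t /=; apply: (erestrict_le (h := fun _ : CN => ((1/2) `^ beta0)%:E) (x := coords t)) => [|/hA h].
    by rewrite lee_fin powR_ge0.
  rewrite lee_fin; apply: le_trans (powdef_le_beta _) _; first lra.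
  by apply: ler_powR_npos => //; case/andP: beta0P.
Qed.

(** Finiteness matters for alpha < 0. The ball is covered by the half ball, where the weight is
    bounded, and by the sets where a given real coordinate is at least c in modulus: if all 2 N were
    smaller, then |w| <= 2 c N < 1 / 2. *)
Lemma ball_bound : exists2 M, 0 <= M &
  (\int[lam]_(w in @unit_ball R N) powdef w <= M%:E)%E.
Proof.
pose c : R := (4 * N.+1%:R)^-1.
have c0 : 0 < c by rewrite invr_gt0 mulr_gt0.
have [M0 M00 hM0] := half_ball_bound.
have /choice[M hM] : forall i, exists M, 0 <= M /\
   (\int[lam]_(w in @unit_ball R N `&` [set w : CN | (c <= `|tnth (tup (w : borel CN)) i|)%R]) powdef w <= M%:E)%E.
  by move=> i; have [M ? ?] := coord_ge_bound i c0; exists M.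
pose A n : set CN := if n is n'.+1 then (if insub n' is Some i then
    @unit_ball R N `&` [set w : CN | c <= `|tnth (tup (w : borel CN)) i|] else set0)
  else [set w : CN | hnorm (w - 0) < 1/2].
(* The power of 2 compensates the ratio 1 / 2 over the 2 N + 1 sets of the finite cover, indexed by
   0 for the half ball and i + 1 for coordinate i, so that the geometric cover lemma applies. *)
pose S := (M0 + \sum_i M i) * 2 ^+ (N + N).+1.
have sM0 : 0 <= \sum_i M i by apply: sumr_ge0 => i _; case: (hM i).
have S0 : 0 <= S by rewrite mulr_ge0 ?addr_ge0// exprn_ge0.
exists (S / (1 - 2^-1)); first by rewrite divr_ge0//; lra.
apply: (@integral_cover_geometric _ _ R lam A) => //.
- exact: measurable_unit_ballC.
- case=> [|n] /=; first by apply: sub_sigma_algebra; exact: open_enorm_ball.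
  by case: insub => [i|//]; exact: measurable_coord_ge.
- exact: measurable_powdef.
- exact: powdef_ge0.
- move=> w wB; have [h|h] := ltP (hnorm (w - 0)) (1/2); first by exists 0%N.
  rewrite subr0 in h; have [i hi] : exists i, c <= `|tnth (tup (w : borel CN)) i|.
    apply: contrapT => hn.
    have hj j : normc (w ord0 j) <= 2 * c.
      apply: le_trans (normc_le_ReIm _) _.
      have : `|Re (w ord0 j)| < c /\ `|Im (w ord0 j)| < c.
        split; rewrite ltNge; apply/negP => hc; apply: hn.
          exists (lshift N j); rewrite tnth_mktuple.
          by rewrite -[lshift N j]/(unsplit (inl j)) unsplitK.
        exists (rshift N j); rewrite tnth_mktuple.
        by rewrite -[rshift N j]/(unsplit (inr j)) unsplitK.
      by move=> [] ? ?; lra.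
    have : 1/2 <= \sum_(j < N) (2 * c).
      by apply: (le_trans h); apply: le_trans (enorm_le_sum _) _; apply: ler_sum => j _; exact: hj.
    rewrite sumr_const card_ord => h2.
    have : 2 * c *+ N < 1/2; last by lra.
    have cN : 2 * c *+ N.+1 = 1 / 2.
      have n0 : N.+1%:R != 0 :> R by rewrite pnatr_eq0.
      by rewrite -[LHS]mulr_natl /c; move: (N.+1%:R : R) n0 => m n0; field.
    by rewrite -cN mulrS; lra.
  by exists i.+1 => //=; rewrite valK; split.
- by apply/andP; split; lra.
- move=> n; apply: (@le_trans _ _ (if (n <= N + N)%N then (M0 + \sum_i M i)%:E else 0%E)).
    case: n => [|n] /=.
      by apply: le_trans hM0 _; rewrite lee_fin; lra.
    case: insubP => [i -> _|/negbTE ->]; last by rewrite integral_set0.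
    have [Mi0 hMi] := hM i; apply: (le_trans hMi); rewrite lee_fin (bigD1 i)//=.
    have : 0 <= \sum_(j | j != i) M j by apply: sumr_ge0 => j _; case: (hM j).
    by lra.
  case: ifPn => hn; last by rewrite lee_fin mulr_ge0// exprn_ge0.
  rewrite lee_fin /S -mulrA ler_peMr ?addr_ge0// exprVn.
  by rewrite ler_pdivlMr ?exprn_gt0// mul1r ler_weXn2l ?ler1n// (leq_trans hn).
Qed.

Definition cap (xi : CN) (t : R) : set CN :=
  [set w | @unit_ball R N w /\ normc (1 - hdot w xi) < t].

Lemma measurable_cap xi t : @measurable _ (borel CN) (cap xi t).
Proof.
have m : @measurable_fun _ _ (borel CN) R setT (fun w : borel CN => normc (1 - hdot (w : CN) xi)).
  exact: (measurableT_comp (g := fun w : borel CN => (xi : borel CN, w)) (@measurable_near_dist R N) (pair1_measurable _)).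
have -> : cap xi t = @unit_ball R N `&` ((fun w : borel CN => normc (1 - hdot (w : CN) xi)) @^-1` `]-oo, t[).
  by apply/seteqP; split => w /=; rewrite in_itv/=.
apply: measurableI; first exact: measurable_unit_ballC.
by rewrite -[X in measurable X]setTI; exact: m.
Qed.

Lemma tup_coord_le (w w' : CN) (k : 'I_N) i : i = lshift N k \/ i = rshift N k ->
  `|tnth (tup (w : borel CN)) i - tnth (tup (w' : borel CN)) i| <= normc (w ord0 k - w' ord0 k).
Proof.
have ReB (u v : R[i]) : Re u - Re v = Re (u - v) by case: u; case: v.
have ImB (u v : R[i]) : Im u - Im v = Im (u - v) by case: u; case: v.
move=> [] ->; rewrite !tnth_mktuple.
  by rewrite -[lshift N k]/(unsplit (inl k)) unsplitK ReB; exact: Re_le_normc.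
by rewrite -[rshift N k]/(unsplit (inr k)) unsplitK ImB; exact: Im_le_normc.
Qed.

Lemma index_complex (i : 'I_(N + N)) : exists k : 'I_N, i = lshift N k \/ i = rshift N k.
Proof. by rewrite -(splitK i); case: (fintype.split i) => j; exists j; [left|right]. Qed.

Lemma tup_le_enorm (w w' : CN) i :
  `|tnth (tup (w : borel CN)) i - tnth (tup (w' : borel CN)) i| <= hnorm (w - w').
Proof.
have [k hk] := index_complex i; apply: le_trans (tup_coord_le w w' hk) _.
by have := normc_coord_le (w - w') k; rewrite !mxE.
Qed.

(** |w - xi|^2 = |w|^2 - 2 Re <w, xi> + 1 is at most 2 Re (1 - <w, xi>); hence the Euclidean radius
    O(sqrt t) of a cap. *)
Lemma cap_dist (xi w : CN) t : hnorm xi = 1 -> cap xi t w ->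
  hnorm (w - xi) ^+ 2 <= 2 * t /\ defect w <= 2 * t.
Proof.
move=> xi1 [wB wt].
have w1 : hnorm w < 1 by move: wB; rewrite /unit_ball/= enormE.
have w0 := enorm_ge0 w.
have cs := cauchy_schwarz w xi; rewrite xi1 mulr1 in cs.
have tr : 1 <= normc (1 - hdot w xi) + normc (hdot w xi).
  by have := normcD_le (1 - hdot w xi) (hdot w xi); rewrite subrK Normc.normc1.
split; last by rewrite /defect; nra.
have hN : Re (hdot w (- xi)) = - Re (hdot w xi).
  by rewrite (innerC (- xi) w) (innerC xi w) innerNl; case: (hdot xi w).
have hR : Re (1 - hdot w xi) = 1 - Re (hdot w xi) by case: (hdot w xi).
have := le_trans (ler_norm _) (Re_le_normc (1 - hdot w xi)).
rewrite enormD_sqr enormN xi1 hN hR; nra.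
Qed.

Lemma cset_dot (w xi : CN) k (c : R[i]) :
  hdot (cset w k c) xi = hdot (cset w k 0) xi + c * conjc (xi ord0 k).
Proof.
have E (d : R[i]) : hdot (cset w k d) xi = d * conjc (xi ord0 k) + \sum_(j < N | j != k) w ord0 j * conjc (xi ord0 j).
  rewrite innerE (bigD1 k)//= mxE eqxx; congr (_ + _).
  by apply: eq_bigr => j /negbTE jk; rewrite mxE jk.
by rewrite !E mul0r add0r addrC.
Qed.

(* In coordinates, one real coordinate i bounded away from 0 is integrated by the
   one-dimensional estimate; its partner, the other part of the same complex coordinate,
   is confined to an interval of length O(t), the others to ones of length O(sqrt t). *)
Lemma cap_small_bound (xi : CN) (t : R) : (0 < N)%N -> hnorm xi = 1 -> 0 < t -> 2 * t <= ((4 * N%:R)^-1) ^+ 2 ->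
  (\int[lam]_(w in cap xi t) powdef w <=
   ((2 * Num.sqrt (2 * t)) ^+ (N + N).-2 * (2 * N%:R * t * ((2 * t) `^ (alpha - beta0) *
     (cap_const (4 * N%:R)^-1 beta0 * (2 * N%:R * t) `^ (beta0 + 1)))))%:E)%E.
Proof.
move=> N0 xi1 t0 tsmall; have mA := measurable_cap xi t; set A := cap xi t in mA *.
have N1 : 1 <= N%:R :> R by rewrite ler1n.
pose c : R := (4 * N%:R)^-1; pose rt := Num.sqrt (2 * t).
have c0 : 0 < c by rewrite invr_gt0; lra.
have cN : c * (4 * N%:R) = 1 by rewrite /c mulVf// gt_eqF//; lra.
have rt2 : rt ^+ 2 = 2 * t by rewrite sqr_sqrtr//; lra.
have rt0 : 0 <= rt by exact: sqrtr_ge0.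
have rtc : rt <= c by rewrite -(@ler_pXn2r _ 2) ?nnegrE ?(ltW c0)// rt2.
(* The largest coordinate of xi has modulus at least 1 / N = 4 c, so its real or imaginary part is
   at least 2 c. On the cap |w - xi| <= sqrt (2 t) <= c, and the same real coordinate of w stays at
   least c. *)
have [k hk] := exists_pivot xi N0.
have xik : 1 <= N%:R * normc (xi ord0 k).
  apply: (@le_trans _ _ (hnorm xi)); first by rewrite xi1.
  apply: (le_trans (enorm_le_sum _)).
  have : \sum_(j < N) normc (xi ord0 j) <= \sum_(j < N) normc (xi ord0 k) by apply: ler_sum.
  by rewrite sumr_const card_ord mulr_natl.
have xik0 : 0 < normc (xi ord0 k).
  rewrite lt_neqAle normc_ge0 andbT; apply/eqP => h; move: xik; rewrite -h mulr0; lra.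
have [i ik xii] : exists2 i, i = lshift N k \/ i = rshift N k & 2 * c <= `|tnth (tup (xi : borel CN)) i|.
  have h := normc_le_ReIm (xi ord0 k).
  have h4 : 4 * c <= normc (xi ord0 k).
    have : 4 * c * (N%:R * normc (xi ord0 k)) = normc (xi ord0 k).
      by transitivity (c * (4 * N%:R) * normc (xi ord0 k)); [ring|rewrite cN mul1r].
    by move=> <-; rewrite ler_peMr//; lra.
  have [h1|h1] := leP (2 * c) `|Re (xi ord0 k)|.
    exists (lshift N k); first by left.
    by rewrite tnth_mktuple -[lshift N k]/(unsplit (inl k)) unsplitK.
  exists (rshift N k); first by right.
  by rewrite tnth_mktuple -[rshift N k]/(unsplit (inr k)) unsplitK; lra.
have pik : partner i = lshift N k \/ partner i = rshift N k.
  by case: ik => ->; rewrite /partner; [right; rewrite -[lshift N k]/(unsplit (inl k)) unsplitK|left; rewrite -[rshift N k]/(unsplit (inr k)) unsplitK].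
have hF := nnm_powdef mA; have ii := partner_neq i.
rewrite integral_mkcond (integral_lebesgue_Cn [tuple 0 | _ < (N + N)%N] _ _ (perm_others ii)); first last.
- by move=> z; apply: erestrict_ge0 => x _; exact: powdef_ge0.
- by apply/(measurable_restrictT _ mA); exact: measurable_funTS measurable_powdef.
have inA u : ((powdef \_ A) \o coords) u != 0%E -> A (coords u).
  by rewrite /= patchE; case: ifPn => [|_]; [rewrite inE|rewrite eqxx].
have near u j : A (coords u) -> `|tnth u j - tnth (tup (xi : borel CN)) j| <= rt.
  move=> /(cap_dist xi1)[h _]; rewrite -{1}(coordsK u).
  apply: le_trans (tup_le_enorm _ _ _) _.
  by rewrite -(@ler_pXn2r _ 2) ?nnegrE ?enorm_ge0// rt2.
pose x0 := tnth (tup (xi : borel CN)).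
apply: (pints_box (a := fun j => x0 j - rt) (b := fun j => x0 j + rt) hF ii beta0P c0) => //.
- by rewrite !mulr_gt0//; lra.
- by rewrite powR_gt0// mulr_gt0.
- by move=> j; rewrite -/rt; split; lra.
- move=> u /[dup] Fu /inA /[dup] hA [/unit_ball_coords h1 _].
  split; first by move=> j _ _; have := near u j hA; rewrite ler_norml /x0; lra.
  split.
    have := near u i hA; have := ler_normB (tnth u i) (tnth u i - tnth (tup (xi : borel CN)) i).
    rewrite opprB addrC subrK; lra.
  split => //; rewrite -enorm_coords.
  apply: (erestrict_le (h := fun w : CN => ((2 * t) `^ (alpha - beta0) * defect w `^ beta0)%:E) (x := coords u)) => [|_].
    by rewrite lee_fin mulr_ge0// powR_ge0.
  have d0 : 0 < defect (coords u) by rewrite /defect enorm_coords subr_gt0.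
  have [_ d2] := cap_dist xi1 hA.
  have ab : 0 <= alpha - beta0 by rewrite subr_ge0 /beta0 ge_min lexx.
  rewrite lee_fin.
  have -> : defect (coords u) `^ alpha = defect (coords u) `^ (alpha - beta0) * defect (coords u) `^ beta0.
    by rewrite -powRD ?subrK// (gt_eqF d0) implybT.
  rewrite ler_wpM2r ?powR_ge0//; apply: ge0_ler_powR; rewrite ?nnegrE//; lra.
(* With the other coordinates fixed, 1 - <w, xi> is affine in w_k with slope of modulus |xi_k| >= 1
   / N. So w_k lies within N t of the zero [uc], which gives both intervals of length 2 N t. *)
- move=> u; pose h0 := hdot (cset (coords u) k 0) xi.
  pose uc := (1 - h0) / conjc (xi ord0 k); pose U := cset (coords u) k uc.
  exists (tnth (tup (U : borel CN)) i - N%:R * t), (tnth (tup (U : borel CN)) (partner i) - N%:R * t) => x y.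
  set u' := tset _ _ _ => /inA[_ hc].
  have u'E : coords u' = cset (coords u) k (coords u' ord0 k).
    apply/rowP => j; rewrite [in RHS]mxE; case: eqVneq => [->//|jk].
    have ne1 : (lshift N j == i) = false.
      by case: ik => ->; rewrite ?(inj_eq (@lshift_inj _ _)) ?(negbTE jk)// eq_lrshift.
    have ne2 : (rshift N j == i) = false.
      by case: ik => ->; rewrite ?(inj_eq (@rshift_inj _ _)) ?(negbTE jk)// eq_rlshift.
    have ne3 : (lshift N j == partner i) = false.
      by case: pik => ->; rewrite ?(inj_eq (@lshift_inj _ _)) ?(negbTE jk)// eq_lrshift.
    have ne4 : (rshift N j == partner i) = false.
      by case: pik => ->; rewrite ?(inj_eq (@rshift_inj _ _)) ?(negbTE jk)// eq_rlshift.
    by rewrite !mxE !tnth_tset ne1 ne2 ne3 ne4.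
  have nz : conjc (xi ord0 k) != 0.
    by apply: contraTneq xik0 => hz; rewrite -normcJ hz Normc.normc0 ltxx.
  have hd : normc (coords u' ord0 k - U ord0 k) < N%:R * t.
    rewrite u'E cset_dot -/h0 opprD addrA in hc.
    have -> : coords u' ord0 k - U ord0 k = - ((1 - h0 - coords u' ord0 k * conjc (xi ord0 k)) / conjc (xi ord0 k)).
      have -> : U ord0 k = uc by rewrite mxE eqxx.
      by rewrite /uc; move: (coords u' ord0 k) (1 - h0) (conjc (xi ord0 k)) nz => z1 z2 z3 z30; field.
    rewrite normcN Normc.normcM Normc.normcV normcJ ltr_pdivrMr//.
    apply: (lt_le_trans hc); rewrite mulrAC ler_peMl// ltW//.
  have b1 := le_lt_trans (tup_coord_le (coords u') U ik) hd.
  have b2 := le_lt_trans (tup_coord_le (coords u') U pik) hd.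
  rewrite coordsK !tnth_tset !eqxx eq_sym (negbTE ii) in b1 b2.
  rewrite !ltr_norml in b1 b2; case/andP: b1 => b1 b1'; case/andP: b2 => b2 b2'.
  by split; apply/andP; split; lra.
Qed.

End volume_estimate.

(** * The measure [v_alpha]: normalization, caps, local estimate *)

Section weighted_measure.
Context (R : realType) (N : nat).
Local Notation CN := 'rV[R[i]]_N.
Local Notation normc := Normc.normc.
Local Notation lam := (@lebesgue_Cn R N).
Local Notation B := (@unit_ball R N).
Variable alpha : R.
Hypothesis alpha1 : -1 < alpha.
Hypothesis N0 : (0 < N)%N.
Local Notation s := (N%:R + 1 + alpha).
Local Notation va := (@v_alpha R N alpha).

Lemma dim_gt0 : 1 < s.
Proof.
have : 1 <= N%:R :> R by rewrite ler1n.
move: alpha1; lra.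
Qed.

(** For small t the powers of t add up as N - 1 from the 2 N - 2 coordinates of range sqrt t, 1 from
    the partner, alpha - b from the bounded part of the weight and b + 1 from the singular one: N +
    1 + alpha in all. For t above the threshold t0 / 1 the mass M of the whole ball is at most M (t
    / t0)^s. *)
Lemma cap_bound : exists2 C : R, 0 < C & forall (xi : CN) t, hnorm xi = 1 -> 0 < t ->
  (\int[lam]_(w in cap xi t) powdef alpha w <= (C * t `^ s)%:E)%E.
Proof.
have [M M0 hM] := ball_bound N alpha1.
pose t0 : R := ((4 * N%:R)^-1) ^+ 2 / 2.
have N1 : 1 <= N%:R :> R by rewrite ler1n.
have t00 : 0 < t0 by rewrite divr_gt0// exprn_gt0// invr_gt0; lra.
pose b := beta0 alpha; pose n := N.-1.
have Nn : N = n.+1 by rewrite /n prednK.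
pose C1 := 8 ^+ n * (2 * N%:R * (2 `^ (alpha - b) * (cap_const (4 * N%:R)^-1 b * (2 * N%:R) `^ (b + 1)))).
have C10 : 0 <= C1.
  apply: mulr_ge0; first exact: exprn_ge0.
  apply: mulr_ge0; first by rewrite mulr_ge0.
  apply: mulr_ge0; first exact: powR_ge0.
  apply: mulr_ge0; last exact: powR_ge0.
  by apply: cap_const_ge0; have /andP[] := beta0P alpha1.
have C20 : 0 <= M / t0 `^ s by rewrite divr_ge0// powR_ge0.
exists (C1 + M / t0 `^ s + 1); first by lra.
move=> xi t xi1 tt0; have ts0 : 0 <= t `^ s by exact: powR_ge0.
have [th|th] := leP (2 * t) (((4 * N%:R)^-1) ^+ 2).
  apply: (le_trans (cap_small_bound alpha1 N0 xi1 tt0 th)); rewrite lee_fin.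
  apply: (@le_trans _ _ (C1 * t `^ s)); last by apply: ler_wpM2r => //; lra.
  rewrite le_eqVlt; apply/orP; left; apply/eqP.
  have -> : (2 * Num.sqrt (2 * t)) ^+ (N + N).-2 = 8 ^+ n * t ^+ n.
    have -> : ((N + N).-2 = 2 * n)%N by rewrite Nn addSn addnS /= addnn mul2n.
    have h2 : Num.sqrt (2 * t) ^+ 2 = 2 * t by rewrite sqr_sqrtr//; lra.
    have -> : (2 * Num.sqrt (2 * t)) ^+ (2 * n) = ((2 * Num.sqrt (2 * t)) ^+ 2) ^+ n by rewrite -exprM.
    have -> : (2 * Num.sqrt (2 * t)) ^+ 2 = 8 * t.
      transitivity (4 * Num.sqrt (2 * t) ^+ 2); [ring|rewrite h2; ring].
    exact: exprMn.
  have e1 : (2 * t) `^ (alpha - b) = 2 `^ (alpha - b) * t `^ (alpha - b) by rewrite powRM// ltW.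
  have e2 : (2 * N%:R * t) `^ (b + 1) = (2 * N%:R) `^ (b + 1) * t `^ (b + 1).
    by apply: powRM; rewrite ?(ltW tt0)// mulr_ge0.
  rewrite -/b e1 e2.
  have -> : t `^ s = t ^+ n * (t * (t `^ (alpha - b) * t `^ (b + 1))).
    rewrite -powR_mulrn ?(ltW tt0)// -{3}(powRr1 (ltW tt0)) -!powRD ?(gt_eqF tt0) ?implybT//.
    by congr (t `^ _); rewrite Nn -[n.+1%:R]natr1; ring.
  by rewrite /C1; ring.
apply: (@le_trans _ _ M%:E).
  apply: le_trans hM; apply: ge0_subset_integral => //.
  - exact: measurable_cap.
  - exact: measurable_unit_ballC.
  - by apply: measurable_funTS; exact: measurable_powdef.
  - by move=> w _; exact: powdef_ge0.
  - by move=> w [].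
rewrite lee_fin; apply: (@le_trans _ _ (M / t0 `^ s * t `^ s)); last by apply: ler_wpM2r => //; lra.
rewrite -mulrA ler_peMr// mulrC ler_pdivlMr ?powR_gt0// mul1r.
have tle : t0 <= t by rewrite /t0; lra.
have s0 : 0 <= s by exact: ltW (lt_trans ltr01 dim_gt0).
by apply: (ge0_ler_powR s0) => //; rewrite nnegrE ltW.
Qed.

Lemma integral_volume (A : set CN) (f : borel CN -> \bar R) : @measurable _ (borel CN) A ->
  measurable_fun setT f -> (forall w, (0 <= f w)%E) ->
  (\int[@volume R N]_(w in A) f w = ((fine (lam B))^-1)%:E * \int[lam]_(w in A `&` B) f w)%E.
Proof.
move=> mA mf f0; have mB := @measurable_unit_ballC R N.
apply: etrans (ge0_integral_mscale _ mA _ (measurable_funTS mf) _) _ => //; congr (_ * _)%E.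
have EA : A = (A `&` B) `|` (A `&` ~` B).
  by rewrite -setIUr setUv setIT.
rewrite {1}EA ge0_integral_setU//.
- rewrite [X in (_ + X)%E](_ : _ = 0%E) ?adde0.
    by apply: eq_measure_integral => /= S mS SAB; rewrite /mrestr; congr (lam _); apply/setIidl => w /SAB[].
  rewrite -[RHS](@integral_measure_zero _ (borel CN) R (A `&` ~` B) f).
  apply: eq_measure_integral => /= S mS SAB; rewrite /mrestr /mzero.
  rewrite (_ : S `&` B = set0) ?measure0//; apply/seteqP; split => // w [/SAB[_ nb] b]; exact: (nb b).
- exact: measurableI.
- by apply: measurableI => //; exact: measurableC.
- exact: measurable_funTS mf.
- by apply/disj_setPS => w [[_ ?] [_ ?]].
Qed.

(** The local estimate for the constant function 1 at the origin would read psi (1 / 16^N) <= 0 if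
    this neighborhood were null; positivity of the volume is thus obtained without computing it. *)
Lemma near_set0_pos (psi : R -> R) : orlicz_function psi -> (0 < lam (near_set (0 : CN)))%E.
Proof.
move=> hpsi; rewrite lt_neqAle measure_ge0 andbT; apply/eqP => h0.
have hf : holomorphic_on B (cst (1 : R[i])) by move=> z _; exact: differentiable_cst.
have d0 : 0 < defect (0 : CN) by rewrite /defect enorm0 expr0n subr0.
have := local_estimate_leb N0 hpsi hf ltr01 d0.
rewrite /cst integral_cst; last exact: measurable_near_set.
rewrite -[X in (_ * (_ * X))%E]/(lam (near_set (0 : CN))) -h0 !mule0 lee_fin leNgt => /negP; apply; apply: orlicz_gt0 => //.
by rewrite Normc.normc1 mulr1 div1r invr_gt0 exprn_gt0.
Qed.

Lemma powR_comparable (x y g : R) : 0 < x -> x <= 2 * y -> y <= 2 * x ->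
  2 `^ (- `|g|) * x `^ g <= y `^ g.
Proof.
move=> x0 xy yx; have y0 : 0 < y by lra.
have [g0|g0] := leP 0 g.
  rewrite ger0_norm// powRN mulrC ler_pdivrMr ?powR_gt0// mulrC -powRM ?(ltW y0)//.
  by apply: (ge0_ler_powR g0) => //; rewrite nnegrE ?mulr_ge0// ltW.
rewrite ltr0_norm// opprK -powRM ?(ltW x0)//.
by apply: ler_powR_npos => //; exact: ltW.
Qed.

(** [volume] and [c_alpha] are built from [fine] and inverses, which have their intended values only
    once the masses involved are known to be finite and positive. The normalization of the volume
    then cancels, and kappa is the inverse of the integral of the weight over the ball. *)
Lemma v_alphaE (psi : R -> R) : orlicz_function psi -> exists2 kappa : R, 0 < kappa &
  forall A, @measurable _ (borel CN) A -> (va A = kappa%:E * \int[lam]_(w in A `&` B) powdef alpha w)%E.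
Proof.
move=> hpsi; have mB := @measurable_unit_ballC R N.
have mp : measurable_fun setT (powdef alpha : borel CN -> \bar R) by exact: measurable_powdef.
have p0 w := @powdef_ge0 R N alpha w.
have n0 := near_set0_pos hpsi.
have [M0 M00 hM0] : exists2 M : R, 0 <= M & (lam B <= M%:E)%E.
  have := @ball_bound R N 0; case; first by rewrite ltrN10.
  move=> M M0; rewrite (_ : (\int[lam]_(w in B) _)%E = lam B); first by exists M.
  rewrite -[RHS]mul1e -integral_cst//; apply: eq_integral => w _.
  by rewrite /powdef powRr0.
have [M1 M10 hM1] := ball_bound N alpha1.
have nB : near_set (0 : CN) `<=` B by move=> w [].
have LB : (0 < lam B)%E.
  by apply: lt_le_trans n0 _; apply: le_measure; rewrite ?inE//; exact: measurable_near_set.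
pose L := fine (lam B).
have LE : lam B = L%:E by rewrite fineK// ge0_fin_numE// (le_lt_trans hM0) ?ltry.
have L0 : 0 < L by rewrite -lte_fin -LE.
pose I := fine (\int[lam]_(w in B) powdef alpha w)%E.
have IE : (\int[lam]_(w in B) powdef alpha w)%E = I%:E.
  by rewrite fineK// ge0_fin_numE ?integral_ge0// (le_lt_trans hM1) ?ltry.
have d0 : defect (0 : CN) = 1 by rewrite /defect enorm0 expr0n subr0.
have I0 : 0 < I.
  rewrite -lte_fin -IE.
  apply: (@lt_le_trans _ _ ((2 `^ (- `|alpha|))%:E * lam (near_set (0 : CN)))%E).
    by rewrite mule_gt0// lte_fin powR_gt0.
  rewrite -integral_cst; last exact: measurable_near_set.
  apply: (@le_trans _ _ (\int[lam]_(w in near_set (0 : CN)) powdef alpha w)%E).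
    apply: ge0_le_integral => //; first exact: measurable_near_set.
    - by move=> w _; rewrite lee_fin powR_ge0.
    - exact: measurable_funTS mp.
    - move=> w [_ [h1 [h2 _]]]; rewrite d0 in h1 h2; rewrite lee_fin.
      have := powR_comparable alpha ltr01 h1 h2.
      have -> : 1 `^ alpha = 1 :> R by rewrite powR1.
      by rewrite mulr1.
  by apply: ge0_subset_integral => //; [exact: measurable_near_set|exact: measurable_funTS mp].
have cE : c_alpha N alpha = (L^-1 * I)^-1.
  rewrite /c_alpha; congr (_^-1).
  have -> : (\int[@volume R N]_z ((1 - enorm z ^+ 2) `^ alpha)%:E)%E = (\int[@volume R N]_z powdef alpha z)%E.
    by rewrite enormE.
  by rewrite integral_volume// setTI IE -/L -EFinM.
exists I^-1; first by rewrite invr_gt0.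
move=> A mA; rewrite /v_alpha.
have -> : (\int[@volume R N]_(z in A) bergman_density alpha z)%E =
   (\int[@volume R N]_(z in A) ((L^-1 * I)^-1%:E * powdef alpha z))%E.
  by apply: eq_integral => z _; rewrite /bergman_density cE EFinM enormE.
rewrite ge0_integralZl//; last 2 first.
- exact: measurable_funTS mp.
- by rewrite lee_fin; apply/ltW; rewrite invr_gt0 mulr_gt0 ?invr_gt0.
rewrite integral_volume// -/L muleA -EFinM; congr (_%:E * _)%E.
by field; rewrite !gt_eqF.
Qed.

Lemma v_alpha_finite (psi : R -> R) : orlicz_function psi -> (va setT < +oo)%E.
Proof.
move=> hpsi; have [k k0 ->//] := v_alphaE hpsi.
have [M M0 hM] := ball_bound N alpha1.
rewrite setTI; apply: (@le_lt_trans _ _ (k%:E * M%:E)%E); last by rewrite -EFinM ltry.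
by apply: lee_wpmul2l => //; rewrite lee_fin ltW.
Qed.

Lemma v_alpha_cap (psi : R -> R) : orlicz_function psi -> exists2 C : R, 0 < C &
  forall (xi : CN) t, hnorm xi = 1 -> 0 < t -> (va (cap xi t) <= (C * t `^ s)%:E)%E.
Proof.
move=> hpsi; have [k k0 hk] := v_alphaE hpsi; have [C C0 hC] := cap_bound.
exists (k * C); first exact: mulr_gt0.
move=> xi t xi1 t0; rewrite hk; last exact: measurable_cap.
rewrite (_ : cap xi t `&` B = cap xi t); last by apply/setIidl => w [].
rewrite -mulrA EFinM; apply: lee_wpmul2l; first by rewrite lee_fin ltW.
exact: hC.
Qed.

(** On the neighborhood of z the weight is at least 2^(-|alpha|) (defect z)^alpha, which turns the
    exponent N + 1 of the Lebesgue estimate into s. *)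
Lemma local_estimate (psi : R -> R) : orlicz_function psi -> exists2 C : R, 0 < C &
  forall f K (z : CN), holomorphic_on B f -> 0 < K -> 0 < defect z ->
  ((psi (normc (f z) / (16 ^+ N * K)))%:E <= (C / defect z `^ s)%:E *
     \int[va]_(w in near_set z) (psi (normc (f w) / K))%:E)%E.
Proof.
move=> hpsi; have [k k0 hk] := v_alphaE hpsi.
pose c := k * 2 `^ (- `|alpha|); have c0 : 0 < c by rewrite mulr_gt0// powR_gt0.
have sc0 : 0 < submean_const R N.
  rewrite /submean_const invr_gt0 exprn_gt0// mulr_gt0// exprn_gt0// /submean_scale.
  by rewrite invr_gt0 mulr_gt0// ltr0n.
exists (submean_const R N / c); first by rewrite divr_gt0.
move=> f K z hf K0 d0; apply: (le_trans (local_estimate_leb N0 hpsi hf K0 d0)).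
have mE := @measurable_near_set R N z.
have EB : near_set z `<=` B by move=> w [].
have mF : @measurable_fun _ _ (borel CN) (\bar R) (near_set z) (fun w => (psi (normc (f w) / K))%:E).
  apply/measurable_EFinP.
  apply: (measurable_psi_normc (T := borel CN)) => //.
  apply: (measurable_normc (T := borel CN)).
  exact: (measurable_funS (@measurable_unit_ballC R N) EB (holomorphic_measurable hf)).
pose e := c * defect z `^ alpha.
have e0 : 0 < e by rewrite mulr_gt0// powR_gt0.
have hle : (e%:E * \int[lam]_(w in near_set z) (psi (normc (f w) / K))%:E <=
    \int[va]_(w in near_set z) (psi (normc (f w) / K))%:E)%E.
  pose en : {nonneg R} := NngNum (ltW e0).
  rewrite -(@ge0_integral_mscale _ _ R lam _ mE en)//; last by move=> w _; exact: psi_normc_ge0.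
  apply: (@ge0_le_measure_integral_on _ (borel CN) R (mscale en lam) va) => //; last first.
    by move=> w _; exact: psi_normc_ge0.
  move=> S mS SE; have hS := hk S mS.
  rewrite (_ : S `&` B = S) in hS; last by apply/setIidl => w /SE[].
  suff : (mscale en lam S <= k%:E * \int[lam]_(w in S) powdef alpha w)%E by rewrite -hS.
  rewrite /mscale /= /e /c -mulrA EFinM -muleA; apply: lee_wpmul2l; first by rewrite lee_fin ltW.
  rewrite -integral_cst//; apply: ge0_le_integral => //.
  - by move=> w _; rewrite lee_fin mulr_ge0 ?powR_ge0.
  - by apply: measurable_funTS; exact: measurable_powdef.
  - by move=> w /SE[_ [h1 [h2 _]]]; rewrite lee_fin; exact: powR_comparable.
have -> : submean_const R N / defect z ^+ N.+1 = submean_const R N / c / defect z `^ s * e.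
  have -> : defect z `^ s = defect z ^+ N.+1 * defect z `^ alpha.
    rewrite powRD ?(gt_eqF d0) ?implybT//; congr (_ * _).
    by rewrite natr1 powR_mulrn// ltW.
  by rewrite /e; field; rewrite !gt_eqF// ?exprn_gt0 ?powR_gt0.
rewrite EFinM -muleA; apply: lee_wpmul2l => //.
by rewrite lee_fin divr_ge0 ?powR_ge0//; exact/ltW/divr_gt0.
Qed.

End weighted_measure.

(** * Relations between the two conditions *)

Section carleson_conditions.
Context (R : realType) (N : nat).
Local Notation CN := 'rV[R[i]]_N.
Variable alpha : R.
Hypothesis alpha1 : -1 < alpha.
Hypothesis N0 : (0 < N)%N.
Local Notation s := (N%:R + 1 + alpha).
Variable mu : {finite_measure set (borel CN) -> \bar R}.

Lemma near0P (P : R -> Prop) : (\forall h \near 0^'+, P h) <->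
  exists2 d, 0 < d & forall h, 0 < h < d -> P h.
Proof.
split.
  move=> [d /= d0 hd]; exists d => // h /andP[h0 hd'].
  by apply: hd => //=; rewrite sub0r normrN gtr0_norm.
move=> [d d0 hd]; exists d => // h /=; rewrite sub0r normrN => h1 h0.
by apply: hd; rewrite h0 /=; rewrite gtr0_norm in h1.
Qed.

Lemma inv_pow_large (y : R) : exists2 d, 0 < d & forall h, 0 < h < d -> y <= 1 / h `^ s.
Proof.
have s1 := (dim_gt0 alpha1 N0).
pose m := Num.max 1 y; have m1 : 1 <= m by rewrite /m le_max lexx.
exists m^-1; first by rewrite invr_gt0; lra.
move=> h /andP[h0 hm].
have h1 : h < 1 by apply: (lt_le_trans hm); rewrite invf_le1//; lra.
have hs : h `^ s <= h by apply: ge1r_powR; [rewrite h0 ltW|exact: ltW].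
have hs0 : 0 < h `^ s by exact: powR_gt0.
apply: (@le_trans _ _ m); first by rewrite /m le_max lexx orbT.
rewrite ler_pdivlMr// -ler_pdivlMl ?div1r ?mulr1; last by lra.
by apply: (le_trans hs); exact: ltW.
Qed.

Lemma exists_sphere : exists xi : CN, @unit_sphere R N xi.
Proof.
exists (delta_mx 0 (Ordinal N0)); rewrite /unit_sphere/= -[LHS]ger0_norm ?sqrtr_ge0//.
rewrite -sqrtr_sqr enorm_sqr (bigD1 (Ordinal N0))//= big1 => [|j /negbTE nj]; rewrite mxE eqxx ?nj /=.
  by rewrite expr0n expr1n !addr0 sqrtr1.
by rewrite expr0n addr0.
Qed.

Lemma varrho_ge0 h : (0 <= varrho mu h)%E.
Proof.
have [xi hxi] := exists_sphere.
apply: (@le_trans _ _ (mu (carleson_window xi h))); first exact: measure_ge0.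
by apply: ereal_sup_ubound; exists xi.
Qed.

Lemma K_mu_ge t h : 0 < t <= h -> (varrho mu t * ((t `^ s)^-1)%:E <= K_mu alpha mu h)%E.
Proof. by move=> th; apply: ereal_sup_ubound; exists t. Qed.

Lemma K_mu_ge0 h : 0 < h -> (0 <= K_mu alpha mu h)%E.
Proof.
move=> h0; apply: le_trans (K_mu_ge (t := h) _); last by rewrite h0 lexx.
by rewrite mule_ge0 ?varrho_ge0// lee_fin invr_ge0 powR_ge0.
Qed.

Lemma K0_R0 psi1 psi2 : orlicz_function psi1 -> orlicz_function psi2 ->
  cond_K0 alpha mu psi1 psi2 -> cond_R0 alpha mu psi1 psi2.
Proof.
move=> hpsi1 hpsi2 hK A A0 e e0; have /near0P[d d0 hd] := hK A A0 e e0.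
apply/near0P; exists d => // h /[dup] hh /andP[h0 _]; have := hd h hh.
have hs : 0 < h `^ s by exact: powR_gt0.
rewrite gee0_abs ?K_mu_ge0// gee0_abs ?varrho_ge0//.
have [X0 _] : 0 <= orlicz_inv psi1 (1 / h `^ s) /\ psi1 (orlicz_inv psi1 (1 / h `^ s)) = 1 / h `^ s.
  by apply: orlicz_invP => //; rewrite div1r invr_ge0 ltW.
have P0 : 0 <= psi2 (A * orlicz_inv psi1 (1 / h `^ s)).
  by apply: orlicz_ge0 => //; rewrite mulr_ge0// ltW.
set P := psi2 _ in P0 *; move=> hle.
have h1 := le_trans (K_mu_ge (t := h) (h := h) ltac:(by rewrite h0 lexx)) hle.
rewrite ger0_norm ?divr_ge0 ?ler01// -(@lee_pmul2r _ ((h `^ s)^-1)%:E) ?lte_fin ?invr_gt0//.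
apply: (le_trans h1); rewrite -EFinM lee_fin ger0_norm; last by rewrite !divr_ge0// ltW.
by rewrite le_eqVlt; apply/orP; left; apply/eqP; ring.
Qed.

(** Telescoping product; C >= 1 keeps 2^n x <= (2 C)^n y, so the condition applies again at each
    stage. *)
Lemma nabla0_iter (psi : R -> R) x0 C : orlicz_function psi -> 0 < x0 -> 1 <= C ->
  (forall x y, x0 <= x -> x <= y -> psi (2 * x) / psi x <= psi (2 * C * y) / psi y) ->
  forall n x y, x0 <= x -> x <= y -> psi (2 ^+ n * x) / psi x <= psi ((2 * C) ^+ n * y) / psi y.
Proof.
move=> hpsi x00 C1 hn; elim=> [|n IH] x y x0x xy.
  by rewrite !expr0 !mul1r !divff// gt_eqF// orlicz_gt0//; lra.
have tele (a b c : R) : 0 < b -> a / b * (b / c) = a / c.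
  by move=> b0; rewrite mulrA divfK// gt_eqF.
have x0' : 0 < x by lra.
have y0' : 0 < y by lra.
have t1 : 1 <= 2 ^+ n :> R by rewrite exprn_ege1// ler1n.
have t2 : 2 ^+ n <= (2 * C) ^+ n by apply: lerXn2r; rewrite ?nnegrE; lra.
have a0 : 0 < 2 ^+ n * x by rewrite mulr_gt0//; lra.
have b0 : 0 < (2 * C) ^+ n * y by rewrite mulr_gt0//; lra.
have p1 := orlicz_gt0 hpsi a0; have p2 := orlicz_gt0 hpsi b0.
have p3 := orlicz_gt0 hpsi x0'; have p4 := orlicz_gt0 hpsi y0'.
have -> : psi (2 ^+ n.+1 * x) / psi x = (psi (2 * (2 ^+ n * x)) / psi (2 ^+ n * x)) * (psi (2 ^+ n * x) / psi x).
  by rewrite tele// exprS -mulrA.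
have -> : psi ((2 * C) ^+ n.+1 * y) / psi y = (psi (2 * C * ((2 * C) ^+ n * y)) / psi ((2 * C) ^+ n * y)) * (psi ((2 * C) ^+ n * y) / psi y).
  by rewrite tele// exprS -[2 * C * _ * y]mulrA.
apply: ler_pM.
- by rewrite divr_ge0 ?(ltW p1)// orlicz_ge0// mulr_ge0// ltW.
- by rewrite divr_ge0// ltW.
- apply: hn; first by apply: (le_trans x0x); rewrite ler_peMl// ltW.
  by apply: ler_pM => //; lra.
- exact: IH.
Qed.

(** With A <= 2^n, A' = (2 C)^n and X h the inverse at 1 / h^s, one has X h <= X t for t <= h, and
    the iterated condition gives psi (A X h) / psi (X h) <= psi (A' X t) / psi (X t). So (R0) for A'
    bounds varrho t / t^s by the required quantity at h, uniformly in t. *)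
Lemma nabla0_R0_K0 psi1 psi2 : orlicz_function psi1 -> orlicz_function psi2 ->
  (forall x, 0 <= x -> psi1 x = psi2 x) -> nabla0 psi1 ->
  cond_R0 alpha mu psi1 psi2 -> cond_K0 alpha mu psi1 psi2.
Proof.
move=> hpsi1 hpsi2 e12 [x0 x00 [C C1 hC]] hR A A0 e e0.
have hiter := nabla0_iter hpsi1 x00 C1 hC.
have [n hn] : exists n, A <= 2 ^+ n.
  have [n hn] : exists n, A <= n%:R.
    by exists (Num.truncn A).+1; apply/ltW; exact: truncnS_gt.
  exists n; apply: (le_trans hn); rewrite -natrX ler_nat; exact/ltnW/ltn_expl.
pose A' := (2 * C) ^+ n; have A'0 : 0 < A' by rewrite exprn_gt0//; lra.
have /near0P[d1 d10 hd1] := hR A' A'0 e e0.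
have [d2 d20 hd2] := inv_pow_large (psi1 x0).
pose X h := orlicz_inv psi1 (1 / h `^ s).
have XP h : 0 <= X h /\ psi1 (X h) = 1 / h `^ s.
  by apply: orlicz_invP => //; rewrite div1r invr_ge0 powR_ge0.
apply/near0P; exists (Num.min d1 d2); first by rewrite lt_min d10.
move=> h /andP[h0]; rewrite lt_min => /andP[hd1h hd2h].
have hs t : 0 < t -> 0 < 1 / t `^ s by move=> t0; rewrite div1r invr_gt0 powR_gt0.
have Xx0 t : 0 < t <= h -> x0 <= X t.
  move=> /andP[t0 th]; have [Xt0 pX] := XP t.
  apply: (orlicz_le_inv hpsi1 Xt0); rewrite pX; apply: hd2; rewrite t0/=; lra.
have Xh : x0 <= X h by apply: Xx0; rewrite h0 lexx.
have [Xh0 pXh] := XP h.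
have Xhp : 0 < X h by lra.
have AX0 : 0 <= A * X h by rewrite mulr_ge0// ltW.
rewrite gee0_abs ?K_mu_ge0// ger0_norm; last first.
  by rewrite divr_ge0 ?(ltW (hs _ h0))//; apply: orlicz_ge0.
rewrite -/(X h); apply: ge_ereal_sup => _ [t /= th <-].
case/andP: (th) => t0 tle; have [Xt0 pXt] := XP t.
have Xt : x0 <= X t by exact: Xx0.
have XX : X h <= X t.
  apply: (orlicz_le_inv hpsi1 Xt0); rewrite pXh pXt !div1r lef_pV2 ?posrE ?powR_gt0//.
  by apply: ge0_ler_powR => //; rewrite ?nnegrE ?ltW//; apply: (lt_trans _ (dim_gt0 alpha1 N0)).
have := hd1 t; rewrite t0 /= => /(_ (le_lt_trans tle hd1h)).
rewrite gee0_abs ?varrho_ge0// -/(X t).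
have AXt : 0 < A' * X t by rewrite mulr_gt0//; lra.
have Pt : 0 < psi2 (A' * X t) by exact: orlicz_gt0.
rewrite ger0_norm; last by rewrite divr_ge0// ltW.
move=> hv; apply: (@le_trans _ _ ((e * (1 / psi2 (A' * X t)))%:E * ((t `^ s)^-1)%:E)%E).
  by apply: lee_wpmul2r => //; rewrite lee_fin invr_ge0 powR_ge0.
rewrite -EFinM lee_fin.
have -> : e * (1 / psi2 (A' * X t)) / t `^ s = e * (psi1 (X t) / psi1 (A' * X t)).
  by rewrite pXt e12 ?ltW//; ring.
have -> : e * (1 / h `^ s / psi2 (A * X h)) = e * (psi1 (X h) / psi1 (A * X h)).
  by rewrite pXh e12.
apply: ler_wpM2l; first exact: ltW.
have k1 : psi1 (A * X h) / psi1 (X h) <= psi1 (A' * X t) / psi1 (X t).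
  apply: le_trans (hiter n _ _ Xh XX).
  apply: ler_wpM2r; first by rewrite invr_ge0 orlicz_ge0.
  by apply: (orlicz_le hpsi1) => //; rewrite ler_wpM2r.
have q1 : 0 < psi1 (A * X h) by apply: orlicz_gt0 => //; rewrite mulr_gt0.
have q2 : 0 < psi1 (X h) by exact: orlicz_gt0.
have q3 : 0 < psi1 (A' * X t) by exact: orlicz_gt0.
have q4 : 0 < psi1 (X t) by apply: orlicz_gt0 => //; lra.
by rewrite -[X in X <= _]invf_div -[X in _ <= X]invf_div lef_pV2 ?posrE ?divr_gt0.
Qed.

End carleson_conditions.

(** * Necessity of the first condition *)

Section modular_limits.
Context d (T : measurableType d) (R : realType).
Local Notation normc := Normc.normc.

Lemma modular_fatou (m : {measure set T -> \bar R}) (D : set T) (psi : R -> R)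
    (u : nat -> T -> R[i]) (v : T -> R[i]) e M :
  measurable D -> orlicz_function psi -> 0 < e ->
  (forall n, measurable_fun D (fun x => normc (u n x))) ->
  (forall x, D x -> (normc (u n x)) @[n --> \oo] --> normc (v x)) ->
  (forall n, orlicz_modular m D psi (u n) e <= M)%E -> (orlicz_modular m D psi v e <= M)%E.
Proof.
move=> mD hpsi e0 mu cu hM.
pose F n x := (psi (normc (u n x) / e))%:E.
have -> : orlicz_modular m D psi v e = (\int[m]_(x in D) limn_einf (F^~ x))%E.
  apply: eq_integral => x; rewrite inE => Dx.
  suff /cvg_limn_einf_sup[-> _] : F^~ x @ \oo --> (psi (normc (v x) / e))%:E by [].
  apply: cvg_EFin; first exact: nearW.
  have E (z : R[i]) : psi (normc z / e) = orlicz_ext psi (normc z / e).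
    by rewrite orlicz_extE// divr_ge0 ?normc_ge0// ltW.
  rewrite E; under eq_fun do rewrite /F /= E.
  apply: (cvg_comp (fun n => normc (u n x) / e) (orlicz_ext psi)); last exact: continuous_orlicz_ext.
  by apply: cvgMl; exact: cu.
apply: le_trans (fatou m mD _ _) _.
- by move=> n; apply/measurable_EFinP; exact: measurable_psi_normc.
- by move=> n x _; exact: psi_normc_ge0.
rewrite limn_einf_lim; apply: lime_le; first exact: is_cvg_einfs.
apply: nearW => n; apply: le_trans (hM n); apply: ereal_inf_lbound.
by exists n => //=.
Qed.

Lemma normc_cvg0 (u : nat -> R[i]) (b : nat -> R) : (forall n, normc (u n) <= b n) ->
  b n @[n --> \oo] --> 0 -> normc (u n) @[n --> \oo] --> (0 : R).
Proof.
move=> ub b0; apply: (@squeeze_cvgr _ _ _ _ (cst 0) b) => //; last exact: cvg_cst.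
by apply: nearW => n; rewrite normc_ge0 ub.
Qed.

End modular_limits.

(** * Test functions concentrated on a Carleson window *)

Section test_functions.
Context (R : realType) (N : nat).
Local Notation CN := 'rV[R[i]]_N.
Local Notation normc := Normc.normc.
Local Notation B := (@unit_ball R N).
Variable alpha : R.
Hypothesis alpha1 : -1 < alpha.
Hypothesis N0 : (0 < N)%N.
Local Notation s := (N%:R + 1 + alpha).
Local Notation va := (@v_alpha R N alpha).

Definition pole (h : R) (xi : CN) : CN := real_complex R (1 - h) *: xi.

Definition bump (h : R) (xi : CN) (m : nat) (z : CN) : R[i] :=
  real_complex R (h ^+ m.+1) * ((1 - hdot z (pole h xi))^-1) ^+ m.+1.

Lemma pole_hdot h xi z : hdot z (pole h xi) = real_complex R (1 - h) * hdot z xi.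
Proof.
rewrite innerC innerZl (innerC z xi); case: (hdot z xi) => a b.
by apply/eqP; rewrite eq_complex /=; apply/andP; split; apply/eqP; ring.
Qed.

Section bump_bounds.
Variables (h : R) (xi : CN).
Hypotheses (h0 : 0 < h) (h1 : h < 1) (xi1 : hnorm xi = 1).

Lemma ball_hdot z : B z -> normc (hdot z xi) <= hnorm z /\ 0 <= hnorm z < 1.
Proof.
rewrite /unit_ball/= enormE => zB; split; last by rewrite enorm_ge0.
by have := cauchy_schwarz z xi; rewrite xi1 mulr1.
Qed.

Lemma normc_pole z : normc (hdot z (pole h xi)) = (1 - h) * normc (hdot z xi).
Proof. by rewrite pole_hdot Normc.normcM normc_real gtr0_norm// subr_gt0. Qed.

Lemma one_sub_le (c : R[i]) : 1 - normc c <= normc (1 - c).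
Proof. by have := normcD_le (1 - c) c; rewrite subrK Normc.normc1; lra. Qed.

(** The three lower bounds serve respectively for |bump| <= 1, for the decay at a fixed point as h
    tends to 0, and for the decay from one dyadic cap to the next. *)
Lemma pole_ge z : B z -> h <= normc (1 - hdot z (pole h xi)) /\
  1 - hnorm z <= normc (1 - hdot z (pole h xi)) /\
  normc (1 - hdot z xi) <= 2 * normc (1 - hdot z (pole h xi)).
Proof.
move=> /ball_hdot[z1 /andP[z2 z3]]; have h0' := h0; have h1' := h1.
have p0 := one_sub_le (hdot z (pole h xi)); rewrite normc_pole in p0.
have n0 := normc_ge0 (hdot z xi).
have q1 : (1 - h) * normc (hdot z xi) <= (1 - h) * 1 by apply: ler_wpM2l; lra.
have q2 : (1 - h) * normc (hdot z xi) <= 1 * normc (hdot z xi) by apply: ler_wpM2r; lra.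
have a1 : h <= normc (1 - hdot z (pole h xi)) by lra.
split => //; split; first by lra.
have -> : 1 - hdot z xi = (1 - hdot z (pole h xi)) - real_complex R h * hdot z xi.
  by rewrite pole_hdot rmorphB rmorph1; ring.
apply: le_trans (normcD_le _ _) _.
rewrite normcN Normc.normcM normc_real gtr0_norm//.
have q3 : h * normc (hdot z xi) <= h * 1 by apply: ler_wpM2l; lra.
lra.
Qed.

Lemma normc_bump m z : normc (bump h xi m z) = (h / normc (1 - hdot z (pole h xi))) ^+ m.+1.
Proof.
rewrite /bump Normc.normcM normc_real normcX Normc.normcV exprMn ger0_norm//.
by rewrite exprn_ge0// ltW.
Qed.

Lemma bump_holo m (K : R[i]) : holomorphic_on B (fun z => K * bump h xi m z).
Proof.
move=> z zB; have [p1 _] := pole_ge zB.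
rewrite (_ : (fun _ => _) = fun z : CN => (K * real_complex R (h ^+ m.+1)) * ((1 - hdot z (pole h xi))^-1) ^+ m.+1); last first.
  by apply/funext => w; rewrite /bump mulrA.
apply: differentiable_test; apply: contraTneq p1 => ->.
by rewrite Normc.normc0 -ltNge.
Qed.

Lemma bump_le1 m z : B z -> normc (bump h xi m z) <= 1.
Proof.
move=> /pole_ge[p1 _]; rewrite normc_bump exprn_ile1 ?divr_ge0 ?normc_ge0 ?(ltW h0)//.
by rewrite ler_pdivrMr ?mul1r// (lt_le_trans h0).
Qed.

Lemma bump_decay m z : B z -> normc (bump h xi m z) <= (h / (1 - hnorm z)) ^+ m.+1.
Proof.
move=> zB; have [_ [p2 _]] := pole_ge zB; have [_ /andP[_ z3]] := ball_hdot zB.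
rewrite normc_bump; apply: lerXn2r; rewrite ?nnegrE ?divr_ge0 ?normc_ge0 ?(ltW h0)//; first lra.
by rewrite ler_pM2l// lef_pV2 ?posrE//; lra.
Qed.

(** Write z = |z| z'. In the window |1 - <z', xi>| < h, and replacing <z', xi> by |z| (1 - h) <z',
    xi> costs at most 1 - |z| (1 - h) <= 2 h; the denominator is thus at most 3 h. *)
Lemma bump_window m z : carleson_window xi h z -> (3 ^+ m.+1)^-1 <= normc (bump h xi m z).
Proof.
move=> [zB z1 [zs zq]]; have h0' := h0; have h1' := h1; have [p1 _] := pole_ge zB; have [_ /andP[z2 z3]] := ball_hdot zB.
rewrite enormE hdotE in z1 zq; rewrite /unit_sphere/= enormE in zs.
pose z' := (real_complex R (hnorm z))^-1 *: z; rewrite -/z' in zs zq.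
have zn : hnorm z != 0.
  apply/eqP => /enorm0_eq0 z00; move: zs.
  by rewrite /z' z00 scaler0 enorm0 => /esym/eqP; rewrite oner_eq0.
have zE : z = real_complex R (hnorm z) *: z'.
  rewrite /z' scalerA divff ?scale1r//; apply: contra zn => /eqP/(congr1 (@complex.Re R)) /= /eqP //.
rewrite normc_bump -exprVn; apply: lerXn2r; rewrite ?nnegrE ?divr_ge0 ?normc_ge0 ?(ltW h0)//.
have p0 : 0 < normc (1 - hdot z (pole h xi)) by exact: lt_le_trans p1.
rewrite ler_pdivlMr// mulrC ler_pdivrMr//.
have q1 : normc (1 - hdot z' xi) < h.
  by rewrite innerC -normcJ rmorphB rmorph1 /= conjcK in zq.
have q2 : normc (hdot z' xi) <= 1 by have := cauchy_schwarz z' xi; rewrite zs xi1 mulr1.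
pose t := hnorm z * (1 - h).
have -> : 1 - hdot z (pole h xi) = (1 - hdot z' xi) + real_complex R (1 - t) * hdot z' xi.
  have zE' : hdot z xi = real_complex R (hnorm z) * hdot z' xi by rewrite {1}zE innerZl.
  by rewrite pole_hdot zE' /t !rmorphB !rmorphM !rmorphB !rmorph1; ring.
apply: le_trans (normcD_le _ _) _; rewrite Normc.normcM normc_real.
have t1 : 0 <= 1 - t <= 2 * h by rewrite /t; apply/andP; split; nra.
case/andP: t1 => t1 t2; rewrite ger0_norm//; have n0 := normc_ge0 (hdot z' xi); nra.
Qed.

End bump_bounds.

Lemma powR_expn (a g : R) n : 0 <= a -> (a ^+ n) `^ g = (a `^ g) ^+ n.
Proof.
move=> a0; elim: n => [|n IH]; first by rewrite !expr0 powR1.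
by rewrite !exprS powRM ?exprn_ge0// IH.
Qed.

Lemma measurable_bump h xi m (K : R[i]) : 0 < h -> h < 1 -> hnorm xi = 1 ->
  @measurable_fun _ _ (borel CN) R B (fun z => normc (K * bump h xi m z)).
Proof.
move=> h0 h1 xi1; apply: (measurable_normc (T := borel CN)).
exact: holomorphic_measurable (bump_holo h0 h1 xi1 m K).
Qed.

(** The ball is cut into dyadic caps |1 - <z, xi>| < 2^(k+1) h, where k is least for z. There |bump|
    <= (2 / 2^k)^(m+1) while the volume is O((2^(k+1) h)^s); the ratio 2^(s - m - 1) is less than 1
    by the choice of m. *)
Lemma bump_integral (psi : R -> R) m : orlicz_function psi -> s < m.+1%:R ->
  exists2 D : R, 0 < D & forall h xi, 0 < h -> h < 1 -> hnorm xi = 1 ->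
    (\int[va]_(z in B) (normc (bump h xi m z))%:E <= (D * h `^ s)%:E)%E.
Proof.
move=> hpsi sm; have [C C0 hC] := v_alpha_cap alpha1 N0 hpsi.
pose M := m.+1; pose q := 2^-1 ^+ M * 2 `^ s.
have q0 : 0 <= q by rewrite mulr_ge0 ?powR_ge0// exprn_ge0// invr_ge0.
have q1 : q < 1.
  rewrite /q exprVn -powR_mulrn// -powRN -powRD; last by rewrite pnatr_eq0 implybT.
  have -> : - M%:R + s = - (M%:R - s) by ring.
  by apply: powR2N_lt1; rewrite subr_gt0.
have D0 : 0 < 2 ^+ M * (C * 2 `^ s) / (1 - q).
  by rewrite divr_gt0 ?subr_gt0// !mulr_gt0 ?powR_gt0// exprn_gt0.
exists (2 ^+ M * (C * 2 `^ s) / (1 - q)) => // h xi h0 h1 xi1.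
pose u z := normc (bump h xi m z).
have mu : @measurable_fun _ _ (borel CN) R B u.
  have := measurable_bump m 1 h0 h1 xi1; apply: eq_measurable_fun => z _.
  by rewrite mul1r.
pose A k : set CN := cap xi (2 ^+ k.+1 * h) `&` (B `&` u @^-1` `]-oo, (2 ^+ M * (2^-1 ^+ M) ^+ k)%R]).
have mB := @measurable_unit_ballC R N.
have mA k : @measurable _ (borel CN) (A k).
  apply: measurableI; first exact: measurable_cap.
  exact: mu.
have mg : @measurable_fun _ _ (borel CN) (\bar R) setT ((fun z => (u z)%:E) \_ B).
  by apply/(measurable_restrictT _ mB)/measurable_EFinP.
have gB : (\int[va]_(z in B) (u z)%:E = \int[va]_(z in B) ((fun z => (u z)%:E) \_ B) z)%E.
  by apply: eq_integral => z zB; rewrite patchE zB.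
rewrite gB mulrAC; apply: (@integral_cover_geometric _ _ R va A) => //.
- by move=> z; apply: erestrict_ge0 => x _; rewrite lee_fin normc_ge0.
- move=> z zB; have ex : exists k, normc (1 - hdot z xi) < 2 ^+ k.+1 * h.
    exists (Num.truncn (normc (1 - hdot z xi) / h)); rewrite -ltr_pdivrMr//.
    apply: (lt_le_trans (truncnS_gt _)); rewrite -natrX ler_nat.
    exact/ltnW/ltn_expl.
  exists (ex_minn ex) => //; case: ex_minnP => k hk hmin; split; first by split.
  split => //; rewrite /= in_itv/=.
  case: k hk hmin => [|k] hk hmin.
    rewrite expr0 mulr1; apply: (le_trans (bump_le1 h0 h1 xi1 m zB)).
    by rewrite exprn_ege1// ler1n.
  have hk2 : 2 ^+ k.+1 * h <= normc (1 - hdot z xi).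
    by rewrite leNgt; apply/negP => /hmin; rewrite ltnn.
  have [p1 [_ p2]] := pole_ge h0 h1 xi1 zB.
  have p0 : 0 < normc (1 - hdot z (pole h xi)) by exact: lt_le_trans p1.
  rewrite /u normc_bump// exprAC -exprMn; apply: lerXn2r; rewrite ?nnegrE ?divr_ge0 ?normc_ge0 ?(ltW h0)//.
  have e0 : 0 < 2 ^+ k.+1 :> R by rewrite exprn_gt0.
  rewrite ler_pdivrMr// exprVn -(@ler_pM2l _ (2 ^+ k.+1))//.
  have -> : 2 ^+ k.+1 * (2 / 2 ^+ k.+1 * normc (1 - hdot z (pole h xi))) = 2 * normc (1 - hdot z (pole h xi)).
    by field; rewrite gt_eqF.
  exact: le_trans hk2 p2.
- apply: mulr_ge0 (powR_ge0 _ _); apply: mulr_ge0; first exact: exprn_ge0.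
  by apply: mulr_ge0 (powR_ge0 _ _); exact: ltW.
- by rewrite q0.
- move=> k; pose b : R := 2 ^+ M * (2^-1 ^+ M) ^+ k.
  have b0 : 0 <= b by rewrite mulr_ge0 ?exprn_ge0 ?invr_ge0.
  apply: (@le_trans _ _ (b%:E * va (cap xi (2 ^+ k.+1 * h)))%E).
    rewrite -integral_cst; last exact: measurable_cap.
    apply: (@le_trans _ _ (\int[va]_(z in A k) b%:E)%E).
      apply: ge0_le_integral => //.
      - by move=> z _; apply: erestrict_ge0 => x _; rewrite lee_fin normc_ge0.
      - exact: measurable_funTS mg.
      - move=> z [_ [zB]]; rewrite /= in_itv/= => hz.
        by rewrite patchE; case: ifPn => _; rewrite lee_fin.
    apply: ge0_subset_integral => //; first exact: measurable_cap.
    by move=> z [].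
  apply: (@le_trans _ _ (b%:E * (C * (2 ^+ k.+1 * h) `^ s)%:E)%E).
    by apply: lee_wpmul2l => //; apply: hC => //; rewrite mulr_gt0// exprn_gt0.
  rewrite -EFinM lee_fin le_eqVlt; apply/orP; left; apply/eqP.
  rewrite powRM ?exprn_ge0 ?(ltW h0)// powR_expn// exprS /b /q exprMn; ring.
Qed.

(** As c |bump| <= 1, convexity gives psi (c |bump| X) <= c |bump| psi X; then psi X = h^-s cancels
    the integral D h^s of |bump|. *)
Lemma test_modular (psi : R -> R) m D c X h xi : orlicz_function psi -> 0 < D -> 0 <= c <= 1 -> c * D <= 1 ->
  (forall h xi, 0 < h -> h < 1 -> hnorm xi = 1 ->
    (\int[va]_(z in B) (normc (bump h xi m z))%:E <= (D * h `^ s)%:E)%E) ->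
  0 < h -> h < 1 -> hnorm xi = 1 -> 0 <= X -> psi X = 1 / h `^ s ->
  (orlicz_modular va B psi (fun z => real_complex R (c * X) * bump h xi m z)%R 1 <= 1)%E.
Proof.
move=> hpsi D0 /andP[c0 c1] cD hD h0 h1 xi1 X0 pX; have mB := @measurable_unit_ballC R N.
have pX0 : 0 <= psi X by exact: orlicz_ge0.
have hs : 0 < h `^ s by exact: powR_gt0.
have mu : @measurable_fun _ _ (borel CN) (\bar R) B (fun z => (normc (bump h xi m z))%:E).
  apply/measurable_EFinP; have := measurable_bump m 1 h0 h1 xi1; apply: eq_measurable_fun => z _.
  by rewrite mul1r.
apply: (@le_trans _ _ ((c * psi X)%:E * \int[va]_(z in B) (normc (bump h xi m z))%:E)%E).
  rewrite -ge0_integralZl//; first last.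
  - by rewrite lee_fin mulr_ge0.
  - by move=> z _; rewrite lee_fin normc_ge0.
  apply: ge0_le_integral => //.
  - by move=> z _; exact: psi_normc_ge0.
  - apply/measurable_EFinP; apply: (measurable_psi_normc (T := borel CN)) => //.
    exact: measurable_bump.
  - exact: measurable_funeM.
  - move=> z zB; have u1 := bump_le1 h0 h1 xi1 m zB; have u0 := normc_ge0 (bump h xi m z).
    rewrite -EFinM lee_fin Normc.normcM normc_real ger0_norm ?mulr_ge0// divr1.
    have -> : c * X * normc (bump h xi m z) = (c * normc (bump h xi m z)) * X by ring.
    apply: le_trans (orlicz_scale hpsi _ X0) _; last by rewrite le_eqVlt; apply/orP; left; apply/eqP; ring.
    by rewrite mulr_ge0//= mulr_ile1.
apply: (@le_trans _ _ ((c * psi X)%:E * (D * h `^ s)%:E)%E).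
  by apply: lee_wpmul2l; [rewrite lee_fin mulr_ge0|exact: hD].
rewrite -EFinM lee_fin pX.
have -> : c * (1 / h `^ s) * (D * h `^ s) = c * D by field; rewrite gt_eqF.
by [].
Qed.

Variable mu : {finite_measure set (borel CN) -> \bar R}.

Lemma not_R0 psi1 psi2 : orlicz_function psi1 -> orlicz_function psi2 ->
  ~ cond_R0 alpha mu psi1 psi2 -> exists A e : R, [/\ 0 < A, 0 < e &
    forall d : R, 0 < d -> exists h xi, [/\ 0 < h < d, hnorm xi = 1 &
     ((e / psi2 (A * orlicz_inv psi1 (1 / h `^ s)))%:E < mu (carleson_window xi h))%E]].
Proof.
move=> hpsi1 hpsi2 nR; apply: contrapT => hn; apply: nR => A A0 e e0; apply/near0P.
apply: contrapT => hn2; apply: hn; exists A, e; split => // d d0.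
apply: contrapT => hn3; apply: hn2; exists d => // h /[dup] hh /andP[h0 hd].
have [X0 _] : 0 <= orlicz_inv psi1 (1 / h `^ s) /\ psi1 (orlicz_inv psi1 (1 / h `^ s)) = 1 / h `^ s.
  by apply: orlicz_invP => //; rewrite div1r invr_ge0 powR_ge0.
have P0 : 0 <= psi2 (A * orlicz_inv psi1 (1 / h `^ s)).
  by apply: orlicz_ge0 => //; rewrite mulr_ge0// ltW.
rewrite gee0_abs ?varrho_ge0// ger0_norm ?divr_ge0// div1r.
apply: ge_ereal_sup => _ [xi hxi <-]; rewrite leNgt; apply/negP => hlt.
by apply: hn3; exists h, xi; split => //; rewrite -enormE.
Qed.

Lemma measurable_hnorm : @measurable_fun _ _ (borel CN) R setT (@hnorm R N).
Proof.
have -> : @hnorm R N = fun z => Num.sqrt (@enorm R N z ^+ 2).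
  by apply/funext => z; rewrite enormE sqrtr_sqr ger0_norm ?enorm_ge0.
apply: (measurableT_comp (continuous_measurable_fun (@sqrt_continuous R))).
exact: measurable_enorm_sqr.
Qed.

(** Multiplying by |z| removes the radial projection: the angular condition becomes | |z| - <z, xi>
    | < h |z|, an inequality between measurable functions on the ball, with z nonzero. *)
Lemma measurable_carleson_window (xi : CN) (h : R) :
  @measurable _ (borel CN) (carleson_window xi h).
Proof.
pose F z := Num.sqrt ((hnorm z - 1 + complex.Re (1 - hdot z xi)) ^+ 2 + complex.Im (1 - hdot z xi) ^+ 2).
have mB := @measurable_unit_ballC R N.
have mh := measurable_funTS (D := (B : set (borel CN))) measurable_hnorm.
have hol : holomorphic_on B (fun z : CN => 1 - hdot z xi : R[i]).
  by move=> z _; exact: differentiable_one_sub_hdot.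
have m1 := holomorphic_measurable hol.
have mF : @measurable_fun _ _ (borel CN) R B F.
  apply: (measurableT_comp (continuous_measurable_fun (@sqrt_continuous R))).
  apply: measurable_funD; apply: measurable_funX.
    apply: measurable_funD; first exact: measurable_funB.
    exact: (measurable_Re (T := borel CN)).
  exact: (measurable_Im (T := borel CN)).
have FE z : F z = normc (real_complex R (hnorm z) - hdot z xi).
  by rewrite normcE_ReIm /F; case: (hdot z xi) => a b /=; congr (Num.sqrt (_ ^+ 2 + _ ^+ 2)); ring.
have mG : @measurable_fun _ _ (borel CN) R B (fun z => h * hnorm z - F z).
  by apply: measurable_funB => //; exact: measurable_funM.
have -> : carleson_window xi h = (B `&` (@hnorm R N) @^-1` `](1 - h), +oo[) `&`
   ((B `&` (@hnorm R N) @^-1` `]0, +oo[) `&` (B `&` (fun z => h * hnorm z - F z) @^-1` `]0, +oo[)).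
  apply/seteqP; split => z /=; rewrite !in_itv/= !andbT.
    move=> [zB]; rewrite enormE => z1 [] /=; rewrite /unit_sphere/= enormE hdotE => zs zq.
    have z0 : 0 < hnorm z.
      rewrite lt_neqAle enorm_ge0 andbT; apply/eqP => /esym/enorm0_eq0 z00; move: zs.
      by rewrite z00 scaler0 enorm0 => /esym/eqP; rewrite oner_eq0.
    split; first by split => //; lra.
    split; split => //; rewrite subr_gt0 FE.
    have -> : real_complex R (hnorm z) - hdot z xi = real_complex R (hnorm z) * (1 - hdot ((real_complex R (hnorm z))^-1 *: z) xi).
      rewrite innerZl mulrBr mulr1 mulrA divff ?mul1r//.
      by apply/eqP => /(congr1 (@complex.Re R)) /= /eqP; rewrite gt_eqF.
    rewrite Normc.normcM normc_real gtr0_norm// mulrC ltr_pM2r//.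
    by rewrite innerC -normcJ rmorphB rmorph1 /= conjcK in zq.
  move=> [[zB z1] [[_ z0] [_]]]; rewrite subr_gt0 FE => hz.
  have nz : real_complex R (hnorm z) != 0.
    by apply/eqP => /(congr1 (@complex.Re R)) /= /eqP; rewrite gt_eqF.
  split => //; rewrite ?enormE; first lra.
  split; rewrite ?/unit_sphere/= ?enormE ?hdotE.
    rewrite enormZ Normc.normcV normc_real gtr0_norm// mulVf// gt_eqF//.
  rewrite innerC -normcJ rmorphB rmorph1 /= conjcK.
  rewrite -(@ltr_pM2r _ (hnorm z))// mulrC; apply: le_lt_trans hz.
  rewrite -{1}(gtr0_norm z0) -normc_real -Normc.normcM innerZl mulrBr mulr1 mulrA divff// mul1r//.
apply: measurableI; first exact: mh.
apply: measurableI; first exact: mh.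
exact: mG.
Qed.

Lemma measurable_carleson_bound h xi m (K : R) : 0 < h -> h < 1 -> hnorm xi = 1 -> 0 <= K ->
  carleson_window xi h `<=` [set z | B z /\ K * (3 ^+ m.+1)^-1 <= normc (real_complex R K * bump h xi m z)].
Proof.
move=> h0 h1 xi1 K0 z hz; split; first by case: hz.
rewrite Normc.normcM normc_real ger0_norm// ler_wpM2l//.
exact: bump_window.
Qed.

Lemma orlicz_arg_bound (psi : R -> R) x : orlicz_function psi -> 0 <= x -> x <= 1 + (psi 1)^-1 * psi x.
Proof.
move=> hpsi x0; have p1 : 0 < psi 1 by exact: orlicz_gt0.
have i0 : 0 <= (psi 1)^-1 by rewrite invr_ge0 ltW.
have px : 0 <= psi x by exact: orlicz_ge0.
have [x1|x1] := leP x 1.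
  by apply: (le_trans x1); rewrite lerDl mulr_ge0.
have xp : 0 < x by apply: lt_trans x1.
have iX : 0 <= x^-1 <= 1 by rewrite invr_ge0 x0 invf_le1 ?(ltW x1).
have := orlicz_scale hpsi iX x0; rewrite mulVf ?gt_eqF// ler_pdivlMl// => h.
have : x <= (psi 1)^-1 * psi x by rewrite ler_pdivlMl// mulrC.
by move=> h2; apply: (le_trans h2); rewrite lerDr.
Qed.

(** An Orlicz function grows at least linearly, so X = O(1 + h^-s), and the exponent m + 1 >= s + 1
    leaves a factor h. *)
Lemma test_pointwise (psi : R -> R) m (h X : R) : orlicz_function psi -> s + 1 <= m.+1%:R ->
  0 < h -> h < 1 -> 0 <= X -> psi X = 1 / h `^ s -> X * h ^+ m.+1 <= (1 + (psi 1)^-1) * h.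
Proof.
move=> hpsi sm h0 h1 X0 pX; have hs : 0 < h `^ s by exact: powR_gt0.
have p1 : 0 < psi 1 by exact: orlicz_gt0.
have hpow : h ^+ m.+1 <= h * h `^ s.
  rewrite mulrC powR_mulS// -powR_mulrn ?(ltW h0)//.
  by apply: ger_powR => //; rewrite h0 ltW.
have hle1 : h `^ s <= 1.
  rewrite -[X in _ <= X](powRr0 h); apply: ger_powR; first by rewrite h0 ltW.
  by apply: ltW; exact: lt_trans ltr01 (dim_gt0 alpha1 N0).
apply: (@le_trans _ _ ((1 + (psi 1)^-1 * psi X) * (h * h `^ s))).
  by apply: ler_pM => //; [rewrite exprn_ge0// ltW|exact: orlicz_arg_bound].
have -> : (1 + (psi 1)^-1 * psi X) * (h * h `^ s) = h * h `^ s + (psi 1)^-1 * h.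
  by rewrite pX; field; rewrite !gt_eqF.
rewrite mulrDl mul1r lerD2r.
by rewrite ler_piMr// ltW.
Qed.

Lemma embeds_compactly_R0 psi1 psi2 : orlicz_function psi1 -> orlicz_function psi2 ->
  embeds_compactly alpha mu psi1 psi2 -> cond_R0 alpha mu psi1 psi2.
Proof.
move=> hpsi1 hpsi2 [hemb hcomp]; apply: contrapT => /(not_R0 hpsi1 hpsi2)[A [eps [A0 eps0 hbad]]].
have mB := @measurable_unit_ballC R N.
have [m sm] : exists m, s + 1 <= m.+1%:R.
  by exists (Num.truncn (s + 1)); exact/ltW/truncnS_gt.
have sm' : s < m.+1%:R by apply: lt_le_trans sm; rewrite ltrDl.
have [D D0 hD] := bump_integral hpsi1 sm'.
pose c := (1 + D)^-1; have c0 : 0 < c by rewrite invr_gt0; lra.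
have c1 : c <= 1 by rewrite invf_le1; lra.
have cD : c * D <= 1 by rewrite mulrC ler_pdivrMr; lra.
pose X h := orlicz_inv psi1 (1 / h `^ s).
have XP h : 0 <= X h /\ psi1 (X h) = 1 / h `^ s.
  by apply: orlicz_invP => //; rewrite div1r invr_ge0 powR_ge0.
have /choice[hx hhx] : forall n, exists p : R * CN, [/\ 0 < p.1 < (n.+1%:R)^-1, hnorm p.2 = 1 &
     ((eps / psi2 (A * X p.1))%:E < mu (carleson_window p.2 p.1))%E].
  move=> n; have [|h [xi hh]] := hbad (n.+1%:R)^-1; first by rewrite invr_gt0.
  by exists (h, xi).
pose h n := (hx n).1; pose xi n := (hx n).2.
have h0 n : 0 < h n by have [/andP[]] := hhx n.
have hsm n : h n < (n.+1%:R)^-1 by have [/andP[]] := hhx n.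
have h1 n : h n < 1 by apply: (lt_le_trans (hsm n)); rewrite invf_le1// ler1n.
have xi1 n : hnorm (xi n) = 1 by have [] := hhx n.
pose f n (z : CN) : R[i] := real_complex R (c * X (h n)) * bump (h n) (xi n) m z.
have fB n : bergman_orlicz alpha psi1 (f n) /\ (orlicz_modular va B psi1 (f n) 1 <= 1)%E.
  have [X0 pX] := XP (h n).
  have hm : (orlicz_modular va B psi1 (f n) 1 <= 1)%E.
    by apply: (test_modular hpsi1 D0 _ cD hD) => //; rewrite (ltW c0).
  have hol := bump_holo (h0 n) (h1 n) (xi1 n) m (real_complex R (c * X (h n))).
  split => //; split; first exact: hol.
  split; first exact: (holomorphic_measurable hol).
  by exists 1 => //; apply: (le_lt_trans hm); rewrite ltry.
pose g n : orlicz_type mu B psi2 := exist _ (f n) (hemb _ (fB n).1).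
pose S := [set g : orlicz_type mu B psi2 |
    bergman_orlicz alpha psi1 (sval g) /\ (bergman_norm alpha psi1 (sval g) <= 1)%E].
have gS n : S (g n).
  by split; [exact: (fB n).1|rewrite /bergman_norm; apply: luxemburg_le => //; exact: (fB n).2].
have [p [_ hp]] : closure S `&` cluster (g @ \oo) !=set0.
  have hSc : compact (closure S) by exact: hcomp.
  apply: (hSc (g @ \oo) (fmap_proper_filter g _)).
  have hall n : closure S (g n) := subset_closure (gS n).
  by exists 0%N => // n _; exact: hall.
(* The scale e below is such that the size of a test function on its window, divided by 2 e, equals
   kk A X. By convexity psi2 (kk A X) >= kk psi2 (A X), and the mass of the window exceeds eps /
   psi2 (A X): the modular at scale 2 e exceeds kk eps = 1 + eps. *)
pose kk := 1 + eps^-1; have ki : 0 < eps^-1 by rewrite invr_gt0.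
have kk1 : 1 <= kk by rewrite /kk lerDl ltW.
have kp : 0 < kk by apply: lt_le_trans kk1.
have t0 : 0 < (3 ^+ m.+1)^-1 :> R by rewrite invr_gt0 exprn_gt0.
pose e := c * (3 ^+ m.+1)^-1 / (2 * (A * kk)).
have e0 : 0 < e by rewrite divr_gt0 ?mulr_gt0.
have mf n : @measurable_fun _ _ (borel CN) (borel R[i]) B (f n).
  by apply: holomorphic_measurable; case: (fB n) => -[].
have mp : @measurable_fun _ _ (borel CN) (borel R[i]) B (sval p) by case: (svalP p).
(* A cluster point is approached along arbitrarily late indices; [phi n >= n] suffices for pointwise
   convergence, monotonicity being immaterial. *)
have hphi n : exists k, (n <= k)%N /\ (orlicz_modular mu B psi2 (fun x => f k x - sval p x)%R e <= 1)%E.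
  have hU : nbhs p [set q : orlicz_type mu B psi2 | (orlicz_modular mu B psi2 (fun x => sval q x - sval p x)%R e <= 1)%E].
    by apply/(nbhs_orliczP mB hpsi2); exists e.
  have hF : (g @ \oo) [set q | exists2 k, (n <= k)%N & q = g k].
    by exists n => // k /= nk; exists k.
  have [_ [[k nk ->] hq]] := hp _ _ hF hU.
  by exists k.
have [phi hph] := choice hphi.
(* The functions f (phi n) - p tend pointwise to - p, so Fatou bounds the modular of p at the scale
   e. Added to the distance from f n0 to p, this bounds f n0 itself at scale 2 e, which is enough
   for the contradiction. *)
have z0 : (orlicz_modular mu B psi2 (fun x => sval p x - 0)%R e <= 1)%E.
  apply: (@modular_fatou _ (borel CN) R mu B psi2 (fun n x => f (phi n) x - sval p x) (fun x => sval p x - 0) e 1%E mB hpsi2 e0).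
  - by move=> n; apply: measurable_normcB.
  - move=> z zB; rewrite subr0 -normcN.
    have hz : 0 < 1 - hnorm z by move: zB; rewrite /unit_ball/= enormE subr_gt0.
    pose C1 := (1 + (psi1 1)^-1) / (1 - hnorm z) ^+ m.+1.
    have p1 : 0 < psi1 1 by exact: orlicz_gt0.
    have fz n : normc (f n z) <= C1 * h n.
      have [X0 pX] := XP (h n).
      rewrite /f Normc.normcM normc_real ger0_norm ?mulr_ge0 ?(ltW c0)//.
      have b1 := bump_decay (h0 n) (h1 n) (xi1 n) m zB.
      apply: (@le_trans _ _ (X (h n) * (h n / (1 - hnorm z)) ^+ m.+1)).
        apply: ler_pM => //; rewrite ?normc_ge0 ?mulr_ge0 ?(ltW c0)//.
        by rewrite ler_piMl.
      have d0 : 0 <= ((1 - hnorm z) ^+ m.+1)^-1 by rewrite invr_ge0 exprn_ge0// ltW.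
      have tp := ler_wpM2r d0 (test_pointwise hpsi1 sm (h0 n) (h1 n) X0 pX).
      have -> : X (h n) * (h n / (1 - hnorm z)) ^+ m.+1 = X (h n) * h n ^+ m.+1 / (1 - hnorm z) ^+ m.+1.
        by rewrite exprMn exprVn mulrA.
      by apply: (le_trans tp); rewrite /C1 mulrAC.
    have cvf : normc (f (phi n) z) @[n --> \oo] --> (0 : R).
      apply: (normc_cvg0 (b := fun n => C1 * (n.+1%:R)^-1)).
        move=> n; apply: (le_trans (fz (phi n))); apply: ler_wpM2l.
          rewrite /C1 divr_ge0 ?exprn_ge0 ?(ltW hz)//; have : 0 < (psi1 1)^-1 by rewrite invr_gt0.
          lra.
        apply: (le_trans (ltW (hsm (phi n)))); rewrite lef_pV2 ?posrE ?ltr0n// ler_nat ltnS.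
        by have [] := hph n.
      rewrite -[X in _ --> X](mulr0 C1); apply: cvgMr.
      exact: cvg_harmonic.
    apply/cvgrPdist_le => eta eta0; have /cvgrPdist_le/(_ eta eta0) := cvf.
    apply: filterS => n; rewrite sub0r normrN ger0_norm ?normc_ge0// => hn.
    rewrite normcN; apply: le_trans hn; rewrite ler_norml; apply/andP; split.
      have := normcD_le (f (phi n) z) (sval p z - f (phi n) z).
      rewrite addrC subrK (normcB_sym (sval p z)); have := normcD_le (f (phi n) z - sval p z) (sval p z).
      by have := normcB_tri (f (phi n) z) 0 (sval p z); rewrite subr0 sub0r normcN; lra.
    have := normcB_tri (sval p z) (f (phi n) z) 0; rewrite !subr0 (normcB_sym (sval p z)); lra.
  - by move=> n; have [] := hph n.
have [n0 [_ hn0]] : exists k, (0 <= k)%N /\ (orlicz_modular mu B psi2 (fun x => f k x - sval p x)%R e <= 1)%E by exact: (hphi 0%N).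
have := modular_tri mB hpsi2 e0 e0 (mf n0) mp (@measurable_cst _ _ (borel CN) (borel R[i]) B (0 : R[i])) hn0 z0.
rewrite leNgt => /negP; apply.
have [X0 pX] := XP (h n0); have [_ _ hW] := hhx n0.
pose Y := c * X (h n0) * (3 ^+ m.+1)^-1.
have hs : 0 < h n0 `^ s by exact: powR_gt0.
have Xp : 0 < X (h n0).
  rewrite lt_neqAle X0 andbT; apply/eqP => hX0; move: pX; rewrite -hX0 orlicz_0//.
  by move=> /esym/eqP; rewrite div1r gt_eqF// invr_gt0.
have AX0 : 0 < A * X (h n0) by exact: mulr_gt0.
have P0 : 0 < psi2 (A * X (h n0)) by exact: orlicz_gt0.
have YE : Y / (e + e) = kk * (A * X (h n0)).
  rewrite /Y /e; move: (3 ^+ m.+1)^-1 t0 => t t0'; field.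
  by rewrite !gt_eqF// addr_gt0// mulr_gt0.
have mW := measurable_carleson_window (xi n0) (h n0).
have WB : carleson_window (xi n0) (h n0) `<=` B by move=> z [].
have mpsi : @measurable_fun _ _ (borel CN) (\bar R) B (fun z => (psi2 (normc (f n0 z - 0) / (e + e)))%:E).
  apply/measurable_EFinP; apply: (measurable_psi_normc (T := borel CN)) => //; first by rewrite addr_gt0.
  by apply: (measurable_normcB (T := borel CN)).
apply: (@lt_le_trans _ _ (\int[mu]_(z in carleson_window (xi n0) (h n0)) (psi2 (kk * (A * X (h n0))))%:E)%E); last first.
  apply: (@le_trans _ _ (\int[mu]_(z in carleson_window (xi n0) (h n0)) (psi2 (normc (f n0 z - 0) / (e + e)))%:E)%E).
    apply: ge0_le_integral => //.
    - by move=> z _; rewrite lee_fin orlicz_ge0// ltW// mulr_gt0.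
    - exact: measurable_funS mpsi.
    - move=> z hz; rewrite lee_fin subr0 -YE.
      have [_ h3] := measurable_carleson_bound m (h0 n0) (h1 n0) (xi1 n0) (mulr_ge0 (ltW c0) X0) hz.
      apply: (orlicz_le hpsi2); first by rewrite YE ltW// mulr_gt0.
      by apply: ler_wpM2r => //; rewrite invr_ge0 addr_ge0// ltW.
  apply: ge0_subset_integral => //.
  by move=> z _; apply: psi_normc_ge0 => //; rewrite addr_gt0.
rewrite integral_cst//.
have kps : kk * psi2 (A * X (h n0)) <= psi2 (kk * (A * X (h n0))).
  have i1 : 0 <= kk^-1 <= 1 by rewrite invr_ge0 (ltW kp) invf_le1.
  have := orlicz_scale hpsi2 i1 (mulr_ge0 (ltW kp) (ltW AX0)).
  by rewrite mulKf ?gt_eqF// ler_pdivlMl.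
apply: (@lt_le_trans _ _ ((kk * psi2 (A * X (h n0)))%:E * mu (carleson_window (xi n0) (h n0)))%E); last first.
  by apply: lee_wpmul2r => //; rewrite lee_fin.
apply: (@le_lt_trans _ _ ((kk * psi2 (A * X (h n0)))%:E * (eps / psi2 (A * X (h n0)))%:E)%E); last first.
  by rewrite lte_pmul2l// lte_fin mulr_gt0.
rewrite -EFinM lee_fin.
have -> : kk * psi2 (A * X (h n0)) * (eps / psi2 (A * X (h n0))) = kk * eps by field; rewrite gt_eqF.
by rewrite /kk mulrDl mul1r mulVf ?gt_eqF// lerDr ltW.
Qed.

End test_functions.

(** * Sufficiency of the second condition *)

Section finite_package.
Context d (T : measurableType d) (R : realType).
Variable m : {measure set T -> \bar R}.

(* A copy carrying the finite measure structure. *)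
Definition finite_copy (_ : (m setT < +oo)%E) : set T -> \bar R := m.

Variable mfin : (m setT < +oo)%E.

HB.instance Definition _ := Measure.copy (finite_copy mfin) m.

Let finite_copy_fin : fin_num_fun (finite_copy mfin).
Proof. apply: lty_fin_num_fun; exact: mfin. Qed.

HB.instance Definition _ := @Measure_isFinite.Build _ _ _ (finite_copy mfin) finite_copy_fin.

End finite_package.

Section schur.
Context d (T : measurableType d) (R : realType).
Local Open Scope ereal_scope.

(* Tonelli, with the roles of the point [z] and of its neighborhood exchanged. *)
Lemma schur_bound (mu : {finite_measure set T -> \bar R}) (nu : {measure set T -> \bar R})
    (rel : set (T * T)) (q G Phi : T -> \bar R) (eps : R) :
  nu setT < +oo -> measurable rel -> measurable_fun setT q -> measurable_fun setT G ->
  measurable_fun setT Phi -> (forall x, 0 <= q x) -> (forall x, 0 <= G x) -> (forall x, 0 <= Phi x) ->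
  (0 <= eps)%R ->
  (forall z, Phi z <= q z * \int[nu]_w (G w * (\1_rel (z, w))%:E)) ->
  (forall w, \int[mu]_z (q z * (\1_rel (z, w))%:E) <= eps%:E) ->
  \int[mu]_z Phi z <= eps%:E * \int[nu]_w G w.
Proof.
move=> nufin mrel mq mG mPhi q0 G0 Phi0 eps0 hPhi hq.
pose nu' := finite_copy nufin.
pose K (p : T * T) := q p.1 * (G p.2 * (\1_rel p)%:E).
have i0 p : 0 <= (\1_rel p : R)%:E by rewrite lee_fin.
have m1 : measurable_fun setT (fun p : T * T => (\1_rel p : R)%:E).
  by apply/measurable_EFinP; exact: measurable_indic.
have mK : measurable_fun setT K.
  apply: emeasurable_funM; first exact: (measurableT_comp mq measurable_fst).
  by apply: emeasurable_funM => //; exact: (measurableT_comp mG measurable_snd).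
have K0 p : 0 <= K p by rewrite mule_ge0// mule_ge0.
have ms z : measurable_fun setT (fun w => G w * (\1_rel (z, w))%:E).
  apply: emeasurable_funM => //.
  exact: (measurableT_comp (f := fun p : T * T => (\1_rel p : R)%:E) (g := fun w => (z, w)) m1 (pair1_measurable z)).
have mt w : measurable_fun setT (fun z => q z * (\1_rel (z, w))%:E).
  apply: emeasurable_funM => //.
  exact: (measurableT_comp (f := fun p : T * T => (\1_rel p : R)%:E) (g := fun z => (z, w)) m1 (pair2_measurable w)).
apply: (@le_trans _ _ (\int[mu]_z \int[nu']_w K (z, w))).
  apply: ge0_le_integral => //.
  - exact: (@measurable_fun_fubini_tonelli_F _ _ _ _ _ nu' K mK K0).
  - move=> z _; apply: (le_trans (hPhi z)); rewrite -ge0_integralZl//.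
    by move=> w _; exact: mule_ge0.
have := @fubini_tonelli _ _ _ _ _ mu nu' K mK K0; rewrite /fubini_F /fubini_G => ->.
rewrite -ge0_integralZl//.
have mKG : measurable_fun setT (fun w => \int[mu]_z K (z, w)).
  exact: (@measurable_fun_fubini_tonelli_G _ _ _ _ _ mu K mK K0).
apply: ge0_le_integral => //.
- by move=> w _; exact: integral_ge0.
- exact: measurable_funeM.
- move=> w _; rewrite (_ : \int[mu]_z K (z, w) = G w * \int[mu]_z (q z * (\1_rel (z, w))%:E)).
    by rewrite muleC; apply: lee_wpmul2r.
  rewrite -ge0_integralZl//; last by move=> z _; exact: mule_ge0.
  by apply: eq_integral => z _; rewrite /K /= muleCA.
Qed.

(** The product form of the hypothesis avoids dividing by mu W, which may vanish. *)
Lemma integral_le_sup_mul (mu : {finite_measure set T -> \bar R}) (W : set T) (f : T -> \bar R) (eps : R) :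
  measurable W -> measurable_fun setT f -> (forall z, 0 <= f z) -> (0 <= eps)%R ->
  (forall z, f z != 0 -> W z /\ f z * mu W <= eps%:E) -> \int[mu]_z f z <= eps%:E.
Proof.
move=> mW mf f0 eps0 hf.
have fW : \int[mu]_z f z = \int[mu]_(z in W) f z.
  rewrite [RHS]integral_mkcond; apply: eq_integral => z _; rewrite patchE; case: ifPn => //.
  rewrite notin_setE => Wz; have [//|/hf[]//] := eqVneq (f z) 0.
have [W0|W0] := eqVneq (mu W) 0.
  rewrite fW null_set_integral//; exact: measurable_funTS.
have Wfin : mu W \is a fin_num by exact: fin_num_measure.
have Wp : (0 < fine (mu W))%R by rewrite fine_gt0// lt_neqAle eq_sym W0 measure_ge0/= -ge0_fin_numE.
rewrite fW; apply: (@le_trans _ _ (\int[mu]_(z in W) (eps / fine (mu W))%:E)).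
  apply: ge0_le_integral => //; first exact: measurable_funTS.
  move=> z _; have [->|/hf[_]] := eqVneq (f z) 0.
    by rewrite lee_fin divr_ge0// ltW.
  by rewrite -{1}(fineK Wfin) EFinM -lee_pdivlMr.
rewrite integral_cst// (_ : _ * _ = (eps / fine (mu W))%:E * (fine (mu W))%:E); last by rewrite fineK.
by rewrite -EFinM divfK// gt_eqF.
Qed.

End schur.

Section geometry.
Context (R : realType) (N : nat).
Local Notation CN := 'rV[R[i]]_N.
Local Notation normc := Normc.normc.

(** The bound |z| > 3 / 4 keeps w away from 0. Normalizing z and w changes 1 - <w, z> by at most 1 -
    |w| |z| <= defect w + defect z, so the angular distance is at most defect w + 3 defect z <= 7
    defect w. *)
Lemma near_window (z w : CN) : near_set z w -> @unit_ball R N z -> 3 / 4 < hnorm z ->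
  exists xi, hnorm xi = 1 /\ 0 < 8 * defect w /\ 8 * defect w <= 16 * defect z /\ carleson_window xi (8 * defect w) z
    /\ xi = (real_complex R (hnorm w))^-1 *: w.
Proof.
move=> [wB [h1 [h2 h3]]] zB z34; exists ((real_complex R (hnorm w))^-1 *: w).
have dw : 0 < defect w by exact/unit_ball_defect.
have dz : 0 < defect z by exact/unit_ball_defect.
pose p := hnorm z; pose q := hnorm w.
have p1 : p < 1 by move: zB; rewrite /unit_ball/= enormE.
have q1 : q < 1 by move: wB; rewrite /unit_ball/= enormE.
have dzE : defect z = 1 - p ^+ 2 by [].
have dwE : defect w = 1 - q ^+ 2 by [].
have p34 : 3 / 4 < p by [].
have q0 : 0 < q.
  rewrite lt_neqAle enorm_ge0 andbT; apply/eqP => q0.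
  by move: dwE h2; rewrite -q0 dzE => ->; nra.
have p0 : 0 < p by lra.
have nq : real_complex R q != 0 by apply/eqP => /(congr1 (@complex.Re R)) /= /eqP; rewrite gt_eqF.
have np : real_complex R p != 0 by apply/eqP => /(congr1 (@complex.Re R)) /= /eqP; rewrite gt_eqF.
have un (u : CN) : 0 < hnorm u -> hnorm ((real_complex R (hnorm u))^-1 *: u) = 1.
  by move=> u0; rewrite enormZ Normc.normcV normc_real gtr0_norm// mulVf// gt_eqF.
split; first exact: un.
split; first by lra.
split; first by lra.
split => //.
split => //; first by rewrite enormE -/p; nra.
split; first by rewrite /unit_sphere/= enormE; exact: un.
rewrite enormE hdotE -/p -/q.
pose a := hdot w z.
have -> : hdot ((real_complex R q)^-1 *: w) ((real_complex R p)^-1 *: z) = real_complex R (q * p)^-1 * a.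
  have hz (x : R) : hdot w (real_complex R x *: z) = real_complex R x * a.
    rewrite /a (innerC (real_complex R x *: z)) innerZl (innerC z w); case: (hdot z w) => u v.
    by apply/eqP; rewrite eq_complex /=; apply/andP; split; apply/eqP; ring.
  by rewrite innerZl -!fmorphV hz invfM rmorphM mulrA.
have pq0 : 0 < q * p by exact: mulr_gt0.
have pq1 : q * p <= 1 by rewrite mulr_ile1// ltW.
have -> : 1 - real_complex R (q * p)^-1 * a = (1 - a) - real_complex R ((q * p)^-1 - 1) * a.
  by rewrite rmorphB rmorph1; ring.
apply: (le_lt_trans (normcD_le _ _)); rewrite normcN Normc.normcM normc_real.
have i1 : 0 <= (q * p)^-1 - 1 by rewrite subr_ge0 invf_ge1.
rewrite ger0_norm//.
have ca : normc a <= q * p by exact: cauchy_schwarz.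
have h4 : ((q * p)^-1 - 1) * normc a <= 1 - q * p.
  apply: le_trans (ler_wpM2l i1 ca) _.
  by rewrite mulrBl mulVf ?gt_eqF// mul1r.
have h5 : 1 - q * p <= defect w + defect z by rewrite dwE dzE; nra.
rewrite -/a in h3; lra.
Qed.

End geometry.

(** * Uniform smallness near the sphere under (K0) *)

Section tail.
Context (R : realType) (N : nat).
Local Notation CN := 'rV[R[i]]_N.
Local Notation normc := Normc.normc.
Local Notation B := (@unit_ball R N).
Variable alpha : R.
Hypothesis alpha1 : -1 < alpha.
Hypothesis N0 : (0 < N)%N.
Local Notation s := (N%:R + 1 + alpha).
Local Notation va := (@v_alpha R N alpha).
Variable mu : {finite_measure set (borel CN) -> \bar R}.
Variables psi1 psi2 : R -> R.
Hypotheses (hpsi1 : orlicz_function psi1) (hpsi2 : orlicz_function psi2).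

(* Contains the unit ball of the Bergman-Orlicz space; the factor 2 leaves room because
   the infimum defining the Luxemburg norm is not known to be attained. *)
Definition bergman_class (f : CN -> R[i]) : Prop :=
  holomorphic_on B f /\ (orlicz_modular va B psi1 f 2 <= 1)%E.

(** All constants are moved by convexity into C1, leaving the bare factor d^(-s) with d = 16 defect
    z, an upper bound for the window sizes of [near_window]; [K0_window] requires exactly this
    form. *)
Lemma class_psi_bound : exists2 C1 : R, 0 < C1 & forall f z, bergman_class f -> 0 < defect z ->
  ((psi1 (normc (f z) / C1))%:E <= ((16 * defect z) `^ (- s))%:E *
     \int[va]_(w in near_set z) (psi1 (normc (f w) / 2))%:E)%E /\
  psi1 (normc (f z) / C1) <= (16 * defect z) `^ (- s).
Proof.
have [C C0 hC] := local_estimate alpha1 N0 hpsi1.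
have b0 : 0 < 16 `^ s :> R by exact: powR_gt0.
pose k := 1 + C * 16 `^ s; have k1 : 1 <= k by rewrite lerDl mulr_ge0// ltW.
have k0 : 0 < k by exact: lt_le_trans k1.
have c0 : 0 < 16 ^+ N * 2 :> R by rewrite mulr_gt0// exprn_gt0.
exists (k * (16 ^+ N * 2)); first exact: mulr_gt0.
move=> f z [hf hm] d0.
have h1 : ((psi1 (normc (f z) / (k * (16 ^+ N * 2))))%:E <= ((16 * defect z) `^ (- s))%:E *
     \int[va]_(w in near_set z) (psi1 (normc (f w) / 2))%:E)%E.
  have I0 : (0 <= \int[va]_(w in near_set z) (psi1 (normc (f w) / 2))%:E)%E.
    by apply: integral_ge0 => w _; exact: psi_normc_ge0.
  apply: (@le_trans _ _ (k^-1 * psi1 (normc (f z) / (16 ^+ N * 2)))%:E).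
    rewrite lee_fin; have -> : normc (f z) / (k * (16 ^+ N * 2)) = k^-1 * (normc (f z) / (16 ^+ N * 2)).
      by rewrite invfM mulrCA.
    apply: orlicz_scale => //; last by rewrite divr_ge0 ?normc_ge0// ltW.
    by rewrite invr_ge0 (ltW k0) invf_le1.
  rewrite EFinM; apply: le_trans (lee_wpmul2l _ (hC f 2 z hf (ltr0Sn _ _) d0)) _.
    by rewrite lee_fin invr_ge0 ltW.
  rewrite muleA -EFinM; apply: lee_wpmul2r => //; rewrite lee_fin.
  rewrite powRN powRM ?(ltW d0)// invfM mulrA; apply: ler_wpM2r; first by rewrite invr_ge0 powR_ge0.
  by rewrite mulrC ler_pdivrMr// mulrC ler_pdivlMr// /k lerDr.
split => //; rewrite -lee_fin; apply: (le_trans h1).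
rewrite -[leRHS]mule1; apply: lee_wpmul2l; first by rewrite lee_fin powR_ge0.
apply: le_trans hm; apply: ge0_subset_integral.
- exact: measurable_near_set.
- exact: measurable_unit_ballC.
- apply/measurable_EFinP; apply: (measurable_psi_normc (T := borel CN)) => //.
    exact: measurable_unit_ballC.
  by apply: (measurable_normc (T := borel CN)); exact: holomorphic_measurable.
- by move=> w _; exact: psi_normc_ge0.
- by move=> w [].
Qed.

(** Define eta by psi1 Y = eta^(-s). The hypothesis on d says d <= eta, so t <= eta and mu (W t) <=
    K eta t^s; (K0) is used at the scale eta, where the inverse of psi1 equals Y. Taking Y >= y0
    makes eta small enough, and t <= d removes the last power. *)
Lemma K0_window A eps : cond_K0 alpha mu psi1 psi2 -> 0 < A -> 0 < eps -> exists2 y0 : R, 0 < y0 &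
  forall Y d t xi, y0 <= Y -> 0 < t -> t <= d -> psi1 Y <= d `^ (- s) -> hnorm xi = 1 ->
  ((psi2 (A * Y) * (psi1 Y) `^ (-1) * d `^ (- s))%:E * mu (carleson_window xi t) <= eps%:E)%E.
Proof.
move=> hK A0 eps0; have /near0P[h0 h00 hh] := hK A A0 eps eps0.
have s1 := dim_gt0 alpha1 N0; have s0 : 0 < s by exact: lt_trans s1.
pose hb := (h0 / 2) `^ (- s); have hb0 : 0 < hb by rewrite powR_gt0// divr_gt0.
have [y0 y00 hy0] := orlicz_unbounded hpsi1 hb.
have y0p : 0 < y0.
  rewrite lt_neqAle y00 andbT; apply/eqP => y0E; move: hy0; rewrite -y0E orlicz_0// leNgt hb0//.
exists y0 => // Y d t xi yY t0 td hd xi1.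
have Y0 : 0 < Y by exact: lt_le_trans yY.
pose v := psi1 Y; have v0 : 0 < v by exact: orlicz_gt0.
have hv : hb <= v by apply: (le_trans hy0); apply: orlicz_le.
pose eta := v `^ (- s^-1).
have eta0 : 0 < eta by exact: powR_gt0.
have etas : eta `^ s = v^-1.
  by rewrite /eta -powRrM mulNr mulVf ?gt_eqF// powR_inv1// ltW.
have leeta x : 0 < x -> v <= x `^ (- s) -> x <= eta.
  move=> x0; rewrite powRN -[v]invrK -etas lef_pV2 ?posrE ?powR_gt0// => h.
  rewrite leNgt; apply/negP => ex.
  have : eta `^ s < x `^ s by apply: (gt0_ltr_powR s0) => //; rewrite nnegrE ltW.
  by rewrite ltNge h.
have etah : eta < h0.
  have h2 : 0 < h0 / 2 by rewrite divr_gt0.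
  have e2 : eta <= h0 / 2.
    rewrite leNgt; apply/negP => ex.
    have : (h0 / 2) `^ s < eta `^ s by apply: (gt0_ltr_powR s0) => //; rewrite nnegrE ltW.
    rewrite etas ltNge => /negP; apply.
    by rewrite -[X in _ <= X]invrK lef_pV2 ?posrE ?invr_gt0 ?powR_gt0// -powRN.
  apply: (le_lt_trans e2); rewrite ltr_pdivrMr// ltr_pMr//.
  by rewrite ltr1n.
have d0 : 0 < d by exact: lt_le_trans td.
have teta : t <= eta by apply: (le_trans td); exact: leeta.
have := hh eta; rewrite eta0 etah => /(_ isT).
have vE : 1 / eta `^ s = v by rewrite etas div1r invrK.
have XE : orlicz_inv psi1 v = Y.
  by have [X0 pX] := orlicz_invP hpsi1 (ltW v0); apply: (orlicz_inj hpsi1) => //; exact: ltW.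
rewrite vE XE gee0_abs ?K_mu_ge0//.
have P0 : 0 < psi2 (A * Y) by apply: orlicz_gt0 => //; exact: mulr_gt0.
rewrite ger0_norm; last by rewrite divr_ge0// ltW.
move=> hKe.
have ts0 : 0 < t `^ s by exact: powR_gt0.
have hr : (mu (carleson_window xi t) <= (eps * (v / psi2 (A * Y)) * t `^ s)%:E)%E.
  apply: (@le_trans _ _ (varrho mu t)).
    by apply: ereal_sup_ubound; exists xi => //; rewrite /unit_sphere/= enormE.
  rewrite -(@lee_pmul2r _ ((t `^ s)^-1)%:E) ?lte_fin ?invr_gt0// -EFinM mulfK ?gt_eqF//.
  by apply: le_trans hKe; apply: K_mu_ge; rewrite t0.
apply: (@le_trans _ _ ((psi2 (A * Y) * v `^ (-1) * d `^ (- s))%:E * (eps * (v / psi2 (A * Y)) * t `^ s)%:E)%E).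
  by apply: lee_wpmul2l => //; rewrite lee_fin !mulr_ge0 ?powR_ge0// ltW.
rewrite -EFinM lee_fin powR_inv1 ?(ltW v0)//.
have -> : psi2 (A * Y) / v * d `^ (- s) * (eps * (v / psi2 (A * Y)) * t `^ s) = eps * (t `^ s * d `^ (- s)).
  by field; rewrite !gt_eqF.
rewrite ler_piMr ?(ltW eps0)// powRN ler_pdivrMr ?powR_gt0// mul1r.
by apply: ge0_ler_powR; rewrite ?nnegrE// ltW.
Qed.

Definition shell (r : R) : set CN := [set z | B z /\ r < hnorm z].

Lemma measurable_shell r : @measurable _ (borel CN) (shell r).
Proof.
have -> : shell r = B `&` (@hnorm R N) @^-1` `]r, +oo[.
  by apply/seteqP; split => z /=; rewrite in_itv/= andbT.
exact: (measurable_funTS (D := (B : set (borel CN))) (@measurable_hnorm R N) (@measurable_unit_ballC R N)).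
Qed.

(** Continuity from above along shells decreasing to the empty set; starting at 1 - 1 / 4 ensures r
    >= 3 / 4, as [near_window] needs. *)
Lemma shell_small (k : R) : 0 < k -> exists r : R, [/\ 3 / 4 <= r, r < 1 & (mu (shell r) <= k%:E)%E].
Proof.
move=> k0; pose F n := shell (1 - (n.+4%:R)^-1).
have mF n : @measurable _ (borel CN) (F n) by exact: measurable_shell.
have dF : nonincreasing_seq F.
  move=> n m nm; apply/subsetPset => z [zB hz]; split => //; apply: le_lt_trans hz.
  by rewrite lerD2l lerN2 lef_pV2 ?posrE// ler_nat !ltnS.
have F0 : \bigcap_n F n = set0.
  apply/seteqP; split => // z hz; have [zB _] := hz 0%N I.
  have z1 : 0 < 1 - hnorm z by move: zB; rewrite /unit_ball/= enormE subr_gt0.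
  have [_] := hz (Num.truncn (1 - hnorm z)^-1) I; apply/negP; rewrite -leNgt lerBrDl -lerBrDr.
  rewrite -[X in _ <= X]invrK lef_pV2 ?posrE ?invr_gt0//.
  by apply: (le_trans (ltW (truncnS_gt _))); rewrite ler_nat -addn4 -addn1 leq_add2l.
have m0 : (mu (F 0%N) < +oo)%E by rewrite -ge0_fin_numE//; exact: fin_num_measure.
have mI : @measurable _ (borel CN) (\bigcap_n F n) by rewrite F0; exact: measurable0.
have := @nonincreasing_cvg_mu _ (borel CN) R mu F m0 mF mI dF.
rewrite F0 measure0 => /fine_cvgP[_ /cvgrPdist_le/(_ k k0)[n _ hn]].
exists (1 - (n.+4%:R)^-1); split.
- have : (n.+4%:R)^-1 <= (4%:R)^-1 :> R by rewrite lef_pV2 ?posrE// ler_nat.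
  by move: (n.+4%:R^-1 : R) => x; lra.
- by rewrite ltrBlDr ltrDl invr_gt0.
- have := hn n (leqnn n); rewrite /= sub0r normrN ger0_norm ?fine_ge0// => h.
  have hfin : mu (F n) \is a fin_num by apply: fin_num_measure; exact: mF.
  by rewrite -/(F n) -(fineK hfin) lee_fin.
Qed.

Lemma measurable_psi_class psi f C : orlicz_function psi -> holomorphic_on B f -> 0 < C ->
  @measurable_fun _ _ (borel CN) R B (fun z => psi (normc (f z) / C)).
Proof.
move=> hpsi hf C0; apply: (measurable_psi_normc (T := borel CN)) => //.
  exact: measurable_unit_ballC.
by apply: (measurable_normc (T := borel CN)); exact: holomorphic_measurable.
Qed.

Lemma tail_estimate e tau : cond_K0 alpha mu psi1 psi2 -> 0 < e -> 0 < tau ->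
  exists r : R, [/\ 3 / 4 <= r, r < 1 & forall f, bergman_class f ->
    (orlicz_modular mu (shell r) psi2 f e <= tau%:E)%E].
Proof.
move=> hK e0 tau0; have [C1 C10 hC1] := class_psi_bound.
pose A := C1 / e; have A0 : 0 < A by exact: divr_gt0.
have th0 : 0 < tau / 2 by exact: divr_gt0.
have [y0 y00 hy0] := K0_window hK A0 th0.
have py0 : 0 < psi2 (A * y0) by apply: orlicz_gt0 => //; exact: mulr_gt0.
have k0 : 0 < tau / 2 / psi2 (A * y0) by exact: divr_gt0.
have [r [r34 r1 hr]] := shell_small k0.
exists r; split => // f /[dup] fcl [hf hm].
have mB := @measurable_unit_ballC R N.
pose Y z := normc (f z) / C1.
have Y0 z : 0 <= Y z by rewrite divr_ge0 ?normc_ge0// ltW.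
have AY z : normc (f z) / e = A * Y z by rewrite /A /Y; field; rewrite !gt_eqF.
have mY : @measurable_fun _ _ (borel CN) R B Y.
  apply: measurable_funM => //.
  by apply: (measurable_normc (T := borel CN)); exact: holomorphic_measurable.
pose Z : set CN := shell r `&` (B `&` Y @^-1` `[y0, +oo[).
have mZ : @measurable _ (borel CN) Z.
  by apply: measurableI; [exact: measurable_shell|exact: mY].
have ZB : Z `<=` B by move=> z [[]].
have ZP z : Z z -> [/\ B z, r < hnorm z & y0 <= Y z].
  by move=> [[zB zr] [_]]; rewrite /= in_itv/= andbT.
pose Phi := (fun z => (psi2 (normc (f z) / e))%:E) \_ Z.
(* The kernel depends on f, but its integral over the z having w in their neighborhood is at most
   tau / 2 for every f of the class: the pointwise bound of [class_psi_bound] is the hypothesis psi1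
   Y <= d^(-s) of [K0_window], with Y = |f z| / C1, d = 16 defect z and t = 8 defect w. *)
pose Q z := psi2 (normc (f z) / e) * (psi1 (normc (f z) / C1)) `^ (-1) * (16 * defect z) `^ (- s).
pose q := (fun z => (Q z)%:E) \_ Z.
pose G := (fun w => (psi1 (normc (f w) / 2))%:E) \_ B.
have m2 := measurable_psi_class hpsi2 hf e0.
have mPhi : @measurable_fun _ _ (borel CN) (\bar R) setT Phi.
  by apply/(measurable_restrictT _ mZ)/measurable_EFinP; exact: measurable_funS m2.
have mQ : @measurable_fun _ _ (borel CN) R B Q.
  apply: measurable_funM.
    apply: measurable_funM => //.
    exact: (measurableT_comp (@measurable_powR R (-1)) (measurable_psi_class hpsi1 hf C10)).
  apply: (measurableT_comp (@measurable_powR R (- s))).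
  by apply: measurable_funTS; apply: measurable_funM => //; exact: measurable_defect.
have mq : @measurable_fun _ _ (borel CN) (\bar R) setT q.
  by apply/(measurable_restrictT _ mZ)/measurable_EFinP; exact: measurable_funS mQ.
have mG : @measurable_fun _ _ (borel CN) (\bar R) setT G.
  by apply/(measurable_restrictT _ mB)/measurable_EFinP; exact: measurable_psi_class.
have Q0 z : 0 <= Q z.
  by rewrite /Q !mulr_ge0 ?powR_ge0// orlicz_ge0// divr_ge0 ?normc_ge0// ltW.
have G0 w : (0 <= G w)%E by apply: erestrict_ge0 => x _; exact: psi_normc_ge0.
have Phi0 w : (0 <= Phi w)%E by apply: erestrict_ge0 => x _; exact: psi_normc_ge0.
have q0 w : (0 <= q w)%E by apply: erestrict_ge0 => x _; rewrite lee_fin.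
have inrel z w : near_rel (z : borel CN, w : borel CN) -> B z /\ near_set z w by case.
have hsch : (\int[mu]_z Phi z <= (tau / 2)%:E * \int[va]_w G w)%E.
  apply: (@schur_bound _ (borel CN) R mu va (@near_rel R N) q G Phi (tau / 2)) => //.
  - by have := v_alpha_finite alpha1 N0 hpsi1.
  - exact: measurable_near_rel.
  - exact: ltW.
  - move=> z; rewrite /Phi patchE; case: ifPn => [|_]; last first.
      by apply: mule_ge0 => //; apply: integral_ge0 => w _; rewrite mule_ge0// lee_fin.
    rewrite inE => Zz; have [zB zr yY] := ZP z Zz; have dz : 0 < defect z by exact/unit_ball_defect.
    have [h1 _] := hC1 f z fcl dz.
    have p1 : 0 < psi1 (normc (f z) / C1) by apply: orlicz_gt0 => //; exact: lt_le_trans yY.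
    rewrite {1}/q patchE ifT ?inE//.
    rewrite (_ : (\int[va]_w _)%E = (\int[va]_(w in near_set z) (psi1 (normc (f w) / 2))%:E)%E); last first.
      rewrite [RHS]integral_mkcond; apply: eq_integral => w _.
      rewrite /G !patchE indicE; have [hw|hw] := pselect (near_set z w).
        rewrite ifT; last by rewrite inE; case: hw.
        rewrite [in RHS]ifT ?inE// (_ : _ \in _) ?mule1//.
        by rewrite inE.
      rewrite [in RHS]ifF; last by apply/negbTE; rewrite notin_setE.
      have -> : ((z : borel CN, w : borel CN) \in @near_rel R N) = false; last by rewrite mule0.
      by apply/negbTE; rewrite notin_setE => /inrel[].
    rewrite /Q EFinM EFinM -muleA; apply: (@le_trans _ _ ((psi2 (normc (f z) / e) * psi1 (normc (f z) / C1) `^ (-1))%:E * (psi1 (normc (f z) / C1))%:E)%E).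
      rewrite -EFinM lee_fin powR_inv1; last exact: ltW.
      by rewrite divfK//; exact: lt0r_neq0.
    rewrite -[in leRHS]EFinM; apply: lee_wpmul2l => //.
    by rewrite lee_fin mulr_ge0 ?powR_ge0// orlicz_ge0// divr_ge0 ?normc_ge0// ltW.
  - move=> w.
    apply: (@integral_le_sup_mul _ (borel CN) R mu (carleson_window ((real_complex R (hnorm w))^-1 *: w) (8 * defect w))).
    + exact: measurable_carleson_window.
    + apply: emeasurable_funM => //; apply/measurable_EFinP.
      apply: (measurableT_comp (f := fun p : borel CN * borel CN => \1_(@near_rel R N) p : R) (g := fun z => (z, w))); last exact: pair2_measurable.
      by apply: measurable_indic; exact: measurable_near_rel.
    + by move=> z; rewrite mule_ge0// lee_fin.
    + exact: ltW.
    + move=> z; rewrite indicE; have [|hw] := boolP ((z, w) \in @near_rel R N); last by rewrite mule0 eqxx.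
      rewrite mule1 inE => /inrel[zB hw]; rewrite /q patchE; case: ifPn => [|_]; last by rewrite eqxx.
      rewrite inE => Zz _; have [_ zr yY] := ZP z Zz.
      have dz : 0 < defect z by exact/unit_ball_defect.
      have [xi [xi1 [t0 [td [hwin xiE]]]]] := near_window hw zB (le_lt_trans r34 zr).
      have [_ h2] := hC1 f z fcl dz.
      rewrite -xiE; split => //.
      by rewrite /Q AY; apply: hy0.
have hG : (\int[va]_w G w <= 1)%E by rewrite /G -integral_mkcond.
have hPhi : (\int[mu]_z Phi z <= (tau / 2)%:E)%E.
  apply: (le_trans hsch); rewrite -[leRHS]mule1; apply: lee_wpmul2l => //.
  by rewrite lee_fin ltW.
(* Where |f| / C1 < y0 the integrand is at most psi2 (A y0), and r was chosen so that this
   contributes at most tau / 2. *)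
apply: (@le_trans _ _ (\int[mu]_(z in shell r) (Phi z + (psi2 (A * y0))%:E))%E).
  apply: ge0_le_integral => //.
  - exact: measurable_shell.
  - by move=> z _; exact: psi_normc_ge0.
  - by apply/measurable_EFinP; apply: measurable_funS m2 => // z [].
  - by apply: measurable_funTS; apply: emeasurable_funD.
  - move=> z [zB zr]; have [yY|yY] := leP y0 (Y z).
      rewrite /Phi patchE ifT; last by rewrite inE; split => //; split => //; rewrite /= in_itv/= yY.
      by rewrite leeDl// lee_fin ltW.
    apply: (@le_trans _ _ (psi2 (A * y0))%:E); last by rewrite leeDr.
    rewrite lee_fin AY; apply: (orlicz_le hpsi2); first by rewrite mulr_ge0// ltW.
    by rewrite ler_wpM2l ?ltW.
rewrite ge0_integralD//; last 3 first.
- exact: measurable_shell.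
- exact: measurable_funTS mPhi.
- by move=> z _; rewrite lee_fin ltW.
have i1 : (\int[mu]_(z in shell r) Phi z <= (tau / 2)%:E)%E.
  apply: le_trans hPhi; apply: ge0_subset_integral => //; exact: measurable_shell.
rewrite integral_cst; last exact: measurable_shell.
have i2 : ((psi2 (A * y0))%:E * mu (shell r) <= (tau / 2)%:E)%E.
  apply: le_trans (lee_wpmul2l _ hr) _; first by rewrite lee_fin ltW.
  by rewrite -EFinM lee_fin mulrC divfK// gt_eqF.
apply: (le_trans (leeD i1 i2)); rewrite -EFinD lee_fin; lra.
Qed.

End tail.

Lemma ultra_bounded_lim (R : realType) (X : Type) (G : set_system X) (h : X -> R) (M : R) :
  UltraFilter G -> G [set x | `|h x| <= M] ->
  exists c, forall e, 0 < e -> G [set x | `|h x - c| < e].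
Proof.
move=> GU GM.
have [c [_ hc]] : `[- M, M]%classic `&` cluster (h @ G) !=set0.
  apply: (@segment_compact R (- M) M (h @ G) (fmap_proper_filter h _)).
  have h2 : [set x | `|h x| <= M] `<=` h @^-1` `[- M, M].
    by move=> x /=; rewrite ler_norml in_itv.
  exact: (filterS h2 GM).
exists c => e e0.
have [//|hn] := in_ultra_setVsetC [set x | `|h x - c| < e] GU.
have nc : nbhs c [set y : R | `|y - c| < e].
  by exists e => //= y; rewrite /ball_/= distrC.
have hF : (h @ G) [set y : R | ~ (`|y - c| < e)] by exact: hn.
by have [y [h1 h2]] := hc _ _ hF nc.
Qed.

(** * Compactness through ultrafilters *)

Section modular_compactness.
Context d (T : measurableType d) (R : realType).
Variables (mu : {measure set T -> \bar R}) (D : set T) (mD : measurable D).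
Variables (psi : R -> R) (hpsi : orlicz_function psi).
Local Notation X := (orlicz_type mu D psi).

Lemma modular_sym (f g : T -> R[i]) e :
  orlicz_modular mu D psi (fun x => f x - g x) e = orlicz_modular mu D psi (fun x => g x - f x) e.
Proof. by apply: eq_integral => x _; rewrite normcB_sym. Qed.

(* Every ultrafilter on [S] having a limit, a filter on the closure of [S] is first
   moved to [S] by replacing its members by nearby elements of [S]. *)
Lemma compact_closure_ultra (S : set X) :
  (forall G : set_system X, UltraFilter G -> G S -> exists p : X, forall e, 0 < e ->
     G [set g : X | (orlicz_modular mu D psi (fun x => sval g x - sval p x)%R e <= 1)%E]) ->
  compact (closure S).
Proof.
move=> hS F FF FS.
have mX (g : X) : @measurable_fun _ _ T (borel R[i]) D (sval g) by case: (svalP g).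
pose E (A : set X) (e : R) : set X := [set g | S g /\ exists2 a, A a &
   (orlicz_modular mu D psi (fun x => sval g x - sval a x)%R e <= 1)%E].
pose G0 : set_system X := fun U => exists A e, [/\ F A, 0 < e & E A e `<=` U].
have G0P : ProperFilter G0.
  split.
    move=> [A [e [FA e0 EA]]].
    have [a [Aa Sa]] : A `&` closure S !=set0 by exact: (filter_ex (filterI FA FS)).
    have : nbhs a [set g : X | (orlicz_modular mu D psi (fun x => sval g x - sval a x)%R e <= 1)%E].
      by apply/(nbhs_orliczP mD hpsi); exists e.
    move=> /Sa[g [Sg hg]]; apply: (EA g).
    by split => //; exists a.
  split.
  - by exists setT, 1; split => //; exact: filterT.
  - move=> U V [A [e [FA e0 EA]]] [A' [e' [FA' e0' EA']]].
    exists (A `&` A'), (Num.min e e'); split; [exact: filterI|by rewrite lt_min e0|].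
    have lem (a g : X) t : Num.min e e' <= t ->
        (orlicz_modular mu D psi (fun x => sval g x - sval a x)%R (Num.min e e') <= 1)%E ->
        (orlicz_modular mu D psi (fun x => sval g x - sval a x)%R t <= 1)%E.
      move=> ht; apply: le_trans; apply: modular_le => //; first by rewrite lt_min e0.
      exact: measurable_normcB.
    move=> g [Sg [a [Aa Aa'] ha]]; split; [apply: EA|apply: EA']; split => //; exists a => //;
      by apply: lem ha; rewrite ge_min lexx ?orbT.
  - by move=> U V UV [A [e [FA e0 EA]]]; exists A, e; split => // g /EA/UV.
have [G [GU G0G]] := ultraFilterLemma G0P.
have GS : G S by apply: G0G; exists setT, 1; split => //; [exact: filterT|move=> g []].
have [p hp] := hS G GU GS.
exists p; split.
  move=> U /(nbhs_orliczP mD hpsi)[e e0 hU].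
  have [g [Sg hg]] : S `&` [set g : X | (orlicz_modular mu D psi (fun x => sval g x - sval p x)%R e <= 1)%E] !=set0.
    exact: (filter_ex (filterI GS (hp _ e0))).
  by exists g; split => //; exact: hU.
move=> A U FA /(nbhs_orliczP mD hpsi)[e e0 hU].
have e2 : 0 < e / 2 by exact: divr_gt0.
have GE : G (E A (e / 2)) by apply: (G0G (E A (e / 2))); exists A, (e / 2); split.
have [g [[Sg [a Aa ha]] hg]] := filter_ex (filterI GE (hp _ e2)).
exists a; split => //; apply: hU.
have ha' : (orlicz_modular mu D psi (fun x => sval a x - sval g x)%R (e / 2) <= 1)%E by rewrite modular_sym.
by have := modular_tri mD hpsi e2 e2 (mX a) (mX g) (mX p) ha' hg; rewrite -splitr.
Qed.

End modular_compactness.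

Section cells.
Context (R : realType) (N : nat).
Local Notation CN := 'rV[R[i]]_N.
Local Notation Re := complex.Re.
Local Notation Im := complex.Im.

(** Grid of side 1 / m on the real and imaginary parts, a finite partition that replaces a covering
    argument on smaller balls. Indices go up to 2 m inclusive, to allow a coordinate equal to 1. *)
Definition cell (m : nat) (z : CN) : {ffun 'I_N -> 'I_(2 * m).+1 * 'I_(2 * m).+1} :=
  [ffun j => (inord (Num.truncn ((Re (z ord0 j) + 1) * m%:R)), inord (Num.truncn ((Im (z ord0 j) + 1) * m%:R)))].

Lemma truncn_close (m : nat) (x y : R) : (0 < m)%N -> -1 <= x <= 1 -> -1 <= y <= 1 ->
  inord (Num.truncn ((x + 1) * m%:R)) = inord (Num.truncn ((y + 1) * m%:R)) :> 'I_(2 * m).+1 ->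
  `|x - y| <= m%:R^-1.
Proof.
move=> m0 hx hy.
have mp : 0 < m%:R :> R by rewrite ltr0n.
have tr (u : R) : -1 <= u <= 1 -> [/\ (Num.truncn ((u + 1) * m%:R) < (2 * m).+1)%N,
    (Num.truncn ((u + 1) * m%:R))%:R <= (u + 1) * m%:R & (u + 1) * m%:R < (Num.truncn ((u + 1) * m%:R)).+1%:R].
  move=> /andP[u1 u2]; have u0 : 0 <= (u + 1) * m%:R by rewrite mulr_ge0//; lra.
  have /andP[t1 t2] := truncn_itv u0; split => //.
  rewrite ltnS -(ler_nat R) natrM; apply: (le_trans t1); apply: ler_wpM2r => //; lra.
have [tx1 tx2 tx3] := tr x hx; have [ty1 ty2 ty3] := tr y hy.
move=> /(congr1 (@nat_of_ord _)); rewrite !inordK// => exy.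
rewrite exy in tx2 tx3; move: tx2 tx3 ty2 ty3; rewrite -natr1; move: ((Num.truncn ((y + 1) * m%:R))%:R : R) => t tx2 tx3 ty2 ty3.
rewrite -(@ler_pM2r _ m%:R)// mulVf ?gt_eqF// -{1}(gtr0_norm mp) -normrM ler_norml; apply/andP; split; lra.
Qed.

Lemma cell_close m (z w : CN) : (0 < m)%N -> hnorm z <= 1 -> hnorm w <= 1 -> cell m z = cell m w ->
  hnorm (z - w) <= 2 * N%:R / m%:R.
Proof.
move=> m0 z1 w1 /ffunP hc.
have rng (u : CN) j : hnorm u <= 1 -> -1 <= Re (u ord0 j) <= 1 /\ -1 <= Im (u ord0 j) <= 1.
  move=> u1; have h := le_trans (normc_coord_le u j) u1.
  have h1 := le_trans (Re_le_normc _) h; have h2 := le_trans (Im_le_normc _) h.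
  by rewrite !ler_norml in h1 h2.
apply: (le_trans (enorm_le_sum _)).
apply: (@le_trans _ _ (\sum_(j < N) (2 / m%:R : R))); last first.
  by rewrite sumr_const card_ord -[leLHS]mulr_natr mulrAC.
apply: ler_sum => j _; apply: (le_trans (normc_le_ReIm _)).
have [z2 z3] := rng z j z1; have [w2 w3] := rng w j w1.
have := hc j; rewrite !ffunE => -[e1 e2].
have a1 := truncn_close m0 z2 w2 e1; have a2 := truncn_close m0 z3 w3 e2.
rewrite !mxE; have ReB (u v : R[i]) : Re (u - v) = Re u - Re v by case: u; case: v.
have ImB (u v : R[i]) : Im (u - v) = Im u - Im v by case: u; case: v.
rewrite ReB ImB; move: a1 a2; move: (m%:R^-1 : R) => t; lra.
Qed.

End cells.

(** * Limits of ultrafilters in the Bergman-Orlicz class *)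

Section embedding.
Context (R : realType) (N : nat).
Local Notation CN := 'rV[R[i]]_N.
Local Notation normc := Normc.normc.
Local Notation B := (@unit_ball R N).
Variable alpha : R.
Hypothesis alpha1 : -1 < alpha.
Hypothesis N0 : (0 < N)%N.
Local Notation s := (N%:R + 1 + alpha).
Local Notation va := (@v_alpha R N alpha).
Variable mu : {finite_measure set (borel CN) -> \bar R}.
Variables psi1 psi2 : R -> R.
Hypotheses (hpsi1 : orlicz_function psi1) (hpsi2 : orlicz_function psi2).
Local Notation cls := (@bergman_class R N alpha psi1).

Lemma class_bounded r : 0 <= r -> r < 1 -> exists2 M : R, 0 < M &
  forall f z, cls f -> hnorm z <= r -> normc (f z) <= M.
Proof.
move=> r0 r1; have [C1 C10 hC1] := class_psi_bound alpha1 N0 hpsi1.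
have r2 : 0 < 1 - r ^+ 2 by rewrite subr_gt0 -(expr1n _ 2) ltr_pXn2r ?nnegrE.
have [X X0 hX] := orlicz_unbounded hpsi1 ((16 * (1 - r ^+ 2)) `^ (- s)).
exists (C1 * X + 1); first by rewrite ltr_wpDl// mulr_ge0// ltW.
move=> f z fc zr.
have dz : 1 - r ^+ 2 <= defect z.
  by rewrite /defect lerD2l lerN2; apply: lerXn2r; rewrite ?nnegrE ?enorm_ge0.
have d0 : 0 < defect z by exact: lt_le_trans dz.
have [_ h] := hC1 f z fc d0.
have le1 : psi1 (normc (f z) / C1) <= psi1 X.
  apply: (le_trans h); apply: le_trans hX; apply: ler_powR_npos; first exact: mulr_gt0.
    by rewrite ler_pM2l.
  by rewrite oppr_le0; apply: ltW; exact: lt_trans ltr01 (dim_gt0 alpha1 N0).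
have := orlicz_le_inv hpsi1 X0 le1; rewrite ler_pdivrMr// mulrC => h2.
by apply: (le_trans h2); rewrite lerDl.
Qed.

(** On the line u -> z + u (z' - z) the two points are u = 0 and u = 1. The square of half side rho
    stays in the ball of radius (1 + r) / 2, where the class is bounded, and |z' - z| <= (1 - r) / 8
    gives rho >= 2; [holo_square_lip] then yields a bound proportional to 1 / rho. *)
Lemma class_equicont r : 0 <= r -> r < 1 -> exists2 L : R, 0 < L &
  forall f z z', cls f -> hnorm z <= r -> hnorm (z' - z) <= (1 - r) / 8 ->
    normc (f z' - f z) <= L * hnorm (z' - z).
Proof.
move=> r0 r1; have r10 : 0 <= (1 + r) / 2 by lra.
have r11 : (1 + r) / 2 < 1 by lra.
have [M M0 hM] := class_bounded r10 r11.
have r3 : 0 < 1 - r by rewrite subr_gt0.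
exists (16 * M / (1 - r)); first by rewrite divr_gt0// mulr_gt0.
move=> f z z' fc zr dr; set dd := z' - z in dr *.
have [d0|d0] := eqVneq (hnorm dd) 0.
  have z'z : z' = z by apply/eqP; rewrite -subr_eq0; apply/eqP/enorm0_eq0.
  by rewrite z'z subrr Normc.normc0 d0 mulr0.
have dp : 0 < hnorm dd by rewrite lt_neqAle eq_sym d0 enorm_ge0.
pose rho := (1 - r) / (4 * hnorm dd).
have rd : rho * hnorm dd = (1 - r) / 4 by rewrite /rho; field.
have rho2 : 2 <= rho.
  by rewrite /rho ler_pdivlMr ?mulr_gt0//; move: dr; move: (hnorm dd) => t; lra.
pose F (u : R[i]) := f (z + u *: dd).
have inside x y : - rho <= x <= rho -> - rho <= y <= rho -> hnorm (z + Complex x y *: dd) <= (1 + r) / 2.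
  move=> hx hy; apply: (le_trans (enormD _ _)); rewrite enormZ.
  have nx : normc (Complex x y) <= 2 * rho.
    apply: (le_trans (normc_le_ReIm _)) => /=.
    have : `|x| <= rho by rewrite ler_norml.
    have : `|y| <= rho by rewrite ler_norml.
    lra.
  have : normc (Complex x y) * hnorm dd <= 2 * rho * hnorm dd by rewrite ler_pM2r.
  by rewrite -mulrA rd; move: (normc _ * _) => t; lra.
have hF : holo_square F rho.
  move=> x y hx hy; apply: (holomorphic_cdiff fc.1).
  rewrite /unit_ball/= enormE; apply: le_lt_trans (inside x y hx hy) _; lra.
have hFM x y : - rho <= x <= rho -> - rho <= y <= rho -> normc (F (Complex x y)) <= M.
  by move=> hx hy; apply: hM => //; exact: inside.
have := holo_square_lip rho2 hF hFM.
have zdd : z + dd = z' by rewrite /dd addrC subrK.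
rewrite /F scale1r scale0r addr0 zdd => h; apply: (le_trans h).
by rewrite /rho le_eqVlt; apply/orP; left; apply/eqP; field; rewrite d0/= gt_eqF.
Qed.

Local Notation X := (orlicz_type mu B psi2).

Section limit.
Variables (G : set_system X) (S : set X).
Hypotheses (GU : UltraFilter G) (GS : G S) (SC : forall g : X, S g -> cls (sval g)).

(** At each point the real and imaginary parts are bounded on the class, so they converge along the
    ultrafilter. The choice outside the ball is arbitrary. *)
Lemma pointwise_limit : exists fs : CN -> R[i], forall z, B z -> forall e, 0 < e ->
  G [set g : X | normc (sval g z - fs z) < e].
Proof.
have hz z : exists c : R[i], B z -> forall e, 0 < e -> G [set g : X | normc (sval g z - c) < e].
  have [zB|zB] := pselect (B z); last by exists 0.
  have z1 : hnorm z < 1 by move: zB; rewrite /unit_ball/= enormE.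
  have [M M0 hM] := class_bounded (enorm_ge0 z) z1.
  have b1 : G [set g : X | `|complex.Re (sval g z)| <= M].
    apply: (filterS _ GS) => g Sg /=; apply: (le_trans (Re_le_normc _)).
    by apply: hM => //; exact: SC.
  have b2 : G [set g : X | `|complex.Im (sval g z)| <= M].
    apply: (filterS _ GS) => g Sg /=; apply: (le_trans (Im_le_normc _)).
    by apply: hM => //; exact: SC.
  have [a ha] := ultra_bounded_lim GU b1; have [b hb] := ultra_bounded_lim GU b2.
  exists (Complex a b) => _ e e0; have e2 : 0 < e / 2 by exact: divr_gt0.
  apply: (filterS _ (filterI (ha _ e2) (hb _ e2))) => g [] /= h1 h2.
  apply: (le_lt_trans (normc_le_ReIm _)).
  have -> : complex.Re (sval g z - Complex a b) = complex.Re (sval g z) - a by case: (sval g z).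
  have -> : complex.Im (sval g z - Complex a b) = complex.Im (sval g z) - b by case: (sval g z).
  by rewrite (splitr e) ltrD.
have [fs hfs] := choice hz.
by exists fs => z zB e e0; exact: hfs.
Qed.

Variable fs : CN -> R[i].
Hypothesis hfs : forall z, B z -> forall e, 0 < e -> G [set g : X | normc (sval g z - fs z) < e].

Lemma limit_equicont r : 0 <= r -> r < 1 -> exists2 L : R, 0 < L &
  forall f z z', cls f \/ f = fs -> hnorm z <= r -> hnorm (z' - z) <= (1 - r) / 8 ->
    normc (f z' - f z) <= L * hnorm (z' - z).
Proof.
move=> r0 r1; have [L L0 hL] := class_equicont r0 r1.
exists L => // f z z' [fc|->] zr dr; first exact: hL.
have z1 : hnorm z < 1 by exact: le_lt_trans r1.
have zB : B z by rewrite /unit_ball/= enormE.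
have z'B : B z'.
  rewrite /unit_ball/= enormE; have := enormD (z' - z) z; rewrite subrK => h.
  apply: (le_lt_trans h); lra.
apply/ler_addgt0Pr => e e0; have e2 : 0 < e / 2 by exact: divr_gt0.
have [g [Sg [h1 h2]]] := filter_ex (filterI GS (filterI (hfs zB e2) (hfs z'B e2))).
rewrite /= in h1 h2; have h3 := hL _ z z' (SC Sg) zr dr.
have t1 := normcB_tri (fs z') (sval g z') (fs z).
have t2 := normcB_tri (sval g z') (sval g z) (fs z).
rewrite (normcB_sym (fs z') (sval g z')) in t1.
rewrite (splitr e); move: (L * _) h3 => t h3; lra.
Qed.

(** One representative for each of the finitely many cells meeting the ball of radius r: pointwise
    convergence there holds simultaneously along the ultrafilter, and equicontinuity of both g and
    the limit carries it to the whole cell, with eta / 3 for each of the three errors. *)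
Lemma limit_uniform r eta : 0 <= r -> r < 1 -> 0 < eta ->
  G [set g : X | S g /\ forall z, hnorm z <= r -> normc (sval g z - fs z) <= eta].
Proof.
move=> r0 r1 eta0; have [L L0 hL] := limit_equicont r0 r1.
have e3 : 0 < eta / 3 by exact: divr_gt0.
pose k := Num.min ((1 - r) / 8) (eta / 3 / L).
have k0 : 0 < k by rewrite /k lt_min !divr_gt0// subr_gt0.
pose m := (Num.truncn (2 * N%:R / k)).+1.
have mk : 2 * N%:R / m%:R <= k.
  have : 2 * N%:R / k <= m%:R by exact/ltW/truncnS_gt.
  by rewrite ler_pdivrMr// => h; rewrite ler_pdivrMr ?ltr0n// [k * _]mulrC.
pose P (q : {ffun 'I_N -> 'I_(2 * m).+1 * 'I_(2 * m).+1}) : set X :=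
  [set g | exists z0 : CN, (exists2 z, hnorm z <= r & cell m z = q) ->
     [/\ hnorm z0 <= r, cell m z0 = q & normc (sval g z0 - fs z0) < eta / 3]].
have GP : \forall g \near G, forall q, P q g.
  apply: filter_forall => q.
  have [[z zr zq]|hn] := pselect (exists2 z, hnorm z <= r & cell m z = q); last first.
    by apply: filterS filterT => g _; exists 0 => /hn.
  have zB : B z by rewrite /unit_ball/= enormE; exact: le_lt_trans r1.
  by apply: (filterS _ (hfs zB e3)) => g hg; exists z.
apply: (filterS _ (filterI GS GP)) => g [Sg hg]; split => // z zr.
have [z0] := hg (cell m z); case; first by exists z.
move=> z0r z0q h0.
have dz : hnorm (z - z0) <= k.
  have le1 (u : CN) : hnorm u <= r -> hnorm u <= 1 by move=> h; exact: le_trans h (ltW r1).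
  exact: le_trans (cell_close (ltn0Sn _) (le1 _ zr) (le1 _ z0r) (esym z0q)) mk.
have dk1 : hnorm (z - z0) <= (1 - r) / 8 by apply: (le_trans dz); rewrite /k ge_min lexx.
have dk2 : L * hnorm (z - z0) <= eta / 3.
  have : hnorm (z - z0) <= eta / 3 / L by apply: (le_trans dz); rewrite /k ge_min lexx orbT.
  by rewrite ler_pdivlMr// mulrC.
have h1 := le_trans (hL _ z0 z (or_introl (SC Sg)) z0r dk1) dk2.
have h2 := le_trans (hL _ z0 z (or_intror erefl) z0r dk1) dk2.
have t1 := normcB_tri (sval g z) (sval g z0) (fs z).
have t2 := normcB_tri (sval g z0) (fs z0) (fs z).
rewrite (normcB_sym (fs z0)) in t2; lra.
Qed.

(** The closure is taken in L^psi2, so the limit only has to be a measurable function; continuity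
    inherited from the equicontinuity gives this without proving holomorphy. *)
Lemma limit_measurable : @measurable_fun _ _ (borel CN) (borel R[i]) B fs.
Proof.
apply: measurable_continuous_on; first exact: open_unit_ball.
move=> z zB; apply: continuous_enorm_normc => e e0.
have z1 : hnorm z < 1 by move: zB; rewrite /unit_ball/= enormE.
have [L L0 hL] := limit_equicont (enorm_ge0 z) z1.
exists (Num.min ((1 - hnorm z) / 8) (e / L)).
  by rewrite lt_min !divr_gt0// subr_gt0.
move=> w; rewrite lt_min => /andP[w1 w2].
apply: (le_lt_trans (hL fs z w (or_intror erefl) (lexx _) (ltW w1))).
by rewrite mulrC -ltr_pdivlMr.
Qed.

(** Fatou's lemma needs a sequence, not an ultrafilter: a g_n in S within 1 / (n+1) of the limit on
    the ball of radius 1 - 1 / (n+1) is picked for each n. *)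
Lemma limit_tail r e M : 0 < e -> (forall f, cls f -> (orlicz_modular mu (shell r) psi2 f e <= M)%E) ->
  (orlicz_modular mu (shell r) psi2 fs e <= M)%E.
Proof.
move=> e0 hM.
have hn n : exists g : X, S g /\ forall z, hnorm z <= 1 - (n.+1%:R)^-1 -> normc (sval g z - fs z) <= (n.+1%:R)^-1.
  have i0 : 0 < (n.+1%:R)^-1 :> R by rewrite invr_gt0.
  have i1 : (n.+1%:R)^-1 <= 1 :> R by rewrite invf_le1// ler1n.
  have r0 : 0 <= 1 - (n.+1%:R)^-1 :> R by rewrite subr_ge0.
  have r1 : 1 - (n.+1%:R)^-1 < 1 :> R by rewrite ltrBlDr ltrDl.
  exact: (filter_ex (limit_uniform r0 r1 i0)).
have [g hg] := choice hn.
have sB : shell r `<=` B by move=> z [].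
apply: (@modular_fatou _ (borel CN) R mu (shell r) psi2 (fun n => sval (g n)) fs e M (measurable_shell r) hpsi2 e0).
- move=> n; apply: (measurable_normc (T := borel CN)).
  apply: (measurable_funS (@measurable_unit_ballC R N) sB).
  by apply: holomorphic_measurable; case: (SC (hg n).1).
- move=> z [zB _]; have z1 : 0 < 1 - hnorm z by move: zB; rewrite /unit_ball/= enormE subr_gt0.
  apply/cvgrPdist_le => eta eta0.
  pose k := Num.min eta (1 - hnorm z); have k0 : 0 < k by rewrite /k lt_min eta0.
  exists (Num.truncn k^-1) => // n /= kn.
  have nk : (n.+1%:R)^-1 <= k.
    rewrite -[X in _ <= X]invrK lef_pV2 ?posrE ?invr_gt0//.
    by apply: (le_trans (ltW (truncnS_gt _))); rewrite ler_nat.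
  have h1 : normc (sval (g n) z - fs z) <= eta.
    apply: (@le_trans _ _ (n.+1%:R)^-1).
      apply: (hg n).2; have : (n.+1%:R)^-1 <= 1 - hnorm z by apply: (le_trans nk); rewrite /k ge_min lexx orbT.
      by move: ((n.+1%:R)^-1 : R) => t; lra.
    by apply: (le_trans nk); rewrite /k ge_min lexx.
  have t1 := normcB_tri (sval (g n) z) (fs z) 0; have t2 := normcB_tri (fs z) (sval (g n) z) 0.
  rewrite !subr0 in t1 t2; rewrite (normcB_sym (fs z)) in t2.
  by rewrite ler_norml; apply/andP; split; lra.
- by move=> n; apply: hM; exact: SC (hg n).1.
Qed.

End limit.

Lemma modular_le1 d (T : measurableType d) (m : {measure set T -> \bar R}) (D : set T) psi (f : T -> R[i]) C :
  measurable D -> orlicz_function psi -> measurable_fun D (fun x => normc (f x)) -> 0 < C ->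
  (orlicz_modular m D psi f C < +oo)%E ->
  exists2 C', 0 < C' & (orlicz_modular m D psi f C' <= 1)%E.
Proof.
move=> mD hpsi mf C0 hfin.
have m0 : (0 <= orlicz_modular m D psi f C)%E by apply: integral_ge0 => x _; exact: psi_normc_ge0.
pose a := fine (orlicz_modular m D psi f C).
have aE : orlicz_modular m D psi f C = a%:E by rewrite fineK// ge0_fin_numE.
have a0 : 0 <= a by exact: fine_ge0.
have a1 : 0 < 1 + a by rewrite ltr_pwDl.
have t1 : 0 < (1 + a)^-1 <= 1 by rewrite invr_gt0 a1 invf_le1// lerDl.
exists (C / (1 + a)^-1); first by rewrite divr_gt0// invr_gt0.
apply: (le_trans (modular_scale m mD hpsi C0 t1 mf)).
by rewrite aE -EFinM lee_fin mulrC ler_pdivrMr// mul1r lerDr.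
Qed.

Lemma class_of_norm f : bergman_orlicz alpha psi1 f -> (bergman_norm alpha psi1 f <= 1)%E -> cls f.
Proof.
move=> [hf [mf _]] hn; split => //.
have [C /andP[C0 C2] hC] : exists2 C, 0 < C < 2 & (orlicz_modular va B psi1 f C <= 1)%E.
  by apply: luxemburg_lt; apply: (le_lt_trans hn); rewrite lte_fin ltr1n.
apply: le_trans hC; apply: modular_le => //; [exact: measurable_unit_ballC|exact: ltW|].
exact: (measurable_normc (T := borel CN)).
Qed.

Lemma modular_shell_le (u : CN -> R[i]) r e M : 0 < e -> 0 <= M ->
  @measurable_fun _ _ (borel CN) R B (fun z => normc (u z)) ->
  (forall z, B z -> hnorm z <= r -> normc (u z) <= M) ->
  (orlicz_modular mu B psi2 u e <= (psi2 (M / e))%:E * mu B + orlicz_modular mu (shell r) psi2 u e)%E.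
Proof.
move=> e0 M0 mu_ hu; have mB := @measurable_unit_ballC R N.
have sB : shell r `<=` B by move=> z [].
have mF : @measurable_fun _ _ (borel CN) (\bar R) B (fun z => (psi2 (normc (u z) / e))%:E).
  apply/measurable_EFinP; apply: (measurable_psi_normc (T := borel CN)) => //.
have P0 : 0 <= psi2 (M / e) by apply: orlicz_ge0 => //; rewrite divr_ge0// ltW.
pose g := (fun z => (psi2 (normc (u z) / e))%:E) \_ (shell r).
have mg : @measurable_fun _ _ (borel CN) (\bar R) setT g.
  by apply/(measurable_restrictT _ (measurable_shell r)); exact: measurable_funS mF.
have g0 z : (0 <= g z)%E by apply: erestrict_ge0 => x _; exact: psi_normc_ge0.
apply: (@le_trans _ _ (\int[mu]_(z in B) ((psi2 (M / e))%:E + g z))%E).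
  apply: ge0_le_integral => //.
  - by move=> z _; exact: psi_normc_ge0.
  - by apply: emeasurable_funD => //; exact: measurable_funTS mg.
  - move=> z zB; have [zr|zr] := leP (hnorm z) r.
      apply: (@le_trans _ _ (psi2 (M / e))%:E); last by rewrite leeDl.
      rewrite lee_fin; apply: (orlicz_le hpsi2); first by rewrite divr_ge0 ?normc_ge0// ltW.
      by apply: ler_wpM2r; [rewrite invr_ge0 ltW|exact: hu].
    by rewrite /g patchE ifT ?leeDr ?lee_fin// inE.
rewrite ge0_integralD//; last exact: measurable_funTS mg.
rewrite integral_cst//; apply: leeD => //.
rewrite /orlicz_modular [leRHS]integral_mkcond; apply: ge0_subset_integral => //.
Qed.

Lemma ball_fin : exists2 b : R, 0 <= b & (mu B = b%:E)%E.
Proof.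
have h : mu B \is a fin_num by apply: fin_num_measure; exact: measurable_unit_ballC.
by exists (fine (mu B)); [exact: fine_ge0|rewrite fineK].
Qed.

Lemma orlicz_space_of_tail (u : CN -> R[i]) r M : 0 <= M ->
  @measurable_fun _ _ (borel CN) (borel R[i]) B u ->
  (forall z, B z -> hnorm z <= r -> normc (u z) <= M) ->
  (orlicz_modular mu (shell r) psi2 u 1 <= 1%:E)%E -> orlicz_space mu B psi2 u.
Proof.
move=> M0 mu_ hu ht; split => //; exists 1 => //.
apply: (le_lt_trans (modular_shell_le ltr01 M0 (measurable_normc (T := borel CN) mu_) hu)).
have [b b0 ->] := ball_fin.
apply: (@le_lt_trans _ _ ((psi2 (M / 1))%:E * b%:E + 1%:E)%E); first exact: leeD.
by rewrite -EFinM -EFinD ltry.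
Qed.

Lemma K0_embeds : cond_K0 alpha mu psi1 psi2 -> bergman_embeds alpha mu psi1 psi2.
Proof.
move=> hK f [hf [mf [C C0 hC]]].
have mB := @measurable_unit_ballC R N.
have mn : @measurable_fun _ _ (borel CN) R B (fun z => normc (f z)) by exact: (measurable_normc (T := borel CN)).
have [C' C'0 hC'] := modular_le1 mB hpsi1 mn C0 hC.
(* Rescales f to the scale 2 of [bergman_class]; the factor is returned at the end to the Luxemburg
   parameter. *)
pose k := 2 / C'; have k0 : 0 < k by exact: divr_gt0.
pose f' (z : CN) : R[i] := real_complex R k * f z.
have nf' z : normc (f' z) = k * normc (f z) by rewrite Normc.normcM normc_real gtr0_norm.
have fc : cls f'.
  split.
    move=> z zB; have hd : differentiable (fun z : CN => (real_complex R k) *: (f z : R[i]^o)) z.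
      by apply: differentiableZ; exact: hf.
    exact: hd.
  rewrite (_ : orlicz_modular va B psi1 f' 2 = orlicz_modular va B psi1 f C')//.
  by apply: eq_integral => z _; rewrite nf'; congr (psi1 _)%:E; rewrite /k; field; rewrite gt_eqF.
have [r [r34 r1 hr]] := tail_estimate alpha1 N0 hpsi1 hpsi2 hK ltr01 ltr01.
have r0 : 0 <= r by apply: le_trans r34; rewrite divr_ge0.
have [M M0 hM] := class_bounded r0 r1.
have mf' : @measurable_fun _ _ (borel CN) (borel R[i]) B f' by apply: holomorphic_measurable; case: fc.
have [_ [E E0 hE]] : orlicz_space mu B psi2 f'.
  apply: (@orlicz_space_of_tail f' r M (ltW M0) mf'); last exact: hr.
  by move=> z _ zr; exact: hM.
split => //; exists (E / k); first exact: divr_gt0.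
rewrite (_ : orlicz_modular mu B psi2 f (E / k) = orlicz_modular mu B psi2 f' E)//.
by apply: eq_integral => z _; rewrite nf'; congr (psi2 _)%:E; field; rewrite !gt_eqF.
Qed.

Lemma K0_compact : cond_K0 alpha mu psi1 psi2 -> compact_inclusion alpha mu psi1 psi2.
Proof.
move=> hK; have mB := @measurable_unit_ballC R N.
apply: (compact_closure_ultra mB hpsi2) => G GU GS.
set S := [set g : X | _] in GS.
have SC (g : X) : S g -> cls (sval g) by move=> [h1 h2]; exact: class_of_norm.
have [fs hfs] := pointwise_limit GU GS SC.
have mfs := limit_measurable GU GS SC hfs.
have fsO : orlicz_space mu B psi2 fs.
  have [r [r34 r1 hr]] := tail_estimate alpha1 N0 hpsi1 hpsi2 hK ltr01 ltr01.
  have r0 : 0 <= r by apply: le_trans r34; rewrite divr_ge0.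
  have [M M0 hM] := class_bounded r0 r1.
  have [g [Sg hg]] := filter_ex (limit_uniform GU GS SC hfs r0 r1 ltr01).
  apply: (@orlicz_space_of_tail fs r (M + 1)) => //; first by rewrite addr_ge0// ltW.
    move=> z _ zr; have h1 := hM _ _ (SC _ Sg) zr; have h2 := hg z zr.
    have t := normcB_tri (fs z) (sval g z) 0; rewrite !subr0 normcB_sym in t.
    by apply: (le_trans t); rewrite addrC; exact: lerD.
  exact: (limit_tail GU GS SC hfs ltr01 hr).
exists (exist _ fs fsO) => e e0 /=.
(* On the shell, g and the limit have modular at most 1 at scale e / 4; their difference has modular
   at most 1 at scale e / 2, hence at most 1 / 2 at scale e by convexity. *)
have e4 : 0 < e / 4 by exact: divr_gt0.
have [r [r34 r1 hr]] := tail_estimate alpha1 N0 hpsi1 hpsi2 hK e4 ltr01.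
have r0 : 0 <= r by apply: le_trans r34; rewrite divr_ge0.
have hrs := limit_tail GU GS SC hfs e4 hr.
have [b b0 bE] := ball_fin.
have p1 : 0 < psi2 1 by exact: orlicz_gt0.
(* A uniform distance e t on the inner ball contributes at most psi2 t mu B <= t psi2 1 mu B <= 1 /
   2, the other half of the modular. *)
pose t := (1 + 2 * (psi2 1 * b))^-1.
have t0' : 0 < 1 + 2 * (psi2 1 * b) by rewrite ltr_pwDl// !mulr_ge0// ltW.
have t0 : 0 < t by rewrite invr_gt0.
have t1 : t <= 1 by rewrite invf_le1// lerDl !mulr_ge0// ltW.
apply: (filterS _ (limit_uniform GU GS SC hfs r0 r1 (mulr_gt0 e0 t0))) => g [Sg hg] /=.
have mg : @measurable_fun _ _ (borel CN) (borel R[i]) B (sval g) by case: (svalP g).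
have mgf : @measurable_fun _ _ (borel CN) R B (fun z => normc (sval g z - fs z)).
  exact: (measurable_normcB (T := borel CN)).
have sB : shell r `<=` B by move=> z [].
have hsh : (orlicz_modular mu (shell r) psi2 (fun z => sval g z - fs z)%R e <= (2^-1)%:E)%E.
  have mS := @measurable_shell R N r.
  have a1 : (orlicz_modular mu (shell r) psi2 (fun z => sval g z - 0)%R (e / 4) <= 1)%E.
    rewrite (_ : orlicz_modular _ _ _ _ _ = orlicz_modular mu (shell r) psi2 (sval g) (e / 4)).
      by apply: hr; exact: SC.
    by apply: eq_integral => z _; rewrite subr0.
  have a2 : (orlicz_modular mu (shell r) psi2 (fun z => 0 - fs z)%R (e / 4) <= 1)%E.
    rewrite (_ : orlicz_modular _ _ _ _ _ = orlicz_modular mu (shell r) psi2 fs (e / 4))//.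
    by apply: eq_integral => z _; rewrite sub0r normcN.
  have m1 := measurable_funS mB sB mg; have m2 := measurable_funS mB sB mfs.
  have := modular_tri mS hpsi2 e4 e4 m1 (@measurable_cst _ _ (borel CN) (borel R[i]) (shell r) (0 : R[i])) m2 a1 a2.
  have -> : e / 4 + e / 4 = e / 2 by field.
  move=> a3; have h21 : 0 < (2^-1 : R) <= 1 by rewrite invr_gt0 ltr0n invf_le1 ?ler1n.
  have e2 : 0 < e / 2 by exact: divr_gt0.
  have := modular_scale mu mS hpsi2 e2 h21 (measurable_funS mB sB mgf).
  rewrite (_ : e / 2 / 2^-1 = e); last by field.
  move=> a4; apply: (le_trans a4); rewrite -[leRHS]mule1; exact: lee_wpmul2l.
have et0 : 0 <= e * t by rewrite mulr_ge0// ltW.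
have := modular_shell_le (r := r) e0 et0 mgf (fun z _ => hg z).
rewrite bE => h; apply: (le_trans h).
apply: (@le_trans _ _ ((2^-1)%:E + (2^-1)%:E)%E); last by rewrite -EFinD lee_fin; lra.
apply: leeD => //; rewrite -EFinM lee_fin.
have -> : e * t / e = t * 1 by field; rewrite gt_eqF.
have st : psi2 (t * 1) <= t * psi2 1 by apply: orlicz_scale => //; rewrite (ltW t0).
apply: (le_trans (ler_wpM2r b0 st)).
have te : t * (1 + 2 * (psi2 1 * b)) = 1 by rewrite mulVf// gt_eqF.
have te' : 2 * (t * psi2 1 * b) = t * (1 + 2 * (psi2 1 * b)) - t by ring.
rewrite te in te'.
by rewrite -[leRHS]mul1r ler_pdivlMr// mulrC te' lerBlDl lerDr ltW.
Qed.

End embedding.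

Theorem theorem2p9 (R : realType) (N : nat) (hN : (1 <= N)%N)
    (alpha : R) (halpha : -1 < alpha)
    (mu : {finite_measure set (borel 'rV[R[i]]_N) -> \bar R})
    (hmu : mu (~` @unit_ball R N) = 0%E)
    (psi1 psi2 : R -> R)
    (hpsi1 : orlicz_function psi1) (hpsi2 : orlicz_function psi2) :
  (embeds_compactly alpha mu psi1 psi2 -> cond_R0 alpha mu psi1 psi2) /\
  (cond_K0 alpha mu psi1 psi2 -> embeds_compactly alpha mu psi1 psi2) /\
  ((forall x, 0 <= x -> psi1 x = psi2 x) -> nabla0 psi1 ->
    (cond_R0 alpha mu psi1 psi2 <-> cond_K0 alpha mu psi1 psi2)).
Proof.
split; first exact: embeds_compactly_R0.
split; first by move=> hK; split; [exact: K0_embeds|exact: K0_compact].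
by move=> e12 hn; split; [exact: nabla0_R0_K0|exact: K0_R0].
Qed.
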